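(* There exist constants $c_{ru}^-,c_{ru}^+$ with $\frac{\log 2}{5}\le c_{ru}^-\le c_{ru}^+\le\frac{\log 2}{3}$ such that almost all posets $P$ on $N$ elements satisfy \[c_{ru}^-\le c_{\mathrm{Ram}^-}(P,P)\le c_{\mathrm{Ram}^+}(P,P)\le c_{ru}^+ + O(1/\log N).\]
   Context: ''Almost all posets on $N$ elements satisfy X'' means that the proportion of partial orders on a fixed labelled $N$-element set satisfying X tends to $1$ as $N\to\infty$ (here with an $O(1/\log N)$ term uniform over these posets). A poset $R$ contains a copy of $F$ if there is an injective map $\phi:F\to R$ with $x\le_F y\Rightarrow\phi(x)\le_R\phi(y)$. $R\to(P,Q)$ means every colouring of $R$ with colours $1,2$ contains a copy of $P$ in colour 1 or a copy of $Q$ in colour 2. $\mathcal{P}(n,p)$ is the random subposet of the power set of $[n]$ (inclusion order) keeping each set independently with probability $p$. $c_{\mathrm{Ram}^-}(P,Q)=\sup\{c>0:\mathcal{P}(n,e^{-cn})\to(P,Q)\text{ with probability}\to1\}$ and $c_{\mathrm{Ram}^+}(P,Q)=\inf\{c>0:\mathcal{P}(n,e^{-cn})\not\to(P,Q)\text{ with probability}\to1\}$, as $n\to\infty$. *)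

(* Defs.v *)
From HB Require Import structures.
From mathcomp Require Import all_boot all_order all_algebra.
From mathcomp Require Import all_classical all_reals all_analysis.
Import Order.TTheory GRing.Theory Num.Theory.
Import Order.DefaultSetSubsetOrder. (* orders [{set T}] by inclusion *)
Import numFieldNormedType.Exports.

Set Implicit Arguments.
Unset Strict Implicit.
Unset Printing Implicit Defensive.

Local Open Scope classical_set_scope.
Local Open Scope ring_scope.

(* [phi] need not reflect the order: this is the non-induced notion. *)
Definition contains_copy_in (dF dR : Order.disp_t) (F : porderType dF)
    (R : porderType dR) (D : set R) : Prop :=
  exists phi : F -> R,
    [/\ injective phi, {homo phi : x y / (x <= y)%O} & forall x, D (phi x)].

(* The two colours are [true] and [false]. *)
Definition arrows (dR dP dQ : Order.disp_t) (R : porderType dR)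
    (P : porderType dP) (Q : porderType dQ) : Prop :=
  forall col : R -> bool,
    contains_copy_in P [set x : R | col x = true] \/
    contains_copy_in Q [set x : R | col x = false].

Definition subposet (n : nat) (A : {set {set 'I_n}}) : Type :=
  {S : {set 'I_n} | S \in A}.

HB.instance Definition _ (n : nat) (A : {set {set 'I_n}}) :=
  SubChoice.on (subposet A).
HB.instance Definition _ (n : nat) (A : {set {set 'I_n}}) :=
  [SubChoice_isSubPOrder of subposet A by <:
     with Order.SetSubsetOrder.subset_display].

Definition random_subset_pr (R : realType) (n : nat) (p : R)
    (E : set {set {set 'I_n}}) : R :=
  \sum_(A : {set {set 'I_n}} | A \in E)
    \prod_(S : {set 'I_n}) (if S \in A then p else 1 - p).

Definition arrows_event (dP dQ : Order.disp_t) (P : porderType dP)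
    (Q : porderType dQ) (n : nat) : set {set {set 'I_n}} :=
  [set A | arrows (subposet A) P Q].
Arguments arrows_event {dP dQ} P Q n _.

(* Taken in the extended reals so that an empty or unbounded set of exponents
   does not produce a junk value. *)
Definition c_Ram_minus (R : realType) (dP dQ : Order.disp_t)
    (P : porderType dP) (Q : porderType dQ) : \bar R :=
  ereal_sup [set c%:E | c in [set c : R | 0 < c /\
    random_subset_pr (expR (- (c * n%:R))) (arrows_event P Q n)
      @[n --> \oo] --> (1 : R)]].

Definition c_Ram_plus (R : realType) (dP dQ : Order.disp_t)
    (P : porderType dP) (Q : porderType dQ) : \bar R :=
  ereal_inf [set c%:E | c in [set c : R | 0 < c /\
    random_subset_pr (expR (- (c * n%:R))) (~` arrows_event P Q n)
      @[n --> \oo] --> (1 : R)]].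

Definition is_partial_order (T : finType) (r : {ffun T * T -> bool}) : Prop :=
  [/\ reflexive (fun x y => r (x, y)), antisymmetric (fun x y => r (x, y))
    & transitive (fun x y => r (x, y))].

Definition labelled_poset (N : nat) : Type :=
  {r : {ffun 'I_N * 'I_N -> bool} | `[< is_partial_order r >]}.

HB.instance Definition _ (N : nat) := Finite.on (labelled_poset N).

(* ['I_N] ordered by [P] rather than by the natural order. *)
Definition poset_of (N : nat) (P : labelled_poset N) : Type := 'I_N.

HB.instance Definition _ (N : nat) (P : labelled_poset N) :=
  Finite.on (poset_of P).

Section PosetOf.
Variables (N : nat) (P : labelled_poset N).

Definition poset_of_le : rel (poset_of P) := fun x y => val P (x, y).

Lemma poset_of_le_refl : reflexive poset_of_le.
Proof. by case: (asboolW (valP P)). Qed.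

Lemma poset_of_le_anti : antisymmetric poset_of_le.
Proof. by case: (asboolW (valP P)). Qed.

Lemma poset_of_le_trans : transitive poset_of_le.
Proof. by case: (asboolW (valP P)). Qed.

End PosetOf.

Fact poset_of_display : Order.disp_t. Proof. exact: Order.Disp tt tt. Qed.

HB.instance Definition _ (N : nat) (P : labelled_poset N) :=
  Order.Le_isPOrder.Build poset_of_display (poset_of P)
    (@poset_of_le_refl N P) (@poset_of_le_anti N P) (@poset_of_le_trans N P).

Definition almost_all_posets (R : realType)
    (X : forall N : nat, labelled_poset N -> Prop) : Prop :=
  #|[set P : labelled_poset N | `[< X N P >]]%SET|%:R /
    #|{: labelled_poset N}|%:R @[N --> \oo] --> (1 : R).

(* Main.v *)
(* The constants are [ln 2 / 5] and [ln 2 / 3], the error constant being a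
   multiple of [1 / g] for the [g] of the Kleitman-Rothschild theorem.

   Kleitman-Rothschild: the Hasse diagram of a poset has no triangle, and an
   orientation of a 4-cycle is determined by three of its edges. Call a graph
   typical if no vertex [a] has all but few of its neighbours, together with the
   orientation of the edges at [a], predicted by sets definable in the graph
   without [a] and of density below 1/2. There are only polynomially many
   definable sets, so atypical graphs are rare by induction on the number of
   vertices. Having a common neighbour is an equivalence relation with two
   classes on a typical graph, which is therefore bipartite; if both parts
   contain a vertex with edges in both directions, then almost all edges go from
   one part to the other, and there are few such graphs. Otherwise one part has
   no such vertex and the graph has three layers. In almost all three-layered
   posets every layer has more than [g N] elements and every two sets of
   [sqrt (5 N)] elements of consecutive layers are joined by an edge.

   Lower bound: the power set of [n] contains five levels, each made of [2 N]
   disjoint families of about [2 ^ (n / 5)] sets, with all sets of a level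
   inside all sets of the next one. If [c < ln 2 / 5], a random poset hits all
   families, and for every colouring three of the five levels contain [N] sets
   of the same colour each, which is enough for a poset with three layers.

   Upper bound: a copy of a poset on [F] in the power set of [n] is a sequence
   of [n] upsets of [F], so for [c > ln i(F) / #|F|], where [i(F)] is the number
   of upsets, the expected number of copies tends to 0. Take [F] to consist of
   [m], about [g N], elements of each of the three layers. An upset is almost
   empty or almost full in all but one of them, so that [ln i(F)] is
   [m ln 2 + O (sqrt N ln N)], which is [#|F| (ln 2 / 3 + O (1 / ln N))].

   The inequality between the two thresholds: thin a [q]-random set to a
   [p]-random one. *)
Require Import Defs.
From mathcomp Require Import all_boot all_order all_algebra.
From mathcomp Require Import all_classical all_reals all_analysis.
From mathcomp Require Import ring lra zify.
From mathcomp Require Import fintype finset.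
Import Order.TTheory GRing.Theory Num.Theory.
Import numFieldNormedType.Exports.
Set Implicit Arguments.
Unset Strict Implicit.
Unset Printing Implicit Defensive.
Local Open Scope ring_scope.

(** * Hasse diagrams and definable sets *)

Section Digraphs.
Variable T : finType.
Implicit Types (H : {set T * T}) (V A B X Y : {set T}) (x y z w : T).

Definition up H x := [set y | (x, y) \in H].
Definition dn H x := [set y | (y, x) \in H].
Definition nb H x := up H x :|: dn H x.
Definition ups H A := \bigcup_(x in A) up H x.
Definition dns H A := \bigcup_(x in A) dn H x.
Definition nbs H A := \bigcup_(x in A) nb H x.
Definition rev H := [set p | (p.2, p.1) \in H].
Definition del H a := [set p in H | (p.1 != a) && (p.2 != a)].

(* What is used of the Hasse diagram of a poset, seen as a set of directed
   edges. *)
Definition cover_like H : Prop :=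
  [/\ forall x y, (x, y) \in H -> (y, x) \notin H,
      forall x y z, (x, y) \in H -> (y, z) \in H -> z \notin nb H x
    & forall x y z w, (x, y) \in H -> (y, z) \in H -> (z, w) \in H ->
        w \notin nb H x].

Definition cover_graphs V : {set {set T * T}} :=
  [set H : {set T * T} | (H \subset setX V V) && `[< cover_like H >]].

Lemma in_up H x y : (y \in up H x) = ((x, y) \in H).
Proof. by rewrite inE. Qed.

Lemma in_dn H x y : (y \in dn H x) = ((y, x) \in H).
Proof. by rewrite inE. Qed.

Lemma in_nb H x y : (y \in nb H x) = ((x, y) \in H) || ((y, x) \in H).
Proof. by rewrite !inE. Qed.

Lemma nbC H x y : (y \in nb H x) = (x \in nb H y).
Proof. by rewrite !in_nb orbC. Qed.

Lemma upsP H A y : reflect (exists2 x, x \in A & (x, y) \in H) (y \in ups H A).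
Proof.
by apply: (iffP bigcupP) => -[x xA]; rewrite ?in_up => h; exists x; rewrite ?in_up.
Qed.

Lemma dnsP H A y : reflect (exists2 x, x \in A & (y, x) \in H) (y \in dns H A).
Proof.
by apply: (iffP bigcupP) => -[x xA]; rewrite ?in_dn => h; exists x; rewrite ?in_dn.
Qed.

Lemma nbsE H A : nbs H A = ups H A :|: dns H A.
Proof. exact: big_split. Qed.

Lemma nbsP H A y : reflect (exists2 x, x \in A & y \in nb H x) (y \in nbs H A).
Proof. exact: bigcupP. Qed.

Lemma in_rev H x y : ((x, y) \in rev H) = ((y, x) \in H).
Proof. by rewrite inE. Qed.

Lemma up_rev H x : up (rev H) x = dn H x.
Proof. by apply/setP => y; rewrite in_up in_dn in_rev. Qed.

Lemma dn_rev H x : dn (rev H) x = up H x.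
Proof. by apply/setP => y; rewrite in_up in_dn in_rev. Qed.

Lemma nb_rev H x : nb (rev H) x = nb H x.
Proof. by rewrite /nb up_rev dn_rev setUC. Qed.

Lemma ups_rev H A : ups (rev H) A = dns H A.
Proof. by apply: eq_bigr => x _; rewrite up_rev. Qed.

Lemma dns_rev H A : dns (rev H) A = ups H A.
Proof. by apply: eq_bigr => x _; rewrite dn_rev. Qed.

Lemma in_del H a x y :
  ((x, y) \in del H a) = [&& (x, y) \in H, x != a & y != a].
Proof. by rewrite inE. Qed.

Lemma del_rev H a : del (rev H) a = rev (del H a).
Proof. by apply/setP => -[x y]; rewrite in_del !in_rev in_del [X in _ && X]andbC. Qed.

Lemma up_del H a x : x != a -> up (del H a) x = up H x :\ a.
Proof. by move=> xa; apply/setP => y; rewrite !inE /= xa andbC. Qed.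

Lemma dn_del H a x : x != a -> dn (del H a) x = dn H x :\ a.
Proof. by move=> xa; apply/setP => y; rewrite !inE /= xa andbT andbC. Qed.

Lemma nb_del H a x : x != a -> nb (del H a) x = nb H x :\ a.
Proof. by move=> xa; rewrite /nb up_del // dn_del // setDUl. Qed.

Lemma ups_del H a A : a \notin A -> ups (del H a) A = ups H A :\ a.
Proof.
move=> aA; apply/setP => y; rewrite !inE; apply/upsP/andP.
  by case=> x xA; rewrite in_del => /and3P[h _ ya]; split=> //; apply/upsP; exists x.
case=> ya /upsP[x xA h]; exists x => //; rewrite in_del h ya andbT /=.
by apply: contraNneq aA => <-.
Qed.

Lemma dns_del H a A : a \notin A -> dns (del H a) A = dns H A :\ a.
Proof. by move=> aA; rewrite -!ups_rev -del_rev ups_del. Qed.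

Lemma nbs_del H a A : a \notin A -> nbs (del H a) A = nbs H A :\ a.
Proof. by move=> aA; rewrite !nbsE ups_del // dns_del // setDUl. Qed.

Lemma cover_like_sub H H' : H' \subset H -> cover_like H -> cover_like H'.
Proof.
move=> /subsetP sH [h1 h2 h3].
have sn x y : y \notin nb H x -> y \notin nb H' x.
  by rewrite !in_nb; apply: contra => /orP[] /sH ->; rewrite ?orbT.
split=> [x y|x y z|x y z w] /sH xy.
- by apply: contra (h1 _ _ xy) => /sH.
- by move=> /sH yz; apply/sn/(h2 x y z).
- by move=> /sH yz /sH zw; apply/sn/(h3 x y z w).
Qed.

Lemma cover_like_rev H : cover_like H -> cover_like (rev H).
Proof.
move=> [h1 h2 h3]; split=> [x y|x y z|x y z w]; rewrite !in_rev.
- exact: h1.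
- by move=> xy yz; rewrite nb_rev nbC; apply: (h2 z y x).
- by move=> xy yz zw; rewrite nb_rev nbC; apply: (h3 w z y x).
Qed.

Lemma cover_graphs_rev V H : H \in cover_graphs V -> rev H \in cover_graphs V.
Proof.
rewrite !inE => /andP[/subsetP sH /asboolP cH]; apply/andP; split; last first.
  exact/asboolP/cover_like_rev.
by apply/subsetP => -[x y]; rewrite in_rev => /sH; rewrite !inE andbC.
Qed.

Lemma cover_graphs_del V H a :
  H \in cover_graphs V -> del H a \in cover_graphs (V :\ a).
Proof.
rewrite !inE => /andP[/subsetP sH /asboolP cH]; apply/andP; split.
  apply/subsetP => -[x y]; rewrite in_del => /and3P[/sH].
  by rewrite !inE /= => /andP[-> ->] -> ->.
by apply/asboolP; apply: cover_like_sub cH; apply/subsetP => -[x y]; rewrite in_del => /and3P[].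
Qed.

Section CoverLike.
Variable H : {set T * T}.
Hypothesis cH : cover_like H.

Lemma cover_asym x y : (x, y) \in H -> (y, x) \notin H.
Proof. by case: cH => h _ _; apply: h. Qed.

Lemma cover_path2 x y z : (x, y) \in H -> (y, z) \in H -> z \notin nb H x.
Proof. by case: cH => _ h _; apply: h. Qed.

Lemma cover_path3 x y z w :
  (x, y) \in H -> (y, z) \in H -> (z, w) \in H -> w \notin nb H x.
Proof. by case: cH => _ _; apply. Qed.

Lemma nb_irr x : x \notin nb H x.
Proof. by rewrite in_nb orbb; apply/negP => h; move: (cover_asym h); rewrite h. Qed.

Lemma nb_up x y : y \in nb H x -> ((y, x) \in H) = ((x, y) \notin H).
Proof.
rewrite in_nb => /orP[h|h]; first by rewrite h; apply/negbTE/cover_asym.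
by rewrite h (cover_asym h).
Qed.

(** However a triangle is oriented, two of its edges form a directed path, and [cover_path2] forbids
    an edge between the ends. *)
Lemma triangle_free x y z : y \in nb H x -> z \in nb H x -> z \notin nb H y.
Proof.
rewrite !(in_nb _ x) => hy hz; apply/negP; rewrite in_nb => hyz.
have bad a b c : (a, b) \in H -> (b, c) \in H -> ((a, c) \in H) || ((c, a) \in H) -> False.
  by move=> ab bc; rewrite -in_nb; apply/negP/(cover_path2 ab bc).
case/orP: hy => hy; case/orP: hz => hz; case/orP: hyz => hyz;
 by [apply: (bad x y z); rewrite ?hy ?hz ?hyz ?orbT
    |apply: (bad x z y); rewrite ?hy ?hz ?hyz ?orbT
    |apply: (bad y x z); rewrite ?hy ?hz ?hyz ?orbT
    |apply: (bad z x y); rewrite ?hy ?hz ?hyz ?orbT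
    |apply: (bad y z x); rewrite ?hy ?hz ?hyz ?orbT
    |apply: (bad z y x); rewrite ?hy ?hz ?hyz ?orbT].
Qed.

(* A 4-cycle of the graph is oriented either alternately or as two directed
   paths of length 2, so three of its orientations determine the fourth. *)
Lemma four_cycle u v t z :
  v \in nb H u -> t \in nb H v -> z \in nb H t -> z \in nb H u ->
  ((u, z) \in H) = if (u, v) \in H then ((v, t) \in H) || ((t, z) \in H)
                   else ((v, t) \in H) && ((t, z) \in H).
Proof.
move=> vu tv zt zu; have := nb_up vu; have := nb_up tv; have := nb_up zt; have := nb_up zu.
have p3 := @cover_path3.
case uv: ((u, v) \in H); case vt: ((v, t) \in H); case tz: ((t, z) \in H);
case uz: ((u, z) \in H) => //= h1 h2 h3 h4; exfalso.
- by have := p3 _ _ _ _ uv vt tz; rewrite zu.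
- by have := p3 _ _ _ _ h1 uv vt; rewrite nbC zt.
- by have := p3 _ _ _ _ tz h1 uv; rewrite nbC tv.
- by have := p3 _ _ _ _ uz h2 h3; rewrite vu.
- by have := p3 _ _ _ _ vt tz h1; rewrite nbC vu.
- by have := p3 _ _ _ _ h4 uz h2; rewrite tv.
- by have := p3 _ _ _ _ h3 h4 uz; rewrite nbC in zt; rewrite nbC zt.
- by have := p3 _ _ _ _ h2 h3 h4; rewrite nbC zu.
Qed.

End CoverLike.

End Digraphs.

(** * Sets definable in a graph, and their number *)

Section Definable.
Variable T : finType.
Implicit Types (H : {set T * T}) (V A B X Y : {set T}) (x y z w : T).

(* For a fixed [k] only polynomially many sets are definable, so that naming
   one of them costs nothing in the encodings of [bad_count]. *)
Fixpoint definable V H k : {set {set T}} :=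
  if k is k'.+1 then
    [set A :|: B | A in definable V H k', B in definable V H k']
    :|: [set A :\: B | A in definable V H k', B in definable V H k']
    :|: [set ups H A | A in definable V H k']
    :|: [set dns H A | A in definable V H k']
  else set0 |: [set [set x] | x in V].

Lemma definableU V H k A B : A \in definable V H k -> B \in definable V H k ->
  A :|: B \in definable V H k.+1.
Proof. by move=> hA hB; rewrite /= !in_setU imset2_f. Qed.

Lemma definableD V H k A B : A \in definable V H k -> B \in definable V H k ->
  A :\: B \in definable V H k.+1.
Proof.
move=> hA hB; rewrite /= !in_setU.
by rewrite (_ : A :\: B \in [set A :\: B | A in _, B in _]) ?orbT // imset2_f.
Qed.

Lemma definable_ups V H k A : A \in definable V H k -> ups H A \in definable V H k.+1.
Proof.
move=> hA; rewrite /= !in_setU.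
by rewrite (_ : ups H A \in [set ups H A | A in _]) ?orbT // imset_f.
Qed.

Lemma definable_dns V H k A : A \in definable V H k -> dns H A \in definable V H k.+1.
Proof.
move=> hA; rewrite /= !in_setU.
by rewrite (_ : dns H A \in [set dns H A | A in _]) ?orbT // imset_f.
Qed.

Lemma definable_le V H k k' A :
  (k <= k')%N -> A \in definable V H k -> A \in definable V H k'.
Proof.
move=> /subnK <-; elim: (k' - k)%N => // m IH /IH hA.
by rewrite addSn -[A]setUid definableU.
Qed.

Lemma definable0 V H k : set0 \in definable V H k.
Proof. by apply: (@definable_le _ _ 0) => //; rewrite setU11. Qed.

Lemma definable1 V H k x : x \in V -> [set x] \in definable V H k.
Proof. by move=> xV; apply: (@definable_le _ _ 0) => //; rewrite /= in_setU imset_f ?orbT. Qed.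

Lemma definable_nbs V H k A : A \in definable V H k -> nbs H A \in definable V H k.+2.
Proof. by move=> hA; rewrite nbsE definableU ?definable_ups ?definable_dns. Qed.

Lemma definable_nb V H k x : x \in V -> nb H x \in definable V H k.+2.
Proof.
move=> xV; rewrite (_ : nb H x = nbs H [set x]) ?definable_nbs ?definable1 //.
by rewrite /nbs big_set1.
Qed.

Lemma definable_up V H k x : x \in V -> up H x \in definable V H k.+1.
Proof.
move=> xV; rewrite (_ : up H x = ups H [set x]) ?definable_ups ?definable1 //.
by rewrite /ups !big_set1.
Qed.

Lemma definable_dn V H k x : x \in V -> dn H x \in definable V H k.+1.
Proof.
move=> xV; rewrite (_ : dn H x = dns H [set x]) ?definable_dns ?definable1 //.
by rewrite /dns !big_set1.
Qed.

Lemma definableI V H k A B : A \in definable V H k -> B \in definable V H k ->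
  A :&: B \in definable V H k.+2.
Proof.
move=> hA hB.
have -> : A :&: B = A :\: (A :\: B) by rewrite setDDr setDv set0U.
by rewrite definableD ?definableD // (definable_le (leqnSn k)).
Qed.

Lemma definable_small V H k A : A \subset V -> (#|A| <= k)%N -> A \in definable V H k.
Proof.
elim: k A => [|k IH] A sA.
  by rewrite leqn0 cards_eq0 => /eqP ->; exact: definable0.
have [->|[x xA]] := set_0Vmem A; first by move=> _; exact: definable0.
rewrite (cardsD1 x) xA add1n ltnS => hA.
rewrite -(setD1K xA) definableU ?definable1 ?(subsetP sA) // IH //.
exact: subset_trans (subD1set _ _) sA.
Qed.

(** One level turns a family of size [f >= 1] into at most [2 f^2 + 2 f <= 4 f^2] sets, so four
    times the size is at most squared. *)
Lemma card_definable V H k :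
  (4 * #|definable V H k| <= (4 * #|V|.+1) ^ (2 ^ k))%N.
Proof.
elim: k => [|k IH].
  by rewrite expn1 leq_mul2l /= -add1n (leq_trans (leq_card_setU _ _)) // cards1 leq_add2l leq_imset_card.
rewrite [(2 ^ k.+1)%N]expnSr expnM; set N := (_ ^ (2 ^ k))%N in IH *.
set F := definable V H k in IH *.
have : (#|definable V H k.+1| <= #|F| * #|F| + #|F| * #|F| + #|F| + #|F|)%N.
  rewrite /= -/F; do ![apply: leq_trans (leq_card_setU _ _) _; rewrite leq_add //];
  by rewrite ?leq_imset_card // -cardsX curry_imset2X leq_imset_card.
have : (0 < #|F|)%N by apply/card_gt0P; exists set0; exact: definable0.
move=> F0 h; rewrite (leq_trans (n := ((4 * #|F|) ^ 2)%N)) ?leq_exp2r //.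
by apply: leq_trans (leq_mul (leqnn 4) h) _; rewrite expnMn -mulnn; nia.
Qed.

(** Reversal only exchanges [ups] and [dns]; this symmetry lets later arguments treat one
    orientation only. *)
Lemma definable_rev W H k : definable W (rev H) k = definable W H k.
Proof.
elim: k => //= k ->; rewrite -!setUA; congr (_ :|: (_ :|: _)).
rewrite setUC; congr (_ :|: _); apply: eq_imset => A; first exact: dns_rev.
exact: ups_rev.
Qed.

End Definable.

(* [done] would otherwise try to compute with [definable]. *)
Opaque definable.

(** * Densities of vertex sets *)

Section Density.
Variables (R : realFieldType) (T : finType) (V : {set T}).
Hypothesis V0 : (0 < #|V|)%N.
Implicit Types A B C : {set T}.

Definition dens A : R := #|A|%:R / #|V|%:R.

Lemma dens_gt0 : 0 < #|V|%:R :> R. Proof. by rewrite ltr0n. Qed.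

Lemma dens_ge0 A : 0 <= dens A.
Proof. by rewrite divr_ge0. Qed.

Lemma dens0 : dens set0 = 0. Proof. by rewrite /dens cards0 mul0r. Qed.

Lemma densT : dens V = 1. Proof. by rewrite /dens divff // gt_eqF // dens_gt0. Qed.

Lemma dens_sub A B : A \subset B -> dens A <= dens B.
Proof. by move=> /subset_leq_card h; rewrite ler_pM2r ?invr_gt0 ?dens_gt0 // ler_nat. Qed.

Lemma densU A B : dens (A :|: B) <= dens A + dens B.
Proof. by rewrite -mulrDl ler_pM2r ?invr_gt0 ?dens_gt0 // -natrD ler_nat leq_card_setU. Qed.

Lemma densID A B : dens A = dens (A :&: B) + dens (A :\: B).
Proof. by rewrite -mulrDl -natrD cardsID. Qed.

Lemma dens_cover A B C : A \subset B :|: C -> dens A <= dens B + dens C.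
Proof. by move=> /dens_sub h; apply: le_trans h (densU _ _). Qed.

Lemma dens_disjoint A B C : A \subset C -> B \subset C -> [disjoint A & B] ->
  dens A + dens B <= dens C.
Proof.
move=> sA sB dAB; rewrite -mulrDl ler_pM2r ?invr_gt0 ?dens_gt0 // -natrD ler_nat.
have := leq_card_setU A B; rewrite dAB => -[_].
by move=> /eqP <-; rewrite subset_leq_card // subUset sA.
Qed.

Lemma dens_le A (m : nat) : (#|A| <= m)%N -> dens A <= m%:R / #|V|%:R.
Proof. by move=> h; rewrite ler_pM2r ?invr_gt0 ?dens_gt0 // ler_nat. Qed.

Lemma dens_nonempty A c : 0 <= c -> c < dens A -> exists x, x \in A.
Proof.
move=> c0; have [->|[x xA] _] := set_0Vmem A; last by exists x.
by rewrite dens0 ltNge c0.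
Qed.

Lemma dens_nonemptyD A B c : dens B <= c -> c < dens A -> exists2 x, x \in A & x \notin B.
Proof.
move=> hB hA; have [|x] := @dens_nonempty (A :\: B) 0 (lexx _); last first.
  by rewrite inE => /andP[xB xA]; exists x.
rewrite ltNge; apply/negP => h; have := densID A B.
have := dens_sub (subsetIr A B); lra.
Qed.

(* Greedily: each new set covers a further fraction [c] of [V]. *)
Lemma greedy_cover (f : T -> {set T}) A (c : R) (m : nat) :
  (forall x, x \in A -> f x \subset V) -> 1 < c * m%:R ->
  exists Q : {set T}, [/\ Q \subset A, (#|Q| <= m)%N
    & forall u, u \in A -> dens (f u :\: \bigcup_(q in Q) f q) <= c].
Proof.
move=> fV cm.
suff: forall j : nat, exists Q : {set T}, [/\ Q \subset A, (#|Q| <= j)%N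
    & (forall u, u \in A -> dens (f u :\: \bigcup_(q in Q) f q) <= c)
      \/ c * j%:R <= dens (\bigcup_(q in Q) f q)].
  move=> /(_ m)[Q [sQ mQ [h|h]]]; first by exists Q.
  have : dens (\bigcup_(q in Q) f q) <= dens V.
    by apply/dens_sub/bigcupsP => q /(subsetP sQ)/fV.
  by rewrite densT; move: cm h; lra.
elim=> [|j [Q [sQ mQ hQ]]].
  by exists set0; rewrite sub0set cards0 mulr0; split=> //; right; exact: dens_ge0.
case: hQ => hQ; first by exists Q; split; rewrite ?(leq_trans mQ) //; left.
have [h|/existsNP[u /not_implyP[uA /negP]]] := pselect
  (forall u, u \in A -> dens (f u :\: \bigcup_(q in Q) f q) <= c).
  by exists Q; split; rewrite ?(leq_trans mQ) //; left.
rewrite -ltNge => hu; exists (u |: Q); split.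
- by rewrite subUset sub1set uA.
- by rewrite cardsU1 -add1n leq_add // leq_b1.
right; rewrite -natr1 mulrDr mulr1.
set W := \bigcup_(q in Q) f q in hQ hu *.
have : dens W + dens (f u :\: W) <= dens (\bigcup_(q in u |: Q) f q).
  apply: dens_disjoint.
  - by apply/bigcupsP => q qQ; apply: bigcup_sup; rewrite inE qQ orbT.
  - by apply: subset_trans (subsetDl _ _) (bigcup_sup _ _); rewrite setU11.
  - by rewrite -setI_eq0; apply/eqP/setP => x; rewrite !inE; case: (x \in W); rewrite ?andbF.
by lra.
Qed.

(** Count the pairs [a], [b] with [b] in [f a] from both ends. *)
Lemma dens_double_count A B (f : T -> {set T}) (c d : R) :
  (forall a, a \in A -> d <= dens (f a :&: B)) ->
  (forall b, b \in B -> dens [set a in A | b \in f a] <= c) ->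
  dens A * d <= dens B * c.
Proof.
move=> h1 h2.
have e : (\sum_(a in A) #|f a :&: B| = \sum_(b in B) #|[set a in A | b \in f a]|)%N.
  transitivity (\sum_(a in A) \sum_(b in B) (b \in f a : nat))%N.
    apply: eq_bigr => a _; rewrite -sum1_card big_mkcond [RHS]big_mkcond /=.
    by apply: eq_bigr => b _; rewrite inE; case: (b \in f a); case: (b \in B).
  rewrite exchange_big /=; apply: eq_bigr => b _.
  rewrite -sum1_card big_mkcond [RHS]big_mkcond /=.
  by apply: eq_bigr => a _; rewrite inE; case: (b \in f a); case: (a \in A).
have v0 := dens_gt0.
have l1 : #|A|%:R * (d * #|V|%:R) <= (\sum_(a in A) #|f a :&: B|)%N%:R.
  rewrite natr_sum mulr_natl -sumr_const; apply: ler_sum => a /h1.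
  by rewrite /dens ler_pdivlMr.
have l2 : (\sum_(b in B) #|[set a in A | b \in f a]|)%N%:R <= #|B|%:R * (c * #|V|%:R).
  rewrite natr_sum mulr_natl -sumr_const; apply: ler_sum => b /h2.
  by rewrite /dens ler_pdivrMr.
have l3 := le_trans l1 (eq_rect _ (fun k => k%:R <= _) l2 _ (esym e)).
rewrite /dens -!mulrA ![(#|V|%:R)^-1 * _]mulrC !mulrA ler_pM2r ?invr_gt0 //.
by move: l3; rewrite !mulrA ler_pM2r.
Qed.

End Density.

(** * Structure of typical graphs *)

Section Typical.
Variables (R : realFieldType) (T : finType) (V : {set T}).
Implicit Types (H : {set T * T}) (A B E F Q X Y Z : {set T}) (x y z w a b u : T).

(* [X] and [Y] predict, from [H] without [a], where the neighbours of [a] lie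
   and how the edges at [a] are oriented. If [X] is smaller than half of [V],
   the edges at [a] can be encoded by fewer than [#|V| / 2] bits. *)
Definition typical k (g e : R) H : Prop :=
  forall a X Y, a \in V ->
    X \in definable (V :\ a) (del H a) k -> Y \in definable (V :\ a) (del H a) k ->
    dens R V (nb H a :\: X) <= g ->
    (forall z, z \in X -> z \in nb H a -> (z \in up H a) = (z \in Y)) ->
    2^-1 - e <= dens R V X.

Lemma dens_UI A B : dens R V (A :|: B) + dens R V (A :&: B) = dens R V A + dens R V B.
Proof. by rewrite -!mulrDl -!natrD cardsUI. Qed.

(** Close a path [u], [v], [t] by a common neighbour [z] of [u] and [t]. With the edges [uv] and
    [vt] fixed, [four_cycle] makes the direction of [uz] either constant or equal to that of [tz].
    [A1] collects the [t] that force an upward edge, [A2] those whose direction is copied. *)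
Lemma predict_orientation H u A : cover_like H ->
  (forall t, t \in A -> exists2 v, v \in nb H u & t \in nb H v) ->
  exists A1 A2, [/\ A1 \subset A, A2 \subset A
    & forall z, z \in nbs H A -> z \in nb H u ->
        (z \in up H u) = (z \in nbs H A1 :|: ups H A2)].
Proof.
move=> cH hA.
pose P1 t := `[< forall z, z \in nb H u -> z \in nb H t -> z \in up H u >].
pose P2 t := `[< forall z, z \in nb H u -> z \in nb H t -> (z \in up H u) = (z \in up H t) >].
exists [set t in A | P1 t], [set t in A | P2 t]; split.
- by apply/subsetP => t; rewrite inE => /andP[].
- by apply/subsetP => t; rewrite inE => /andP[].
move=> z /nbsP[t tA zt] zu; apply/idP/idP; last first.
  case/setUP => [/nbsP[t']|/upsP[t']]; rewrite inE => /andP[_ /asboolP h].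
    by move=> /h; apply.
  by move=> ht; rewrite h // ?in_up // in_nb ht.
have [v vu tv] := hA t tA.
have hz z' : z' \in nb H u -> z' \in nb H t -> (z' \in up H u) =
    if (u, v) \in H then ((v, t) \in H) || ((t, z') \in H)
    else ((v, t) \in H) && ((t, z') \in H).
  by move=> zu' zt'; rewrite in_up (four_cycle cH vu tv zt' zu').
move=> uz; rewrite in_setU.
move: (hz z zu zt); rewrite uz.
case uv: ((u, v) \in H) hz; case vt: ((v, t) \in H) => //= hz e.
- apply/orP; left; apply/nbsP; exists t => //; rewrite inE tA /=.
  by apply/asboolP => z' ? ?; rewrite hz.
- apply/orP; right; apply/upsP; exists t => //; rewrite inE tA /=.
  by apply/asboolP => z' ? ?; rewrite hz // in_up.
- apply/orP; right; apply/upsP; exists t => //; rewrite inE tA /=.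
  by apply/asboolP => z' ? ?; rewrite hz // in_up.
Qed.

(** * The bipartition of a typical graph *)

Section Structure.
Variables (H : {set T * T}) (m k : nat) (g1 g2 e1 e2 D : R).
Hypothesis V0 : (0 < #|V|)%N.
Hypothesis HG : H \in cover_graphs V.
Hypotheses (g1_gt0 : 0 < g1) (g1e1 : g1 <= e1) (e1g2 : e1 * 30 <= g2)
  (g2e2 : g2 <= e2) (e2D : e2 * 200 <= D) (D4 : D <= 4^-1).
Hypothesis km : (m + 6 <= k)%N.
(** The threshold of the greedy covers; the double count in [second_neighbours_cover] then leaves
    density at most [2 c / D = g1 / 4]. *)
Let c := g1 * D / 8.
Hypotheses (cm : 1 < c * m%:R) (cV : (m + 6)%:R / #|V|%:R <= c).
Hypotheses (typ1 : typical k g1 e1 H) (typ2 : typical k g2 e2 H)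
  (typD : typical k D 4^-1 H).
Notation d := (dens R V).

Let cH : cover_like H.
Proof. by move: HG; rewrite inE => /andP[_ /asboolP]. Qed.

Let sH x y : (x, y) \in H -> x \in V /\ y \in V.
Proof. by move: HG; rewrite inE => /andP[/subsetP h _] /h; rewrite inE => /andP[]. Qed.

Ltac consts := move: g1_gt0 g1e1 e1g2 g2e2 e2D D4.

Let D_gt0 : 0 < D. Proof. by consts; lra. Qed.
Let c_gt0 : 0 < c. Proof. by rewrite /c; apply: divr_gt0 => //; apply: mulr_gt0. Qed.
Let c_small : c * 4 <= g1 /\ c * 2 <= D.
Proof.
have : g1 * D <= g1 * 4^-1 by rewrite ler_pM2l.
have : D * g1 <= D * 1 by rewrite ler_pM2l //; consts; lra.
by rewrite /c; consts; lra.
Qed.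

Lemma nb_subset x : nb H x \subset V.
Proof. by apply/subsetP => y; rewrite in_nb => /orP[] /sH[]. Qed.

Lemma nbs_subset A : nbs H A \subset V.
Proof. by apply/subsetP => y /nbsP[x _]; apply/subsetP/nb_subset. Qed.

(** At a vertex of smaller degree the empty sets would be valid predictions, and typicality would
    give [1/4 <= 0]. *)
Lemma degree_gt a : a \in V -> D < d (nb H a).
Proof.
move=> aV; rewrite ltNge; apply/negP => h.
have := typD aV (definable0 _ _ _) (definable0 _ _ _).
rewrite setD0 => /(_ h); rewrite dens0 => h'.
have : 2^-1 - 4^-1 <= (0 : R) by apply: h' => z; rewrite inE.
by lra.
Qed.

Lemma dens_small A : (#|A| <= m + 6)%N -> d A <= c.
Proof. by move=> h; apply: le_trans (dens_le R V0 h) cV. Qed.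

(** Typicality for the prediction [nbs H A :\: E]. The vertices of [A] are at distance two from [a],
    so [predict_orientation] supplies the set that predicts the orientations. *)
Lemma typical_nbs (g e : R) a A E : typical k g e H -> a \in V ->
  A \subset V :\ a -> (#|A| <= m)%N ->
  (forall t, t \in A -> exists2 v, v \in nb H a & t \in nb H v) ->
  E \in definable (V :\ a) (del H a) (m + 5) ->
  d (nb H a :\: (nbs H A :\: E)) <= g -> 2^-1 - e <= d ((nbs H A :\: E) :\ a).
Proof.
move=> typ aV sA mA hA hE hd.
have aA B : B \subset A -> a \notin B.
  by move=> /subset_trans/(_ sA)/subsetP sB; apply/negP => /sB; rewrite !inE eqxx.
have [A1 [A2 [s1 s2 hY]]] := predict_orientation cH hA.
have defA B : B \subset A -> B \in definable (V :\ a) (del H a) m.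
  move=> sB; apply: definable_small; first exact: subset_trans sB sA.
  exact: leq_trans (subset_leq_card sB) mA.
have eX : nbs (del H a) A :\: E = (nbs H A :\: E) :\ a.
  by rewrite nbs_del ?aA // !setDDl setUC.
rewrite -eX.
apply: (typ a _ (nbs (del H a) A1 :|: ups (del H a) A2)) => //.
(* The neighbours of at most [m] vertices are at level [m + 2], and the difference with [E] is at
   level [m + 6]. *)
- apply: (definable_le km); rewrite addnS definableD //.
  apply: (@definable_le _ _ _ m.+2 (m + 5)); first by clear; lia.
  exact/definable_nbs/defA.
- apply: (@definable_le _ _ _ m.+3 k); first by move: km; clear; lia.
  apply: definableU; first exact/definable_nbs/defA.
  apply: (@definable_le _ _ _ m.+1 m.+2); first by [].
  exact/definable_ups/defA.
- apply: le_trans hd; apply: dens_sub => //; apply/subsetP => z.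
  rewrite nbs_del ?aA // !inE => /andP[h zn]; rewrite zn andbT.
  apply: contra h => /andP[-> h]; rewrite h !andbT.
  by apply/negP => /eqP za; move: zn; rewrite za -!in_nb; move: (nb_irr cH a); rewrite in_nb => /negbTE ->.
move=> z; rewrite eX !in_setD => /and3P[_ _ zA] zn; rewrite (hY z) //.
have za : z != a by apply: contraTneq zn => ->; exact: nb_irr.
by rewrite ups_del ?aA // nbs_del ?aA // -setDUl in_setD1 za.
Qed.

(** [Q] greedily covers the neighbourhoods of the neighbours of [a] outside [F]. The degree of [a]
    leaves a further neighbour [u] outside [Q] and [F]. As [Q] is at distance two from [u] through
    [a] and nearly covers [nb H u], typicality at [u] bounds [nbs H Q] from below. *)
Lemma neighbours_cover a F : a \in V -> (#|F| <= 6)%N ->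
  exists Q, [/\ Q \subset nb H a :\: F, (#|Q| <= m)%N & 2^-1 - e1 <= d (nbs H Q)].
Proof.
move=> aV F6.
have cg1 : c <= g1 by case: c_small; move: c_gt0; lra.
have [|Q [sQ mQ hQ]] := @greedy_cover R T V V0 (nb H) (nb H a :\: F) c m _ cm.
  by move=> x _; exact: nb_subset.
exists Q; split=> //.
have [u ua uQ] : exists2 u, u \in nb H a & u \notin Q :|: F.
  apply: (@dens_nonemptyD R T V V0 _ _ c); last first.
    by apply: lt_trans (degree_gt aV); case: c_small; move: c_gt0; lra.
  by apply: dens_small; apply: leq_trans (leq_card_setU _ _) _; rewrite leq_add.
move: uQ; rewrite in_setU negb_or => /andP[uQ uF].
have uV := subsetP (nb_subset a) _ ua.
have := @typical_nbs g1 e1 u Q set0 typ1 uV.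
rewrite !setD0 => h; apply: le_trans (dens_sub R V0 (subD1set _ u)); apply: h => //; last 2 first.
- exact: definable0.
- by apply: le_trans (hQ u _) cg1; rewrite inE uF.
- apply/subsetP => q qQ; rewrite !inE; apply/andP; split.
    by apply: contraNneq uQ => <-.
  by move/(subsetP sQ): qQ; rewrite inE => /andP[_] /(subsetP (nb_subset _)).
- by move=> t /(subsetP sQ); rewrite inE => /andP[_ h]; exists a; rewrite // nbC.
Qed.

(** Let [A] be the second neighbours outside [F]. An uncovered [z] of [Z] has density at least
    [D / 2] of neighbours in [A], while a vertex of [A] has density at most [c] of uncovered
    neighbours; now count the edges between them twice. *)
Lemma second_neighbours_cover a F : a \in V -> (#|F| <= 6)%N ->
  exists Q, [/\ Q \subset nbs H (nb H a) :\: F, (#|Q| <= m)%N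
    & forall Z, (forall z, z \in Z -> z \in V /\ nb H z \subset nbs H (nb H a)) ->
        d (Z :\: nbs H Q) <= g1 / 4].
Proof.
move=> aV F6; set A := _ :\: F.
have [|Q [sQ mQ hQ]] := @greedy_cover R T V V0 (nb H) A c m _ cm.
  by move=> x _; exact: nb_subset.
exists Q; split=> // Z hZ; set Z' := Z :\: _.
have : d Z' * (D / 2) <= d A * c.
  apply: (@dens_double_count R T V V0 _ _ (nb H)) => [z|b bA].
    rewrite inE => /andP[_ /hZ[zV zA]].
    have h : nb H z \subset (nb H z :&: A) :|: F.
      apply/subsetP => t tz; rewrite in_setU in_setI tz /= in_setD.
      by rewrite (subsetP zA _ tz) andbT orNb.
    have := dens_cover R V0 h; have := degree_gt zV.
    have : d F <= c by apply: dens_small; apply: leq_trans F6 (leq_addl _ _).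
    by case: c_small; lra.
  apply: le_trans (hQ b bA); apply: dens_sub => //; apply/subsetP => z.
  by rewrite !in_set => /andP[/andP[-> _]]; rewrite -!in_nb nbC.
have dA : d A <= 1.
  rewrite -(densT R V0); apply: dens_sub => //.
  exact: subset_trans (subsetDl _ _) (nbs_subset _).
have : d A * c <= 1 * c by rewrite ler_pM2r.
rewrite mul1r => h1 h2; have {h1 h2} h := le_trans h2 h1.
by rewrite -(ler_pM2r D_gt0); move: h; rewrite /c; lra.
Qed.

(* [X] approximates the part without [a] of the bipartition to be found. It is
   built from vertices outside [F], hence definable without any [b] in [F]. *)
Record frame F a X : Prop := Frame {
  frame_sub : X \subset V;
  frame_self : a \notin X;
  frame_le : d X <= 2^-1 + e1;
  frame_def : forall b, b \in F -> b \in V ->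
    X :\ b \in definable (V :\ b) (del H b) (m + 4);
  frame_ge : forall g e E, g1 <= g -> typical k g e H ->
    E \in definable (V :\ a) (del H a) (m + 4) ->
    d (E :&: nb H a) <= g / 2 -> 2^-1 - e <= d (X :\: E);
  frame_near : forall Z, (forall z, z \in Z ->
      [/\ z \in V, nb H z \subset nbs H (nb H a) & z \notin nbs H (nb H a)]) ->
    d (Z :\: X) <= g1 / 4 }.

(** Take the neighbours of a few second neighbours of [a], minus the neighbours of a few neighbours
    of [a]. The subtracted set has density at least [1/2 - e1], which gives the upper bound. What
    remains contains almost all neighbours of [a], also after removing an [E] that meets few of
    them, so typicality gives the lower bound. *)
Lemma frame_exists F a : a \in V -> (#|F| <= 5)%N -> exists X, frame F a X.
Proof.
move=> aV F5.
have F6 : (#|a |: F| <= 6)%N by rewrite cardsU1; move: F5; case: (a \in F) => /=; clear; lia.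
have [Q [sQ mQ hQ]] := neighbours_cover aV F6.
have [S [sS mS hS]] := second_neighbours_cover aV F6.
have aF b A B : b \in F -> A \subset B :\: (a |: F) -> b \notin A.
  by move=> bF /subsetP h; apply/negP => /h; rewrite !inE bF orbT.
have sQ' : Q \subset nb H a by apply: subset_trans sQ (subsetDl _ _).
have aa A B : A \subset B :\: (a |: F) -> a \notin A.
  by move=> /subsetP h; apply/negP => /h; rewrite !inE eqxx.
have near Z : (forall z, z \in Z ->
      [/\ z \in V, nb H z \subset nbs H (nb H a) & z \notin nbs H (nb H a)]) ->
    d (Z :\: (nbs H S :\: nbs H Q)) <= g1 / 4.
  move=> hZ; apply: le_trans (hS Z _); last by move=> z /hZ[].
  apply: dens_sub => //; apply/subsetP => z; rewrite !in_setD => /andP[h zZ].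
  rewrite zZ andbT; apply: contra h => ->; rewrite andbT.
  have [_ _] := hZ z zZ; apply: contra => /nbsP[q /(subsetP sQ') qa zq].
  by apply/nbsP; exists q.
exists (nbs H S :\: nbs H Q); split=> //.
- exact: subset_trans (subsetDl _ _) (nbs_subset _).
- rewrite in_setD negb_and negbK; apply/orP; left.
  have [q qQ] : exists q, q \in Q.
    have [Q0|[q qQ]] := set_0Vmem Q; last by exists q.
    move: hQ; rewrite Q0 /nbs big_set0 dens0.
    by consts; lra.
  by apply/nbsP; exists q; rewrite // nbC (subsetP sQ').
- have h : [disjoint nbs H S :\: nbs H Q & nbs H Q].
    by rewrite -setI_eq0 setIC setIDA setIC -setIDA setDv setI0.
  have := dens_disjoint R V0 _ (nbs_subset Q) h.
  by rewrite densT // => /(_ (subset_trans (subsetDl _ _) (nbs_subset _))); lra.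
- move=> b bF bV; rewrite setDDl setUC -setDDl.
  have -> : nbs H S :\ b :\: nbs H Q = nbs (del H b) S :\: nbs (del H b) Q.
    rewrite !nbs_del ?(aF b _ _ bF sS) ?(aF b _ _ bF sQ) //.
    by apply/setP => z; rewrite !in_setD !in_set1; case: (z == b); rewrite //= andbF.
  have Vb A B : B \subset V -> A \subset B :\: (a |: F) -> A \subset V :\ b.
    move=> sB sA; apply/subsetP => z zA; rewrite in_setD1; apply/andP; split.
      by apply: contraTneq zA => ->; apply: (aF b _ _ bF sA).
    by move/(subsetP sA): zA; rewrite in_setD => /andP[_ /(subsetP sB)].
  apply: (@definable_le _ _ _ m.+3); first by clear; lia.
  by rewrite definableD // definable_nbs // definable_small // (Vb _ _ _ sS, Vb _ _ _ sQ) ?nb_subset ?nbs_subset.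
- move=> g e E g1g typ hE hd; rewrite setDDl.
  have hE' : d (nb H a :\: (nbs H S :\: (nbs H Q :|: E))) <= g.
    have h : nb H a :\: (nbs H S :\: (nbs H Q :|: E)) \subset
       (nb H a :\: (nbs H S :\: nbs H Q)) :|: (E :&: nb H a).
      apply/subsetP => z; rewrite in_setU in_setI !in_setD in_setU.
      by case: (z \in nb H a); case: (z \in E); case: (z \in nbs H S); case: (z \in nbs H Q).
    have := dens_cover R V0 h.
    (* Neighbours of [a] qualify for [near]: by [triangle_free] no two of them are adjacent. *)
    have : d (nb H a :\: (nbs H S :\: nbs H Q)) <= g1 / 4.
      apply: near => z za; split; first exact: (subsetP (nb_subset a)).
        by apply/subsetP => t tz; apply/nbsP; exists z.
      apply/negP => /nbsP[t ta]; apply/negP; rewrite nbC.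
      exact: (triangle_free cH za ta).
    by consts; lra.
  have aS : S \subset V :\ a.
    apply/subsetP => z zS; rewrite in_setD1; apply/andP; split.
      by apply: contraTneq zS => ->; apply: aa sS.
    by move/(subsetP sS): zS; rewrite in_setD => /andP[_ /(subsetP (nbs_subset _))].
  have aQ : a \notin Q by apply: aa sQ.
  have a2 t : t \in S -> exists2 v, v \in nb H a & t \in nb H v.
    by move=> /(subsetP sS); rewrite in_setD => /andP[_ /nbsP[v va tv]]; exists v.
  have hE2 : nbs (del H a) Q :|: E \in definable (V :\ a) (del H a) (m + 5).
    rewrite addnS definableU //; apply: (@definable_le _ _ _ m.+2); first by clear; lia.
    rewrite definable_nbs // definable_small //; apply/subsetP => z zQ.
    rewrite in_setD1 (subsetP (nb_subset a)) ?(subsetP sQ') // andbT.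
    by apply: contraTneq zQ => ->.
  have nE : nb H a :\: (nbs H S :\: (nbs (del H a) Q :|: E)) =
            nb H a :\: (nbs H S :\: (nbs H Q :|: E)).
    apply/setP => z; case: (eqVneq z a) => [->|za].
      by rewrite !in_setD (negbTE (nb_irr cH a)) !andbF.
    by rewrite !in_setD !in_setU nbs_del // in_setD1 za.
  have := @typical_nbs g e a S _ typ aV aS mS a2 hE2.
  rewrite nE => /(_ hE') h; apply: (le_trans h); apply: dens_sub => //.
  apply/subsetP => z; rewrite in_setD1 => /andP[za].
  by rewrite !in_setD !in_setU nbs_del // in_setD1 za.
Qed.

Lemma frame_dens_ge F a X : frame F a X -> 2^-1 - e1 <= d X.
Proof.
move=> fX; have := frame_ge fX (lexx _) typ1 (definable0 _ _ _).
by rewrite set0I dens0 setD0; apply; consts; lra.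
Qed.

(** Removing [E] loses few neighbours of [a], so the rest of [X] still has density at least
    [1/2 - e], while all of [X] has at most [1/2 + e1]. *)
Lemma frame_hit (g e : R) F a X E : frame F a X -> g1 <= g -> typical k g e H ->
  E \in definable (V :\ a) (del H a) (m + 4) ->
  d (E :&: nb H a) <= g / 2 -> d (X :&: E) <= e1 + e.
Proof.
move=> fX g1g typ hE hd; have := frame_ge fX g1g typ hE hd.
by have := frame_le fX; have := densID R V X E; lra.
Qed.

(* This will mean that [x] and [y] lie in the same part. *)
Definition par x y := nb H x :&: nb H y != set0.

Lemma parC x y : par x y = par y x. Proof. by rewrite /par setIC. Qed.

Lemma par_refl x : x \in V -> par x x.
Proof.
move=> /degree_gt h; rewrite /par setIid; apply: contraTneq h => ->.
by rewrite dens0 -leNgt ltW.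
Qed.

Lemma parP x y : reflect (exists2 w, w \in nb H x & w \in nb H y) (par x y).
Proof.
apply: (iffP (set0Pn _)) => [[w]|[w wx wy]]; last by exists w; rewrite in_setI wx.
by rewrite in_setI => /andP[]; exists w.
Qed.

Lemma par_adjacent x y : y \in nb H x -> ~~ par x y.
Proof.
move=> yx; apply/parP => -[w wx wy].
by have := triangle_free cH wx yx; rewrite nbC wy.
Qed.

(** Two rounds of [frame_hit]. As [nb H b] misses [nb H a], the frame [X] nearly misses [nb H b];
    then [X] without [b] is a definable set with few neighbours of [b], so [Y] nearly misses it. The
    error [e1 + e1] of the first round has to be within the tolerance [g2 / 2] of the second, hence
    the two scales. *)
Lemma frames_disjoint F a b X Y : a \in V -> b \in V -> a \in F -> b \in F ->
  a != b -> ~~ par a b -> frame F a X -> frame F b Y -> d (X :&: Y) <= e2 * 2.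
Proof.
move=> aV bV aF bF ab; rewrite negbK => /eqP nab fX fY.
have E1 : nb (del H a) b \in definable (V :\ a) (del H a) (m + 4).
  apply: (@definable_le _ _ _ 2); first by clear; lia.
  by rewrite definable_nb // in_setD1 eq_sym ab.
have h1 : d (X :&: nb H b) <= e1 + e1.
  have -> : X :&: nb H b = X :&: nb (del H a) b.
    apply/setP => z; rewrite !in_setI nb_del 1?eq_sym // in_setD1.
    by case: eqVneq => // ->; rewrite (negbTE (frame_self fX)).
  apply: (frame_hit fX (lexx _) typ1 E1).
  apply: (@le_trans _ _ (d set0)); last by rewrite dens0; consts; lra.
  apply: dens_sub => //; rewrite -nab setIC setIS // nb_del 1?eq_sym //.
  exact: subD1set.
have h2 : d (Y :&: (X :\ b)) <= e1 + e2.
  have g12 : g1 <= g2 by consts; lra.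
  apply: (frame_hit fY g12 typ2 (frame_def fX bF bV)).
  apply: (@le_trans _ _ (e1 + e1)); last by consts; lra.
  apply: le_trans h1; apply: dens_sub => //; rewrite setSI //.
  exact: subD1set.
apply: (@le_trans _ _ (e1 + e2)); last by consts; lra.
apply: le_trans h2; apply: dens_sub => //; apply/subsetP => z.
rewrite !in_setI in_setD1 => /andP[-> zY]; rewrite zY !andbT.
by apply: contraTneq zY => ->; rewrite (negbTE (frame_self fY)).
Qed.

(** Three nearly disjoint frames of density almost 1/2 do not fit into [V]. *)
Lemma par_three x y z : x \in V -> y \in V -> z \in V ->
  [|| par x y, par y z | par x z].
Proof.
move=> xV yV zV; apply/negPn/negP; rewrite !negb_or => /and3P[xy yz xz].
have [nxy nyz nxz] : [/\ x != y, y != z & x != z].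
  by split; [move: xy|move: yz|move: xz]; apply: contraNneq => <-; rewrite par_refl.
pose F := [set t in [:: x; y; z]].
have F5 : (#|F| <= 5)%N by rewrite cardsE; apply: leq_trans (card_size _) _.
have [X fX] := frame_exists xV F5; have [Y fY] := frame_exists yV F5.
have [Z fZ] := frame_exists zV F5.
have [xF yF zF] : [/\ x \in F, y \in F & z \in F] by rewrite !inE !eqxx !orbT.
have hXY := frames_disjoint xV yV xF yF nxy xy fX fY.
have hYZ := frames_disjoint yV zV yF zF nyz yz fY fZ.
have hXZ := frames_disjoint xV zV xF zF nxz xz fX fZ.
have hX := frame_dens_ge fX; have hY := frame_dens_ge fY; have hZ := frame_dens_ge fZ.
have e1' := dens_UI X Y; have e2' := dens_UI (X :|: Y) Z.
have : d ((X :|: Y) :&: Z) <= d (X :&: Z) + d (Y :&: Z).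
  by rewrite setIUl; apply: densU.
have : d ((X :|: Y) :|: Z) <= 1.
  rewrite -(densT R V0); apply: dens_sub => //.
  by rewrite !subUset (frame_sub fX) (frame_sub fY) (frame_sub fZ).
by consts; lra.
Qed.

(** Let [w] be a common neighbour of [x] and [y], and [v] one of [y] and [z]. Adjacent vertices have
    nearly disjoint frames of density about 1/2, so the frames of [x] and [y] both nearly fill the
    complement of that of [w]; likewise [y] and [z] with [v]. Hence the frames of [x] and [z]
    overlap in almost 1/2, against [frames_disjoint]. *)
Lemma par_trans x y z : x \in V -> y \in V -> z \in V ->
  par x y -> par y z -> par x z.
Proof.
move=> xV yV zV xy yz; apply: contraT => xz; suff: False by [].
have nxz : x != z by apply: contraNneq xz => <-; rewrite par_refl.
have /parP[w wx wy] := xy; have /parP[v vy vz] := yz.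
have [wV vV] := (subsetP (nb_subset x) _ wx, subsetP (nb_subset y) _ vy).
pose F := [set t in [:: x; y; z; w; v]].
have F5 : (#|F| <= 5)%N by rewrite cardsE; apply: leq_trans (card_size _) _.
have inF t : t \in [:: x; y; z; w; v] -> t \in F by rewrite in_set.
have [X fX] := frame_exists xV F5; have [Y fY] := frame_exists yV F5.
have [Z fZ] := frame_exists zV F5; have [W fW] := frame_exists wV F5.
have [U fU] := frame_exists vV F5.
have adj a b A B : a \in F -> b \in F -> a \in V -> b \in V -> b \in nb H a ->
    frame F a A -> frame F b B -> d (A :&: B) <= e2 * 2.
  move=> aF bF aV bV ba fA fB; apply: (@frames_disjoint F a b) => //.
    by apply: contraTneq ba => ->; exact: nb_irr.
  exact: par_adjacent.
have [xF yF zF wF vF] : [/\ x \in F, y \in F, z \in F, w \in F & v \in F].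
  by split; apply: inF; rewrite !inE eqxx ?orbT.
have hXW := adj x w _ _ xF wF xV wV wx fX fW.
have hYW := adj y w _ _ yF wF yV wV wy fY fW.
have hYU := adj y v _ _ yF vF yV vV vy fY fU.
have hZU := adj z v _ _ zF vF zV vV vz fZ fU.
have hXZ := frames_disjoint xV zV xF zF nxz xz fX fZ.
have := frame_dens_ge fX; have := frame_dens_ge fY; have := frame_dens_ge fZ.
have := frame_dens_ge fW; have := frame_dens_ge fU; have := frame_le fY.
have U3 A B (C : {set T}) : A \subset V -> B \subset V -> C \subset V ->
    d A + d B + d C <= 1 + d (A :&: B) + d (A :&: C) + d (B :&: C).
  move=> sA sB sC; have := dens_UI A B; have := dens_UI (A :|: B) C.
  have : d ((A :|: B) :&: C) <= d (A :&: C) + d (B :&: C).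
    by rewrite setIUl; apply: densU.
  have : d ((A :|: B) :|: C) <= 1.
    by rewrite -(densT R V0); apply: dens_sub => //; rewrite !subUset sA sB.
  by lra.
have [[sX sY] sZ] := (frame_sub fX, frame_sub fY, frame_sub fZ).
have := U3 X Y W sX sY (frame_sub fW); have := U3 Y Z U sY sZ (frame_sub fU).
have : d (X :&: Y) + d (Y :&: Z) <= d Y + d (X :&: Z).
  rewrite -dens_UI lerD //; apply: dens_sub => //.
    by rewrite subUset subsetIr subsetIl.
  by apply/subsetP => t; rewrite !in_setI => /andP[/andP[-> _] /andP[_ ->]].
by consts; lra.
Qed.

(** By [par_trans] and [par_three] there are at most two classes, and [s] tests membership in that
    of a fixed vertex. For the second clause, [frame_near] puts almost all of [E] inside a frame of
    [a], where [frame_hit] bounds it. *)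
Lemma bipartite_side : exists s : T -> bool,
  [/\ {in V &, forall x y, y \in nb H x -> s y != s x}
    & forall (g e : R) a E, typical k g e H -> g1 <= g -> a \in V ->
        E \in definable (V :\ a) (del H a) (m + 4) ->
        (forall z, z \in E -> z \in V /\ s z != s a) ->
        d (E :&: nb H a) <= g / 2 -> d E <= e1 * 2 + e].
Proof.
have [x0 x0V] : exists x0, x0 \in V by apply/card_gt0P.
have sP x y : x \in V -> y \in V -> par x y = (par x x0 == par y x0).
  move=> xV yV; case hx: (par x x0); case hy: (par y x0).
  - by rewrite (par_trans xV x0V yV) // parC.
  - apply/negbTE; apply: contraFN hy => h.
    by apply: par_trans hx => //; rewrite parC.
  - by apply/negbTE; apply: contraFN hx => h; apply: par_trans hy.
  - by have := par_three xV yV x0V; rewrite hx hy !orbF => ->.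
exists (fun x => par x x0); split=> [x y xV yV yx|g e a E typ g1g aV hE sE hd].
  by have := par_adjacent yx; rewrite sP // eq_sym.
have [|X fX] := @frame_exists set0 a aV; first by rewrite cards0.
have h1 := frame_hit fX g1g typ hE hd.
have near a' : a' \in V -> par a' a -> a' \in nbs H (nb H a).
  by move=> a'V /parP[w wa' wa]; apply/nbsP; exists w; rewrite // nbC.
have : d (E :\: X) <= g1 / 4.
  apply: (frame_near fX) => z /sE[zV zs]; split=> //.
    apply/subsetP => t tz; have tV := subsetP (nb_subset z) _ tz.
    apply: near => //; rewrite sP //; move: zs.
    have := par_adjacent tz; rewrite sP //.
    by case: (par z x0); case: (par t x0); case: (par a x0).
  apply/negP => /nbsP[w wa zw].
  have : par z a by apply/parP; exists w; rewrite // nbC.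
  by rewrite sP // (negbTE zs).
by have := densID R V E X; rewrite setIC; consts; lra.
Qed.

End Structure.

(* What remains of typicality once the graph is known to be bipartite with
   sides given by [s]. *)
Definition hits k (s : T -> bool) (e1 g e : R) H : Prop :=
  forall a E, a \in V -> E \in definable (V :\ a) (del H a) k ->
    (forall z, z \in E -> z \in V /\ s z != s a) ->
    dens R V (E :&: nb H a) <= g / 2 -> dens R V E <= e1 * 2 + e.

Lemma hits_rev k s (e1 g e : R) H : hits k s e1 g e H -> hits k s e1 g e (rev H).
Proof.
by move=> h a E aV; rewrite del_rev definable_rev nb_rev; apply: h.
Qed.

Definition mixed H x := (up H x != set0) && (dn H x != set0).

(** * The orientation of the edges between the two sides *)

Section Orientation.
Variables (s : T -> bool) (k : nat) (g1 g2 g3 e1 e2 e3 D : R).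
Hypothesis V0 : (0 < #|V|)%N.
Hypotheses (g1_gt0 : 0 < g1) (g1e1 : g1 <= e1) (e1g2 : e1 * 30 <= g2)
  (g2e2 : g2 <= e2) (e2g3 : e2 * 20 <= g3) (g3e3 : g3 <= e3) (e3D : e3 * 10 <= D).
Hypothesis (V_large : 1 / #|V|%:R <= g1).
Hypothesis k4 : (4 <= k)%N.
Notation d := (dens R V).
Ltac consts := move: g1_gt0 g1e1 e1g2 g2e2 e2g3 g3e3 e3D V_large.

(* Closed under [rev], so that the two orientations are treated at once. *)
Record oriented H : Prop := Oriented {
  or_cover : H \in cover_graphs V;
  or_side : {in V &, forall x y, y \in nb H x -> s y != s x};
  or_deg : forall a, a \in V -> D < d (nb H a);
  or_hit1 : hits k s e1 g1 e1 H;
  or_hit2 : hits k s e1 g2 e2 H;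
  or_hit3 : hits k s e1 g3 e3 H }.

Lemma oriented_rev H : oriented H -> oriented (rev H).
Proof.
case=> h1 h2 h3 h4 h5 h6; split; try exact: hits_rev.
- exact: cover_graphs_rev.
- by move=> x y; rewrite nb_rev; apply: h2.
- by move=> x; rewrite nb_rev; apply: h3.
Qed.

Section One.
Variable H : {set T * T}.
Hypothesis OH : oriented H.

Let cH : cover_like H.
Proof. by case: OH => + _ _ _ _ _; rewrite inE => /andP[_ /asboolP]. Qed.

Let sH x y : (x, y) \in H -> [/\ x \in V, y \in V & s y != s x].
Proof.
move=> xy; have [xV yV] : x \in V /\ y \in V.
  case: OH => + _ _ _ _ _; rewrite inE => /andP[/subsetP h _].
  by move: (h _ xy); rewrite inE => /andP[].
by split=> //; apply: (or_side OH) => //; rewrite in_nb xy.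
Qed.

Lemma side_nb x y : y \in nb H x -> [/\ x \in V, y \in V & s y != s x].
Proof. by rewrite in_nb => /orP[] /sH[] // ? ?; rewrite eq_sym. Qed.

(** Otherwise [nb H y], which is on the side opposite to [x], meets few neighbours of [x] and has
    density at most [e1 * 2 + e3], below the degree bound [D]. *)
Lemma common_neighbours x y : x \in V -> y \in V -> s x = s y ->
  g3 / 2 < d (nb H x :&: nb H y).
Proof.
move=> xV yV sxy; have dy := or_deg OH yV.
have [<-|xy] := eqVneq x y.
  by rewrite setIid; have := or_deg OH xV; consts; lra.
rewrite ltNge; apply/negP => h.
have E1 : nb (del H x) y \in definable (V :\ x) (del H x) k.
  apply: (@definable_le _ _ _ 2); first by apply: leq_trans k4.
  by rewrite definable_nb // in_setD1 eq_sym xy.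
have yx : x \notin nb H y.
  by apply/negP => /side_nb[_ _]; rewrite sxy eqxx.
have e : nb (del H x) y = nb H y.
  rewrite nb_del 1?eq_sym //; apply/setP => z; rewrite in_setD1.
  by case: eqVneq => // ->; rewrite (negbTE yx).
have := or_hit3 OH xV E1; rewrite e setIC => /(_ _ h) h'.
have : d (nb H y) <= e1 * 2 + e3.
  by apply: h' => z /side_nb[_ zV sz]; rewrite sxy.
by consts; lra.
Qed.

(** By [cover_path3] no vertex two steps below [w] is adjacent to [u]. These vertices are on the
    side opposite to [u], so [hits] at [u] makes them few. *)
Lemma below_below w u : (w, u) \in H -> d (dns H (dn H w)) <= e1 * 3.
Proof.
move=> wu; have [wV uV swu] := sH wu.
have wu' : w != u by apply: contraNneq swu => ->.
have uw : u \notin dn H w by rewrite in_dn; apply: cover_asym.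
have e : dns (del H u) (dn (del H u) w) = dns H (dn H w).
  rewrite dn_del // (_ : dn H w :\ u = dn H w); last first.
    by apply/setP => z; rewrite in_setD1; case: eqVneq => // ->; rewrite (negbTE uw).
  rewrite dns_del //; apply/setP => z; rewrite in_setD1; case: eqVneq => // ->.
  apply/esym/negbTE/dnsP => -[x]; rewrite in_dn => xw ux.
  by have := cover_path2 cH wu ux; rewrite in_nb xw orbT.
have E1 : dns H (dn H w) \in definable (V :\ u) (del H u) k.
  rewrite -e; apply: (@definable_le _ _ _ 2); first by apply: leq_trans k4.
  by rewrite definable_dns // definable_dn // in_setD1 wu'.
apply: (@le_trans _ _ (e1 * 2 + e1)); last by consts; lra.
apply: (or_hit1 OH uV E1) => [z /dnsP[x]|].
  rewrite in_dn => /sH[xV _ sxw] /sH[zV _ szx]; split=> //.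
  by move: sxw szx swu; case: (s x); case: (s w); case: (s z); case: (s u).
apply: (@le_trans _ _ (d set0)); last by rewrite dens0; consts; lra.
apply: dens_sub => //; apply/subsetP => z; rewrite in_setI => /andP[/dnsP[x]].
rewrite in_dn => xw zx zu; have := cover_path3 cH zx xw wu.
by rewrite nbC zu.
Qed.

End One.

Lemma above_above H w u : oriented H -> (u, w) \in H -> d (ups H (up H w)) <= e1 * 3.
Proof.
move=> /oriented_rev OH uw; have := @below_below _ OH w u.
by rewrite in_rev dn_rev dns_rev; apply.
Qed.

(* The vertices whose edges to the neighbours of [w] need not follow the
   pattern given by [w]. *)
Definition exceptional H w := dns H (dn H w) :|: ups H (up H w).

Lemma exceptional_rev H w : exceptional (rev H) w = exceptional H w.
Proof. by rewrite /exceptional dn_rev up_rev dns_rev ups_rev setUC. Qed.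

Lemma mixed_rev H w : mixed (rev H) w = mixed H w.
Proof. by rewrite /mixed up_rev dn_rev andbC. Qed.

Lemma dens_exceptional H w : oriented H -> mixed H w -> d (exceptional H w) <= e1 * 6.
Proof.
move=> OH /andP[/set0Pn[u]]; rewrite in_up => wu /set0Pn[v]; rewrite in_dn => vw.
have := below_below OH wu; have := above_above OH vw.
by have := densU R V0 (dns H (dn H w)) (ups H (up H w)); rewrite -/(exceptional H w); lra.
Qed.

Lemma dens1 x : d [set x] <= g1.
Proof. by rewrite /dens cards1. Qed.

(** If [z] is below [v] and adjacent to [a], the edge goes from [z] to [a], because [a] is not two
    steps below [v]; as [a] is below [w], this makes [z] exceptional for [w]. So [dn H v] meets few
    neighbours of [a] and is small by [hits] at the second scale. *)
Lemma mixed_hit H v w a : oriented H -> mixed H v -> mixed H w -> v \in V ->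
  s v != s w -> a \in dn H w -> a \notin exceptional H v -> d (dn H v) <= e2 * 2.
Proof.
move=> OH mv mw vV svw; rewrite in_dn => aw aB.
have /(side_nb OH)[aV wV saw] : w \in nb H a by rewrite in_nb aw.
have Bw := dens_exceptional OH mw.
have sav : s a = s v by move: saw svw; case: (s a); case: (s v); case: (s w).
have dvE z : z \in dn H v -> z \in nb H a -> z \in exceptional H w.
  rewrite in_dn => zv za; apply/setUP; left; apply/dnsP; exists a; first by rewrite in_dn.
  move: za; rewrite in_nb => /orP[az|//]; case/negP: aB; apply/setUP; left.
  by apply/dnsP; exists z; rewrite ?in_dn.
have [av|av] := eqVneq v a.
  apply: (@le_trans _ _ (d (exceptional H w))); last by consts; lra.
  apply: dens_sub => //; apply/subsetP => z zv; apply: dvE => //.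
  by move: zv; rewrite in_dn -av in_nb => ->; rewrite orbT.
have e : dn (del H a) v = dn H v.
  rewrite dn_del //; apply/setP => z; rewrite in_setD1; case: eqVneq => // ->.
  apply/esym/negbTE; rewrite in_dn; apply/negP => h.
  have /(side_nb OH)[_ _] : v \in nb H a by rewrite in_nb h.
  by rewrite sav eqxx.
have E1 : dn H v \in definable (V :\ a) (del H a) k.
  rewrite -e; apply: (@definable_le _ _ _ 1); first by apply: leq_trans k4.
  by rewrite definable_dn // in_setD1 av.
apply: (@le_trans _ _ (e1 * 2 + e2)); last by consts; lra.
apply: (or_hit2 OH aV E1) => [z|].
  rewrite in_dn sav => zv.
  by have /(side_nb OH)[] : z \in nb H v by rewrite in_nb zv orbT.
apply: (@le_trans _ _ (d (exceptional H w))); last by consts; lra.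
by apply: dens_sub => //; apply/subsetP => z; rewrite in_setI => /andP[]; apply: dvE.
Qed.

(** The degree of [w] prevents [dn H w] and [up H w] from both lying in the exceptional set of [v];
    by [mixed_hit] and its reverse, the degree of [v] prevents both from leaving it. *)
Lemma mixed_dichotomy H v w : oriented H -> mixed H v -> mixed H w -> v \in V ->
  w \in V -> s v != s w ->
  (d (up H w) <= e1 * 6 /\ d (dn H v) <= e2 * 2) \/
  (d (dn H w) <= e1 * 6 /\ d (up H v) <= e2 * 2).
Proof.
move=> OH mv mw vV wV svw; have Bv := dens_exceptional OH mv.
have sub_or (A B : {set T}) : A \subset B \/ exists2 a, a \in A & a \notin B.
  by case: (boolP (A \subset B)) => [|/subsetPn]; [left|right].
have dw := or_deg OH wV; have dv := or_deg OH vV.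
have dnU x : d (nb H x) <= d (up H x) + d (dn H x) by apply: densU.
have OR := oriented_rev OH.
have hr a : a \in up H w -> a \notin exceptional H v -> d (up H v) <= e2 * 2.
  move=> aw aB; have := @mixed_hit (rev H) v w a OR.
  by rewrite !mixed_rev !dn_rev exceptional_rev; apply.
case: (sub_or (dn H w) (exceptional H v)) => [h1|[a aw aB]].
  case: (sub_or (up H w) (exceptional H v)) => [h2|[b bw bB]].
    exfalso; have : d (nb H w) <= d (exceptional H v).
      by apply: dens_sub => //; rewrite subUset h1 h2.
    by consts; lra.
  right; split; last exact: (hr b).
  by apply: le_trans Bv; apply: dens_sub.
case: (sub_or (up H w) (exceptional H v)) => [h2|[b bw bB]].
  left; split; last exact: (mixed_hit OH mv mw vV svw aw aB).
  by apply: le_trans Bv; apply: dens_sub.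
exfalso; have := hr b bw bB; have := mixed_hit OH mv mw vV svw aw aB.
by have := dnU v; consts; lra.
Qed.

(** Given an edge from [z] to [x], take a common neighbour [a] of [w] and [z] not above [w]; it is
    below both, as [z] is not exceptional. A [t] above [v] and adjacent to [x] is above [x], and the
    path [a], [z], [x], [t] keeps it from being adjacent to [a]. By [hits] there are few such [t],
    yet almost all the common neighbours of [v] and [x] are of this kind. *)
Lemma mixed_direction H v w x z : oriented H -> mixed H v -> mixed H w ->
  v \in V -> w \in V -> s v != s w ->
  d (up H w) <= e1 * 6 -> d (dn H v) <= e2 * 2 ->
  s x = s v -> s z = s w -> x \notin exceptional H v -> z \notin exceptional H w ->
  (z, x) \notin H.
Proof.
move=> OH mv mw vV wV svw dw dv sx sz xB zB; apply/negP => zx.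
have cH : cover_like H by case: OH => + _ _ _ _ _; rewrite inE => /andP[_ /asboolP].
have /(side_nb OH)[zV xV _] : x \in nb H z by rewrite in_nb zx.
have cwz := common_neighbours OH wV zV (esym sz).
have [a] : exists2 a, a \in nb H w :&: nb H z & a \notin up H w :|: [set v].
  apply: (@dens_nonemptyD R T V V0 _ _ (e1 * 6 + g1)); last by consts; lra.
  by have := densU R V0 (up H w) [set v]; have := dens1 v; lra.
rewrite in_setI in_setU in_set1 negb_or in_up => /andP[wa za] /andP[aw nav].
have {}aw : (a, w) \in H by move: wa; rewrite in_nb (negbTE aw).
have /(side_nb OH)[aV _ saw] : w \in nb H a by rewrite in_nb aw.
have az : (a, z) \in H.
  move: za; rewrite in_nb => /orP[za|//]; case/negP: zB; apply/setUP; left.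
  by apply/dnsP; exists a; rewrite ?in_dn.
have ax : a != x.
  by apply: contraTneq az => ->; apply: cover_asym.
have sav : s a = s v by move: saw svw; case: (s a); case: (s v); case: (s w).
have nob t y : s t = s y -> t \notin nb H y.
  by move=> e; apply/negP => /(side_nb OH)[_ _]; rewrite e eqxx.
have eE : up (del H a) v :&: nb (del H a) x = up H v :&: nb H x.
  rewrite up_del 1?eq_sym // nb_del 1?eq_sym //; apply/setP => t.
  rewrite !in_setI !in_setD1; case: eqVneq => //= ->.
  by rewrite (negbTE (nob a x _)) ?andbF // sav sx.
have E1 : up H v :&: nb H x \in definable (V :\ a) (del H a) k.
  rewrite -eE; apply: (@definable_le _ _ _ 4) => //.
  by rewrite definableI ?definable_nb ?definable_up ?in_setD1 1?eq_sym ?ax ?nav.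
have hE : d (up H v :&: nb H x) <= e1 * 2 + e1.
  apply: (or_hit1 OH aV E1) => [t|].
    rewrite in_setI sav => /andP[vt _].
    by have /(side_nb OH)[] : t \in nb H v by rewrite in_nb -in_up vt.
  apply: (@le_trans _ _ (d set0)); last by rewrite dens0; consts; lra.
  apply: dens_sub => //; apply/subsetP => t; rewrite !in_setI in_up.
  case/andP=> /andP[vt xt] at_.
  have xt' : (x, t) \in H.
    move: xt; rewrite in_nb => /orP[//|tx]; case/negP: xB; apply/setUP; right.
    by apply/upsP; exists t; rewrite ?in_up.
  by have := cover_path3 cH az zx xt'; rewrite at_.
have := common_neighbours OH vV xV (esym sx).
have h : nb H v :&: nb H x \subset (up H v :&: nb H x) :|: dn H v.
  apply/subsetP => t; rewrite in_setI => /andP[/setUP[tv|tv] tx].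
    by apply/setUP; left; rewrite in_setI tv.
  by apply/setUP; right.
by have := dens_cover R V0 h; consts; lra.
Qed.

(** [A] is the bottom layer, [B] the middle one, and the other vertices form the top. *)
Definition layered H : Prop := exists A B : {set T},
  [/\ B \subset V, A \subset V :\: B
    & H \subset setX A B :|: setX B (V :\: B :\: A)].

(** [t] is the lower side and [B] an exceptional set. The last clause provides the 4-cycles used in
    [bilevel_determined]. *)
Definition nearly_bilevel H : Prop := exists (t : {set T}) (B : {set T}),
  [/\ d B <= e1 * 12,
      forall x y, (x, y) \in H -> (x \in t) != (y \in t),
      forall x y, (x, y) \in H -> x \notin B -> y \notin B -> x \in t
    & {in V &, forall x y, (x \in t) = (y \in t) ->
        exists2 w, w \in nb H x :&: nb H y & w \notin B}].

(** The pure side splits into vertices with no edge from below, which form the bottom, and the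
    others, which form the top; the opposite side is the middle layer. *)
Lemma layered_of_pure H (b : bool) : oriented H ->
  (forall x, x \in V -> s x = b -> ~~ mixed H x) -> layered H.
Proof.
move=> OH pure.
exists [set x in V | (s x == b) && (dn H x == set0)], [set x in V | s x != b].
split.
- by apply/subsetP => x; rewrite !inE => /andP[].
- by apply/subsetP => x; rewrite !inE => /and3P[-> /eqP ->]; rewrite eqxx.
apply/subsetP => -[x y] xy.
have /(side_nb OH)[xV yV sxy] : y \in nb H x by rewrite in_nb xy.
have y0 : dn H y != set0 by apply/set0Pn; exists x; rewrite in_dn.
have x0 : up H x != set0 by apply/set0Pn; exists y; rewrite in_up.
rewrite in_setU !in_setX !in_setD !in_set xV yV /= (negbTE y0) andbF /=.
have [sx|sx] := eqVneq (s x) b.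
  have := pure x xV sx; rewrite /mixed x0 /= negbK => ->.
  by rewrite -sx sxy.
by rewrite /= andbT; move: sxy sx; case: (s x); case: (s y); case: (b).
Qed.

Lemma layered_or_bilevel H : oriented H -> layered H \/ nearly_bilevel H.
Proof.
move=> OH.
have [?|/existsNP[v /not_implyP[vV /not_implyP[sv /negP]]]] := pselect
  (forall x, x \in V -> s x = true -> ~~ mixed H x).
  by left; apply: (layered_of_pure (b := true)).
rewrite negbK => mv.
have [?|/existsNP[w /not_implyP[wV /not_implyP[sw /negP]]]] := pselect
  (forall x, x \in V -> s x = false -> ~~ mixed H x).
  by left; apply: (layered_of_pure (b := false)).
rewrite negbK => mw; right.
pose B := exceptional H v :|: exceptional H w.
have Bd : d B <= e1 * 12.
  have := dens_exceptional OH mv; have := dens_exceptional OH mw.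
  by have := densU R V0 (exceptional H v) (exceptional H w); rewrite -/B; lra.
have nB x : x \notin B -> x \notin exceptional H v /\ x \notin exceptional H w.
  by rewrite in_setU negb_or => /andP[].
have cn x y : x \in V -> y \in V -> s x = s y ->
    exists2 w, w \in nb H x :&: nb H y & w \notin B.
  move=> xV yV sxy; apply: (@dens_nonemptyD R T V V0 _ _ (e1 * 12)) => //.
  by have := common_neighbours OH xV yV sxy; consts; lra.
have sd x y : (x, y) \in H -> [/\ x \in V, y \in V & s y != s x].
  by move=> xy; apply: (side_nb OH); rewrite in_nb xy.
have svw : s v != s w by rewrite sv sw.
case: (mixed_dichotomy OH mv mw vV wV svw) => -[h1 h2].
  exists [set x | s x], B; split=> //.
  - by move=> x y /sd[_ _]; rewrite !in_set eq_sym.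
  - move=> x y xy /nB[xv xw] /nB[yv yw].
    have [_ _ sxy] := sd x y xy; rewrite in_set; case sx: (s x) => //.
    have sy : s y = s v by move: sxy; rewrite sx sv; case: (s y).
    have := mixed_direction OH mv mw vV wV svw h1 h2 sy (_ : s x = s w) yv xw.
    by rewrite sx sw xy; apply.
  - by move=> x y xV yV; rewrite !in_set; apply: cn.
(* Here the roles of up and down are exchanged, so [mixed_direction] is applied to [rev H]. *)
exists [set x | ~~ s x], B; split=> //.
- by move=> x y /sd[_ _]; rewrite !in_set; case: (s x); case: (s y).
- move=> x y xy /nB[xv xw] /nB[yv yw].
  have [_ _ sxy] := sd x y xy; rewrite in_set; case sx: (s x) => //.
  have sy : s y = s w by move: sxy; rewrite sx sw; case: (s y).
  have := @mixed_direction (rev H) v w x y (oriented_rev OH).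
  rewrite !mixed_rev !exceptional_rev up_rev dn_rev in_rev xy sv sx sy sw.
  by move=> /(_ mv mw vV wV isT h1 h2 erefl erefl xv yw).
by move=> x y xV yV; rewrite !in_set => /negb_inj; apply: cn.
Qed.

End Orientation.

Lemma typical_structure H (m k : nat) (g1 g2 g3 e1 e2 e3 D : R) :
  (0 < #|V|)%N -> H \in cover_graphs V ->
  0 < g1 -> g1 <= e1 -> e1 * 30 <= g2 -> g2 <= e2 -> e2 * 20 <= g3 ->
  g3 <= e3 -> e3 * 10 <= D -> D <= 4^-1 ->
  (m + 6 <= k)%N -> 1 < g1 * D / 8 * m%:R -> (m + 6)%:R / #|V|%:R <= g1 * D / 8 ->
  typical k g1 e1 H -> typical k g2 e2 H -> typical k g3 e3 H -> typical k D 4^-1 H ->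
  layered H \/ nearly_bilevel e1 H.
Proof.
move=> V0 HG g10 ge1 eg1 ge2 eg2 ge3 eD D4 km cm cV t1 t2 t3 tD.
have e2D : e2 * 200 <= D by lra.
have [s [h1 h2]] := bipartite_side V0 HG g10 ge1 eg1 ge2 e2D D4 km cm cV t1 t2 tD.
have V1 : 1 / #|V|%:R <= g1.
  apply: (@le_trans _ _ ((m + 6)%:R / #|V|%:R)).
    by rewrite ler_pM2r ?invr_gt0 ?ltr0n // -[1]/(1%:R) ler_nat addn_gt0 orbT.
  apply: le_trans cV _.
  have : g1 * D <= g1 * 4^-1 by rewrite ler_pM2l.
  by lra.
have k4 : (4 <= m + 4)%N by rewrite leq_addl.
apply: (@layered_or_bilevel s _ _ _ _ _ _ _ _ V0 g10 ge1 eg1 ge2 eg2 ge3 eD V1 k4).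
split=> //.
- by move=> a; apply: (degree_gt tD).
- by move=> a E aV hE sE hd; apply: (h2 g1 e1) hd => //.
- by move=> a E aV hE sE hd; apply: (h2 g2 e2) hd => //; lra.
- by move=> a E aV hE sE hd; apply: (h2 g3 e3) hd => //; lra.
Qed.

End Typical.

(** * Counting *)

Section Exp2.
Variable R : realType.
Implicit Types x y c : R.

Definition exp2 x : R := expR (x * ln 2).

Lemma ln2_gt0 : 0 < ln 2 :> R.
Proof. by rewrite ln_gt0 // ltr1n. Qed.

Lemma exp2D x y : exp2 (x + y) = exp2 x * exp2 y.
Proof. by rewrite /exp2 mulrDl expRD. Qed.

Lemma exp2_gt0 x : 0 < exp2 x. Proof. exact: expR_gt0. Qed.

Lemma exp2_ge0 x : 0 <= exp2 x. Proof. exact: expR_ge0. Qed.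

Lemma exp2_le x y : x <= y -> exp2 x <= exp2 y.
Proof. by move=> h; rewrite ler_expR ler_pM2r ?ln2_gt0. Qed.

Lemma exp2_nat n : exp2 n%:R = (2 ^ n)%N%:R.
Proof. by rewrite /exp2 expRM_natl lnK ?natrX // posrE. Qed.

Lemma exp2_ge x : 1 + x * ln 2 <= exp2 x.
Proof. exact: expR_ge1Dx. Qed.

Lemma exp2X x j : exp2 x ^+ j = exp2 (x * j%:R).
Proof. by rewrite /exp2 -expRM_natr mulrAC. Qed.

Lemma exp2_AGM x y : exp2 ((x + y) / 2) * 2 <= exp2 x + exp2 y.
Proof.
have e z : exp2 z = exp2 (z / 2) ^+ 2 by rewrite exp2X divfK.
rewrite mulrDl exp2D (e x) (e y).
by have := sqr_ge0 (exp2 (x / 2) - exp2 (y / 2)); rewrite sqrrB; lra.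
Qed.

Lemma exp2_unbounded c (eta : R) : 0 < eta ->
  exists N, forall n, (N <= n)%N -> c <= exp2 (eta * n%:R).
Proof.
move=> eta0; have h : 0 < eta * ln 2 by rewrite mulr_gt0 ?ln2_gt0.
have [N hN] : exists N : nat, c / (eta * ln 2) <= N%:R.
  exists (Num.bound `|c / (eta * ln 2)|).
  exact: le_trans (ler_norm _) (ltW (archi_boundP (normr_ge0 _))).
exists N => n Nn; apply: le_trans (exp2_ge _).
rewrite mulrAC -lerBlDl; apply: (@le_trans _ _ c); first by rewrite lerBlDl lerDr ler01.
by rewrite mulrC -ler_pdivrMr // (le_trans hN) // ler_nat.
Qed.

Lemma exp2_dominates c (eta : R) (j : nat) : 0 < eta ->
  exists N, forall n, (N <= n)%N -> c * n.+1%:R ^+ j <= exp2 (eta * n%:R).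
Proof.
move=> eta0.
pose d := eta / 2 / j.+1%:R.
have d0 : 0 < d by rewrite !divr_gt0 ?ltr0n.
have dl : 0 < d * ln 2 by rewrite mulr_gt0 ?ln2_gt0.
pose A := 1 + (d * ln 2)^-1.
have A1 : 1 <= A by rewrite lerDl invr_ge0 ltW.
have hA n : n.+1%:R <= A * exp2 (d * n%:R).
  have := exp2_ge (d * n%:R); rewrite mulrAC => h.
  apply: le_trans (ler_wpM2l _ h); last by apply: le_trans A1.
  rewrite /A mulrDr mulr1 mulrA -natr1 addrC lerD //.
  apply: ler_peMl => //; rewrite mulrDl mul1r mulVf ?gt_eqF //.
  by rewrite lerDr ltW.
have [N hN] := exp2_unbounded (`|c| * A ^+ j) (divr_gt0 eta0 (ltr0n _ 2)).
exists N => n /hN h.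
apply: (@le_trans _ _ (`|c| * (A * exp2 (d * n%:R)) ^+ j)).
  apply: (@le_trans _ _ (`|c| * n.+1%:R ^+ j)); first by rewrite ler_wpM2r ?exprn_ge0 ?ler_norm.
  rewrite ler_wpM2l //.
  by apply: lerXn2r; rewrite ?nnegrE ?mulr_ge0 ?exp2_ge0 // (le_trans _ A1).
rewrite exprMn mulrA exp2X.
have -> : eta * n%:R = eta / 2 * n%:R + eta / 2 * n%:R by lra.
rewrite exp2D; apply: ler_pM => //; rewrite ?exp2_ge0 ?mulr_ge0 ?exprn_ge0 //.
  exact: le_trans A1.
apply: exp2_le; rewrite mulrAC ler_wpM2r //.
by rewrite /d mulrAC ler_pdivrMr ?ltr0n // ler_pM2l ?divr_gt0 // ler_nat.
Qed.

End Exp2.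

(** * Union bounds and the number of small sets *)

Section Cardinals.
Variable R : realType.

Lemma card_bigcup_le (I T : finType) (P : {set I}) (F : I -> {set T}) (c : R) :
  (forall i, i \in P -> #|F i|%:R <= c) ->
  #|\bigcup_(i in P) F i|%:R <= #|P|%:R * c.
Proof.
move=> h; rewrite [leRHS]mulr_natl -[leRHS]sumr_const.
apply: (@le_trans _ _ (\sum_(i in P) #|F i|%:R)); last by apply: ler_sum => i /h.
rewrite -natr_sum ler_nat; elim/big_rec2: _ => [|i A n _ hA]; first by rewrite cards0.
by rewrite (leq_trans (leq_card_setU _ _)) // leq_add2l.
Qed.

Lemma card_bigcup_sum (I T : finType) (P : {set I}) (F : I -> {set T}) :
  (#|\bigcup_(i in P) F i| <= \sum_(i in P) #|F i|)%N.
Proof.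
elim/big_rec2: _ => [|i A n _ hA]; first by rewrite cards0.
by rewrite (leq_trans (leq_card_setU _ _)) // leq_add2l.
Qed.

Lemma sum_powerset (T : finType) (V : {set T}) (f : nat -> nat) :
  (\sum_(B in powerset V) f #|B| = \sum_(b < #|V|.+1) 'C(#|V|, b) * f b)%N.
Proof.
rewrite (partition_big (fun B : {set T} => inord #|B| : 'I_#|V|.+1) xpredT) //=.
apply: eq_bigr => b _; have <- := cards_draws V b.
rewrite -[X in (X * _)%N]sum1_card big_distrl /=.
apply: congr_big => // B.
- rewrite !inE; case: (boolP (B \subset V)) => //= sB.
  rewrite -val_eqE /= inordK // ltnS; exact: subset_leq_card.
- by rewrite !inE mul1n => /andP[sB /eqP <-]; rewrite inordK // ltnS subset_leq_card.
Qed.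

Definition small_sets (T : finType) (V : {set T}) (g : R) : {set {set T}} :=
  [set S : {set T} | (S \subset V) && (dens R V S <= g)].

(* Chernoff: each small set has weight at least [x `^ (g n)] among the
   weights [x ^+ #|S|], which add up to [(1 + x) ^+ n]. *)
Lemma small_sets_entropy (e : R) : 0 < e -> exists g : R, [/\ 0 < g, g <= e
  & forall (T : finType) (V : {set T}), (0 < #|V|)%N ->
      #|small_sets V g|%:R <= exp2 (e * #|V|%:R)].
Proof.
move=> e0; have l2 := ln2_gt0 R.
pose x := Num.min (e * ln 2 / 2) 2^-1.
have x0 : 0 < x by rewrite lt_min invr_gt0 ltr0n andbT divr_gt0 ?mulr_gt0.
have x1 : x < 1 by rewrite gt_min [X in _ || X]invf_lt1 ?ltr1n ?orbT.
have lx : 0 < - ln x by rewrite oppr_gt0 ln_lt0 // x0.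
exists (Num.min e (x / - ln x)); split.
- by rewrite lt_min e0 divr_gt0.
- by rewrite ge_min lexx.
move=> T V V0; set g := Num.min _ _.
have gl : g * - ln x <= x by rewrite -ler_pdivlMr // ge_min lexx orbT.
have n0 : 0 < #|V|%:R :> R by rewrite ltr0n.
have w S : S \in small_sets V g -> expR (ln x * (g * #|V|%:R)) <= x ^+ #|S|.
  rewrite inE => /andP[_]; rewrite /dens ler_pdivrMr // => h.
  rewrite -[x in x ^+ _]lnK ?posrE // -expRM_natr ler_expR.
  by rewrite -lerN2 -!mulNr ler_pM2l.
have : #|small_sets V g|%:R * expR (ln x * (g * #|V|%:R)) <= (1 + x) ^+ #|V|.
  rewrite mulr_natl -sumr_const.
  apply: le_trans (ler_sum _ w) _.
  have -> : (1 + x) ^+ #|V| = \prod_(i : T) (1 + (if i \in V then x else 0)).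
    rewrite -prodr_const [LHS]big_mkcond; apply: eq_bigr => i _.
    by case: ifP; rewrite ?addr0.
  under [X in _ <= X]eq_bigr do rewrite addrC.
  rewrite bigA_distr big_mkcond /=; apply: ler_sum => S _.
  have p0 : 0 <= \prod_i (if i \in S then if i \in V then x else 0 else 1 : R).
    by apply: prodr_ge0 => i _; case: ifP => // _; case: ifP => // _; apply: ltW.
  case: ifP => // /[!inE] /andP[/subsetP sS _].
  rewrite -prodr_const big_mkcond /=; apply: ler_prod => i _.
  by case: ifP => iS; rewrite ?(sS i iS) ?lexx ?ler01 ?andbT ?ltW.
have : (1 + x) ^+ #|V| <= expR (x * #|V|%:R).
  by rewrite expRM_natr; apply: lerXn2r; rewrite ?nnegrE ?expR_ge0 ?expR_ge1Dx // addr_ge0 // ltW.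
move=> h1 h2; have {h1 h2} := le_trans h2 h1.
rewrite -ler_pdivlMr ?expR_gt0 // -expRN -expRD => h; apply: le_trans h _.
rewrite ler_expR -mulNr mulrA -mulrDl mulrAC ler_pM2r //.
have : x <= e * ln 2 / 2 by rewrite ge_min lexx.
by rewrite mulNr [ln x * g]mulrC -mulrN; lra.
Qed.

End Cardinals.

(** * Numbers of layered, atypical and nearly bilevel graphs *)

Section Counting.
Variable R : realType.

(* A layered graph is given by its middle layer, of size [b], the bottom layer
   inside the rest and a subset of the [(n - b) * b] possible edges. *)
Definition layered_bound n : nat := (\sum_(b < n.+1) 'C(n, b) * 2 ^ ((n - b) * b.+1))%N.
Definition bipartite_bound n : nat := (\sum_(b < n.+1) 'C(n, b) * 2 ^ ((n - b) * b))%N.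

Lemma layered_bound_gt0 n : (0 < layered_bound n)%N.
Proof. by rewrite /layered_bound big_ord_recl bin0 mul1n addn_gt0 expn_gt0. Qed.

(** The terms of the two sums differ by a factor [2 ^ (n - b)]. Replacing [b] by [n - b] turns this
    factor into [2 ^ b], and the average of the two is at least [2 ^ (n / 2)]. *)
Lemma bipartite_layered_bound n :
  exp2 (n%:R / 2 : R) * (bipartite_bound n)%:R <= (layered_bound n)%:R.
Proof.
have e1 : (layered_bound n)%:R =
    \sum_(b < n.+1) ('C(n, b) * 2 ^ ((n - b) * b))%N%:R * exp2 ((n - b)%N%:R : R).
  rewrite natr_sum; apply: eq_bigr => b _.
  by rewrite exp2_nat -natrM -mulnA -expnD mulnS addnC.
have e2 : (layered_bound n)%:R =
    \sum_(b < n.+1) ('C(n, b) * 2 ^ ((n - b) * b))%N%:R * exp2 (b%:R : R).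
  rewrite e1 (reindex_inj rev_ord_inj) /=; apply: eq_bigr => b _.
  have bn : (b <= n)%N by rewrite -ltnS.
  by rewrite subSS subKn // bin_sub // [(b * _)%N]mulnC.
have : exp2 (n%:R / 2 : R) * (bipartite_bound n)%:R * 2 <=
    (layered_bound n)%:R + (layered_bound n)%:R.
  rewrite {1}e1 e2 -big_split natr_sum mulr_sumr mulr_suml; apply: ler_sum => b _.
  rewrite /= -mulrDr mulrAC mulrC ler_wpM2l //=.
  apply: le_trans (exp2_AGM _ _); rewrite -natrD subnK // -ltnS.
  exact: ltn_ord.
by lra.
Qed.

(** Pascal's rule regroups the sum for [n + 1] so that the term of index [b] is multiplied by
    [2 ^ (b + 1) + 2 ^ (n - b)], to which the inequality of means applies. *)
Lemma layered_bound_step n :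
  exp2 (n%:R / 2 : R) * (layered_bound n)%:R <= (layered_bound n.+1)%:R.
Proof.
have e : layered_bound n.+1 = (\sum_(b < n.+1)
    'C(n, b) * (2 ^ ((n.+1 - b) * b.+1) + 2 ^ ((n - b) * b.+2)))%N.
  under [RHS]eq_bigr do rewrite mulnDr.
  rewrite big_split /= /layered_bound big_ord_recl.
  under [X in (_ + X)%N]eq_bigr => b _ do rewrite lift0 binS mulnDl.
  rewrite big_split /= addnA [X in (_ + X + _)%N]big_ord_recr /= (bin_small (ltnSn n)) mul0n addn0.
  by congr (_ + _)%N; rewrite [RHS]big_ord_recl !bin0.
rewrite e [leRHS]natr_sum /layered_bound natr_sum mulr_sumr; apply: ler_sum => b _.
rewrite [leRHS]natrM natrD [('C(n, b) * _)%N%:R]natrM mulrCA ler_wpM2l //.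
have bn : (b <= n)%N by rewrite -ltnS.
have -> : ((n.+1 - b) * b.+1 = (n - b) * b.+1 + b.+1)%N by rewrite subSn // mulSn addnC.
have -> : ((n - b) * b.+2 = (n - b) * b.+1 + (n - b))%N by rewrite mulnS addnC.
rewrite !expnD !natrM -mulrDr mulrC ler_wpM2l // -!(exp2_nat R).
apply: (@le_trans _ _ (exp2 (b%:R : R) + exp2 ((n - b)%N%:R : R))); last first.
  by rewrite lerD2r exp2_le // ler_nat.
apply: le_trans (exp2_AGM _ _).
rewrite -natrD subnKC // ler_pMr ?exp2_gt0 //; lra.
Qed.

Section Graphs.
Variables (T : finType) (V : {set T}).
Implicit Types (H : {set T * T}) (A B X Y : {set T}) (x y z w a : T).

Lemma cover_graphs_subset H : H \in cover_graphs V -> H \subset setX V V.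
Proof. by rewrite inE => /andP[]. Qed.

Lemma cover_graphs_cover H : H \in cover_graphs V -> cover_like H.
Proof. by rewrite inE => /andP[_ /asboolP]. Qed.

Lemma card_cover_graphs : (#|cover_graphs V| <= 2 ^ (#|V| * #|V|))%N.
Proof.
rewrite -cardsX -card_powerset subset_leq_card //.
by apply/subsetP => H /cover_graphs_subset; rewrite inE.
Qed.

Lemma card_setD_sub A B : B \subset A -> #|A :\: B| = (#|A| - #|B|)%N.
Proof. by move=> sB; rewrite cardsD (setIidPr sB). Qed.

Lemma layered_pairs A B : B \subset V -> A \subset V :\: B ->
  (#|setX A B :|: setX B (V :\: B :\: A)| <= (#|V| - #|B|) * #|B|)%N.
Proof.
move=> sB sA; apply: leq_trans (leq_card_setU _ _) _.
rewrite !cardsX [(#|B| * _)%N]mulnC -mulnDl leq_mul2r; apply/orP; right.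
by rewrite -(card_setD_sub sB) (card_setD_sub sA) subnKC // subset_leq_card.
Qed.

Lemma layered_count : (#|[set H in cover_graphs V | `[< layered V H >]]| <= layered_bound #|V|)%N.
Proof.
pose F B := \bigcup_(A in powerset (V :\: B)) powerset (setX A B :|: setX B (V :\: B :\: A)).
apply: (@leq_trans #|\bigcup_(B in powerset V) F B|).
  apply/subset_leq_card/subsetP => H; rewrite inE => /andP[_ /asboolP[A [B [sB sA sH]]]].
  by apply/bigcupP; exists B; rewrite ?inE //; apply/bigcupP; exists A; rewrite inE.
apply: leq_trans (card_bigcup_sum _ _) _.
rewrite /layered_bound -(sum_powerset V (fun b => 2 ^ ((#|V| - b) * b.+1))%N).
apply: leq_sum => B; rewrite inE => sB; apply: leq_trans (card_bigcup_sum _ _) _.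
apply: (@leq_trans (\sum_(A in powerset (V :\: B)) 2 ^ ((#|V| - #|B|) * #|B|))%N).
  apply: leq_sum => A; rewrite inE => sA; rewrite card_powerset leq_exp2l //.
  exact: layered_pairs.
by rewrite sum_nat_const card_powerset card_setD_sub // -expnD mulnS.
Qed.

(** The failure of [typical] at one vertex. *)
Definition bad_at k (g e : R) a : {set {set T * T}} :=
  [set H in cover_graphs V | `[< exists X Y,
    [/\ X \in definable (V :\ a) (del H a) k, Y \in definable (V :\ a) (del H a) k,
        dens R V (nb H a :\: X) <= g,
        forall z, z \in X -> z \in nb H a -> (z \in up H a) = (z \in Y)
      & dens R V X < 2^-1 - e] >]].

Lemma cover_graph_determined H1 H2 a : H1 \in cover_graphs V -> H2 \in cover_graphs V ->
  del H1 a = del H2 a -> nb H1 a = nb H2 a -> up H1 a = up H2 a -> H1 = H2.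
Proof.
move=> h1 h2 ed en eu; apply/setP => -[x y].
have e1 t : ((a, t) \in H1) = ((a, t) \in H2) by rewrite -!in_up eu.
have e2 t : ((t, a) \in H1) = ((t, a) \in H2).
  case: (boolP (t \in nb H1 a)) => ht.
    have ht2 := ht; rewrite en in ht2.
    by rewrite (nb_up (cover_graphs_cover h1) ht) (nb_up (cover_graphs_cover h2) ht2) e1.
  have ht2 := ht; rewrite en in ht2; move: ht ht2.
  by rewrite !in_nb !negb_or => /andP[_ /negbTE ->] /andP[_ /negbTE ->].
have [->|xa] := eqVneq x a; first exact: e1.
have [->|ya] := eqVneq y a; first exact: e2.
have : ((x, y) \in del H1 a) = ((x, y) \in del H2 a) by rewrite ed.
by rewrite !in_del xa ya !andbT.
Qed.

Lemma nb_subsetV H x : H \in cover_graphs V -> nb H x \subset V.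
Proof.
move=> /cover_graphs_subset/subsetP sH; apply/subsetP => y.
by rewrite in_nb => /orP[] /sH; rewrite inE => /andP[].
Qed.

(** The edges at [a] are encoded by the neighbours in [X], whose orientation is read off from [Y],
    and by two small sets: the neighbours outside [X] and the upper ones among these. *)
Lemma extensions_count a (H' : {set T * T}) X Y (g : R) : (0 < #|V|)%N ->
  (#|[set H in cover_graphs V | [&& del H a == H', (dens R V (nb H a :\: X) <= g)%R
      & [forall z, (z \in X) ==> (z \in nb H a) ==> ((z \in up H a) == (z \in Y))]]]|
   <= 2 ^ #|X| * (#|small_sets V g| * #|small_sets V g|))%N.
Proof.
move=> V0; set E := [set H in _ | _].
pose f H := (nb H a :&: X, (nb H a :\: X, up H a :\: X)).
rewrite -card_powerset -!cardsX -(card_in_imset (f := f) (D := E)).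
  apply/subset_leq_card/subsetP => _ /imsetP[H + ->].
  rewrite in_set => /andP[HG /and3P[_ hd _]].
  rewrite !in_setX powersetE subsetIr /= !in_set hd andbT.
  have sV := subset_trans (subsetDl (nb H a) X) (nb_subsetV _ HG).
  have su : up H a :\: X \subset nb H a :\: X by rewrite setSD // subsetUl.
  by rewrite sV (subset_trans su sV) (le_trans (dens_sub R V0 su) hd).
move=> H1 H2; rewrite in_set => /andP[G1 /and3P[/eqP d1 _ /forallP p1]].
rewrite in_set => /andP[G2 /and3P[/eqP d2 _ /forallP p2]] [ei ed eu].
have en : nb H1 a = nb H2 a by rewrite -(setID (nb H1 a) X) ei ed setID.
apply: (cover_graph_determined G1 G2 _ en); first by rewrite d1 d2.
apply/setP => z; case: (boolP (z \in X)) => zX; last first.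
  by move/setP/(_ z): eu; rewrite !in_setD zX.
case: (boolP (z \in nb H1 a)) => zn.
  have /implyP/(_ zX)/implyP/(_ zn)/eqP -> := p1 z.
  by rewrite en in zn; have /implyP/(_ zX)/implyP/(_ zn)/eqP -> := p2 z.
have zn2 := zn; rewrite en in zn2; move: zn zn2.
by rewrite !in_setU !negb_or => /andP[/negbTE -> _] /andP[/negbTE -> _].
Qed.

(** Sum [extensions_count] over the graphs without [a] and the polynomially many pairs [X], [Y]; the
    gain comes from [#|X|] being below [(1/2 - e) n]. *)
Lemma bad_count k (g e s : R) a : a \in V -> 0 <= s ->
  #|small_sets V g|%:R <= s ->
  #|bad_at k g e a|%:R <= #|cover_graphs (V :\ a)|%:R *
    (((4 * #|V|.+1) ^ (2 ^ k)) ^ 2)%N%:R * (exp2 ((2^-1 - e) * #|V|%:R) * s ^+ 2).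
Proof.
move=> aV s0 hs; have V0 : (0 < #|V|)%N by apply/card_gt0P; exists a.
have vR : 0 < #|V|%:R :> R by rewrite ltr0n.
pose D H' := setX [set X in definable (V :\ a) H' k | dens R V X < 2^-1 - e]
                  (definable (V :\ a) H' k).
pose E H' (p : {set T} * {set T}) := [set H in cover_graphs V |
  [&& del H a == H', (dens R V (nb H a :\: p.1) <= g)%R
    & [forall z, (z \in p.1) ==> (z \in nb H a) ==> ((z \in up H a) == (z \in p.2))]]].
have sub : bad_at k g e a \subset
    \bigcup_(H' in cover_graphs (V :\ a)) \bigcup_(p in D H') E H' p.
  apply/subsetP => H; rewrite in_set => /andP[HG /asboolP[X [Y [hX hY hd p hl]]]].
  apply/bigcupP; exists (del H a); first exact: cover_graphs_del.
  apply/bigcupP; exists (X, Y); first by rewrite in_setX in_set hX hY hl.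
  rewrite in_set HG eqxx hd /=; apply/forallP => z; apply/implyP => zX.
  by apply/implyP => zn; rewrite p.
apply: (@le_trans _ _ (#|\bigcup_(H' in cover_graphs (V :\ a)) \bigcup_(p in D H') E H' p|%:R)).
  by rewrite ler_nat subset_leq_card.
rewrite -mulrA; apply: card_bigcup_le => H' _.
apply: (@le_trans _ _ (#|D H'|%:R * (exp2 ((2^-1 - e) * #|V|%:R) * s ^+ 2))).
  apply: card_bigcup_le => -[X Y]; rewrite in_setX in_set => /andP[/andP[_ hX] _].
  apply: (@le_trans _ _ ((2 ^ #|X|)%N%:R * (#|small_sets V g|%:R * #|small_sets V g|%:R))).
    by rewrite -!natrM ler_nat; apply: extensions_count.
  apply: ler_pM; rewrite ?ler0n ?mulr_ge0 //; last by rewrite expr2 ler_pM.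
  rewrite -exp2_nat exp2_le //; move: hX; rewrite /dens ltr_pdivrMr //.
  exact: ltW.
rewrite ler_wpM2r ?mulr_ge0 ?exp2_ge0 ?exprn_ge0 // ler_nat.
rewrite cardsX -mulnn; have F0 : (#|definable (V :\ a) H' k| <= (4 * #|V|.+1) ^ (2 ^ k))%N.
  apply: leq_trans (_ : 4 * #|definable (V :\ a) H' k| <= _)%N; first by rewrite leq_pmull.
  apply: leq_trans (card_definable _ _ _) _.
  by rewrite leq_exp2r ?expn_gt0 // leq_mul2l /= ltnS subset_leq_card // subD1set.
apply: leq_mul => //; apply: leq_trans F0; apply/subset_leq_card/subsetP => X.
by rewrite in_set => /andP[].
Qed.

Definition bilevel_at (t B : {set T}) H : bool :=
  `[< [/\ forall x y, (x, y) \in H -> (x \in t) != (y \in t),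
      forall x y, (x, y) \in H -> x \notin B -> y \notin B -> x \in t
    & {in V &, forall x y, (x \in t) = (y \in t) ->
        exists2 w, w \in nb H x :&: nb H y & w \notin B}] >].

Definition outer_neighbour H B b := [pick w in nb H b :\: B].

(* One orientation for each vertex of [B]; the other edges at that vertex
   follow by [four_cycle]. *)
Definition outer_signs H B :=
  [set b in B | if outer_neighbour H B b is Some w then w \in up H b else false].

(** Edges outside [B] leave [t]. At a vertex [x] of [B] the signs give the edge to one outer
    neighbour [q]. Any other neighbour [z] is on the side of [q], so [q] and [z] have a common
    neighbour [w] outside [B], and the 4-cycle [x], [q], [w], [z] decides [xz]. Edges inside [B]
    come last, as they need [wz] first. *)
Lemma bilevel_determined t B H1 H2 : B \subset V ->
  H1 \in cover_graphs V -> H2 \in cover_graphs V ->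
  bilevel_at t B H1 -> bilevel_at t B H2 ->
  H1 :|: rev H1 = H2 :|: rev H2 -> outer_signs H1 B = outer_signs H2 B -> H1 = H2.
Proof.
move=> sB G1 G2 /asboolP[b1 c1 d1] /asboolP[b2 c2 _] eG eS.
have cl1 := cover_graphs_cover G1; have cl2 := cover_graphs_cover G2.
have en x : nb H1 x = nb H2 x.
  apply/setP => y; rewrite !in_nb.
  by move/setP/(_ (x, y)): eG; rewrite !in_setU !in_rev.
pose agree x y := ((x, y) \in H1) = ((x, y) \in H2).
have agC x y : agree x y -> agree y x.
  rewrite /agree; case: (boolP (y \in nb H1 x)) => hn.
    have hn2 := hn; rewrite en in hn2.
    by rewrite (nb_up cl1 hn) (nb_up cl2 hn2) => ->.
  have hn2 := hn; rewrite en in hn2; move: hn hn2.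
  by rewrite !in_nb !negb_or => /andP[_ /negbTE ->] /andP[_ /negbTE ->].
have ag4 x q w z : q \in nb H1 x -> w \in nb H1 q -> z \in nb H1 w -> z \in nb H1 x ->
    agree x q -> agree q w -> agree w z -> agree x z.
  move=> h1 h2 h3 h4 a1 a2 a3; rewrite /agree (four_cycle cl1 h1 h2 h3 h4).
  by rewrite !en in h1 h2 h3 h4; rewrite (four_cycle cl2 h1 h2 h3 h4) a1 a2 a3.
have ag0 x y : x \notin B -> y \notin B -> agree x y.
  move=> xB yB; rewrite /agree; case: (boolP (y \in nb H1 x)) => hn; last first.
    have hn2 := hn; rewrite en in hn2; move: hn hn2.
    by rewrite !in_nb !negb_or => /andP[/negbTE -> _] /andP[/negbTE -> _].
  have hn2 := hn; rewrite en in hn2.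
  have or H : H \in cover_graphs V -> y \in nb H x ->
      (forall x y, (x, y) \in H -> (x \in t) != (y \in t)) ->
      (forall x y, (x, y) \in H -> x \notin B -> y \notin B -> x \in t) ->
      ((x, y) \in H) = (x \in t).
    move=> HG; rewrite in_nb => hxy hb hc; apply/idP/idP => [xy|xt]; first exact: hc xy xB yB.
    case/orP: hxy => // yx; have := hb _ _ yx; rewrite xt (hc _ _ yx) //.
  by rewrite (or H1) // (or H2).
have vV H x y : H \in cover_graphs V -> y \in nb H x -> x \in V /\ y \in V.
  move=> HG h; split; last exact: (subsetP (nb_subsetV x HG)).
  by rewrite nbC in h; apply: (subsetP (nb_subsetV y HG)).
have side H x y : H \in cover_graphs V -> (forall x y, (x, y) \in H -> (x \in t) != (y \in t)) ->
    y \in nb H x -> (y \in t) = ~~ (x \in t).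
  move=> HG hb; rewrite in_nb => /orP[] /hb; by case: (x \in t); case: (y \in t).
have agq x : x \in B -> exists q, [/\ q \in nb H1 x, q \notin B & agree x q].
  move=> xB; have xV := subsetP sB _ xB.
  have eO : outer_neighbour H2 B x = outer_neighbour H1 B x.
    by apply: eq_pick => w; rewrite !in_setD en.
  move/setP/(_ x): eS; rewrite !in_set xB eO /= /outer_neighbour.
  case: pickP => [q|no].
    by rewrite in_setD => /andP[qB qn] e; exists q; split=> //; rewrite /agree -!in_up.
  have [w] := d1 x x xV xV erefl; rewrite setIid => wn wB.
  by have := no w; rewrite in_setD wn wB.
have agB x z : x \in B -> z \notin B -> z \in nb H1 x -> agree x z.
  move=> xB zB zx; have [q [qx qB aq]] := agq x xB.
  have [xV zV] := vV _ _ _ G1 zx; have [_ qV] := vV _ _ _ G1 qx.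
  have [|w] := d1 q z qV zV; first by rewrite (side _ _ _ G1 b1 qx) (side _ _ _ G1 b1 zx).
  rewrite in_setI => /andP[wq wz] wB.
  by apply: (ag4 x q w z) => //; rewrite 1?nbC // ; apply: ag0.
apply/setP => -[x z]; rewrite -/(agree x z).
case: (boolP (z \in nb H1 x)) => zx; last first.
  have zx2 := zx; rewrite en in zx2; move: zx zx2; rewrite /agree.
  by rewrite !in_nb !negb_or => /andP[/negbTE -> _] /andP[/negbTE -> _].
case: (boolP (x \in B)) => xB; case: (boolP (z \in B)) => zB.
- have [q [qx qB aq]] := agq x xB.
  have [xV zV] := vV _ _ _ G1 zx; have [_ qV] := vV _ _ _ G1 qx.
  have [|w] := d1 q z qV zV; first by rewrite (side _ _ _ G1 b1 qx) (side _ _ _ G1 b1 zx).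
  rewrite in_setI => /andP[wq wz] wB.
  apply: (ag4 x q w z) => //; first by rewrite nbC.
    exact: ag0.
  by apply/agC/agB.
- exact: agB.
- by apply/agC/agB => //; rewrite nbC.
- exact: ag0.
Qed.

(** A graph is encoded by [t], the small set [B], the signs, which form a subset of [B], and the
    underlying bipartite graph, given by its pairs in [setX t (V :\: t)]. *)
Lemma bilevel_count (e s : R) : 0 <= s -> #|small_sets V (e * 12)|%:R <= s ->
  #|[set H in cover_graphs V | `[< nearly_bilevel V e H >]]|%:R <=
    (bipartite_bound #|V|)%:R * s ^+ 2.
Proof.
move=> s0 hs.
pose E t B b := [set H in cover_graphs V | bilevel_at t B H && (outer_signs H B == b)].
pose S := small_sets V (e * 12).
have hE (t B b : {set T}) : t \subset V -> B \subset V -> (#|E t B b| <= 2 ^ ((#|V| - #|t|) * #|t|))%N.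
  move=> st sB; pose f H := (H :|: rev H) :&: setX t (V :\: t).
  have inj : {in E t B b &, injective f}.
    move=> H1 H2; rewrite in_set => /andP[G1 /andP[h1 /eqP o1]].
    rewrite in_set => /andP[G2 /andP[h2 /eqP o2]] ef.
    apply: (bilevel_determined sB G1 G2 h1 h2); last by rewrite o1 o2.
    have /asboolP[c1 _ _] := h1; have /asboolP[c2 _ _] := h2.
    have key H H' : H \in cover_graphs V ->
        (forall x y, (x, y) \in H -> (x \in t) != (y \in t)) -> f H = f H' ->
        H :|: rev H \subset H' :|: rev H'.
      move=> HG c efH; apply/subsetP => -[x y] hxy.
      have /andP[xV yV] : (x \in V) && (y \in V).
        move: hxy; rewrite in_setU in_rev => /orP[] /(subsetP (cover_graphs_subset HG));
        by rewrite in_setX // andbC.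
      have txy : (y \in t) = ~~ (x \in t).
        by move: hxy; rewrite in_setU in_rev => /orP[] /c; case: (x \in t); case: (y \in t).
      case: (boolP (x \in t)) => xt.
        have : (x, y) \in f H by rewrite in_setI hxy in_setX xt in_setD yV txy xt.
        by rewrite efH in_setI => /andP[].
      have : (y, x) \in f H.
        rewrite in_setI in_setX in_setD xV txy xt /= andbT.
        by move: hxy; rewrite !in_setU !in_rev orbC.
      by rewrite efH in_setI => /andP[+ _]; rewrite !in_setU !in_rev orbC.
    by apply/eqP; rewrite eqEsubset !key.
  rewrite -(card_in_imset inj).
  apply: (@leq_trans #|powerset (setX t (V :\: t))|).
    by apply/subset_leq_card/subsetP => _ /imsetP[H _ ->]; rewrite powersetE subsetIr.
  by rewrite card_powerset cardsX card_setD_sub // mulnC.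
have sub : [set H in cover_graphs V | `[< nearly_bilevel V e H >]] \subset
    \bigcup_(t in powerset V) \bigcup_(p in setX S S) E t p.1 p.2.
  apply/subsetP => H; rewrite in_set => /andP[HG /asboolP[t [B [dB h1 h2 h3]]]].
  have sub12 x y : (x, y) \in H -> x \in V /\ y \in V.
    by move=> /(subsetP (cover_graphs_subset HG)); rewrite in_setX => /andP.
  have BV : B :&: V \in S.
    rewrite in_set subsetIr; apply: le_trans dB.
    by rewrite /dens ler_wpM2r ?invr_ge0 // ler_nat subset_leq_card // subsetIl.
  apply/bigcupP; exists (t :&: V); first by rewrite powersetE subsetIr.
  apply/bigcupP; exists (B :&: V, outer_signs H (B :&: V)).
    have so : outer_signs H (B :&: V) \subset B :&: V.
      by apply/subsetP => x; rewrite in_set => /andP[].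
    rewrite in_setX BV /=; move: BV; rewrite !in_set subsetIr /= => dBV.
    rewrite (subset_trans so (subsetIr _ _)); apply: le_trans dBV.
    by rewrite /dens ler_wpM2r ?invr_ge0 // ler_nat subset_leq_card.
  rewrite in_set HG eqxx andbT; apply/asboolP; split.
  - by move=> x y xy; have [xV yV] := sub12 _ _ xy; rewrite !in_setI xV yV !andbT h1.
  - move=> x y xy; have [xV yV] := sub12 _ _ xy; rewrite !in_setI xV yV !andbT.
    exact: h2.
  - move=> x y xV yV; rewrite !in_setI xV yV !andbT => exy.
    by have [w wn wB] := h3 x y xV yV exy; exists w; rewrite // in_setI (negbTE wB).
apply: (@le_trans _ _ (#|\bigcup_(t in powerset V) \bigcup_(p in setX S S) E t p.1 p.2|%:R)).
  by rewrite ler_nat subset_leq_card.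
apply: (@le_trans _ _ (\sum_(t in powerset V)
    #|\bigcup_(p in setX S S) E t p.1 p.2|%:R)).
  by rewrite -natr_sum ler_nat card_bigcup_sum.
rewrite /bipartite_bound -(sum_powerset V (fun b => 2 ^ ((#|V| - b) * b))%N).
rewrite natr_sum mulr_suml; apply: ler_sum => t; rewrite powersetE => st.
apply: (@le_trans _ _ (#|setX S S|%:R * (2 ^ ((#|V| - #|t|) * #|t|))%N%:R)).
  apply: card_bigcup_le => -[B b]; rewrite in_setX => /andP[BS _].
  by rewrite ler_nat hE //; move: BS; rewrite in_set => /andP[].
by rewrite mulrC ler_wpM2l // cardsX natrM expr2 ler_pM.
Qed.

End Graphs.
End Counting.

(** * Nonlayered graphs are rare, by induction on the number of vertices *)

Section Rare.
Variable R : realType.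

Definition nonlayered (T : finType) (V : {set T}) : {set {set T * T}} :=
  [set H in cover_graphs V | ~~ `[< layered V H >]].

Lemma typical_of_not_bad (T : finType) (V : {set T}) k (g e : R) H :
  H \in cover_graphs V -> (forall a, a \in V -> H \notin bad_at V k g e a) ->
  typical V k g e H.
Proof.
move=> HG nb a X Y aV hX hY hd hp; rewrite leNgt; apply/negP => hl.
by case/negP: (nb a aV); rewrite in_set HG; apply/asboolP; exists X, Y.
Qed.

Lemma small_sets_le (T : finType) (V : {set T}) (g g' : R) :
  g <= g' -> (#|small_sets V g| <= #|small_sets V g'|)%N.
Proof.
move=> h; apply/subset_leq_card/subsetP => S; rewrite !in_set => /andP[-> h'].
exact: le_trans h' h.
Qed.

(** A nonlayered graph is nearly bilevel or bad at some vertex. The former are fewer by almost a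
    factor [2 ^ (n / 2)]. A bad vertex is added in [2 ^ ((1/2 - 2 d) n)] ways up to a polynomial
    factor, while [layered_bound] grows by about [2 ^ (n / 2)] at least. *)
Lemma nonlayered_step : exists (d : R) (N0 : nat), 0 < d /\
  forall (T : finType) (V : {set T}) (C : R), (N0 <= #|V|)%N -> 0 <= C ->
    (forall a, a \in V -> #|cover_graphs (V :\ a)|%:R <= C * (layered_bound #|V|.-1)%:R) ->
    exp2 (- d * #|V|%:R) <= 2^-1 /\
    #|nonlayered V|%:R <= (1 + C) * (exp2 (- d * #|V|%:R) * (layered_bound #|V|)%:R).
Proof.
(* Constants are chosen from coarse to fine. For each [e], starting with 1/4, the entropy lemma
   gives a [g] whose small sets cost [e / 8] in the exponent, and the next [e] is a fixed fraction
   of that [g]. *)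
have [D [D0 D32 hD]] := @small_sets_entropy R 32^-1 ltac:(by rewrite invr_gt0 ltr0n).
pose e3 := D / 10; have e30 : 0 < e3 by rewrite divr_gt0.
have [g3 [g30 ge3 hg3]] := @small_sets_entropy R (e3 / 8) ltac:(by rewrite divr_gt0).
pose e2 := g3 / 20; have e20 : 0 < e2 by rewrite divr_gt0.
have [g2 [g20 ge2 hg2]] := @small_sets_entropy R (e2 / 8) ltac:(by rewrite divr_gt0).
pose e1 := g2 / 30; have e10 : 0 < e1 by rewrite divr_gt0.
have [g1 [g10 ge1 hg1]] := @small_sets_entropy R (e1 / 8) ltac:(by rewrite divr_gt0).
have E3 : e3 * 10 = D by rewrite /e3; lra.
have E2 : e2 * 20 = g3 by rewrite /e2; lra.
have E1 : e1 * 30 = g2 by rewrite /e1; lra.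
move: e3 e2 e1 e30 e20 e10 ge3 hg3 ge2 hg2 ge1 hg1 E3 E2 E1.
move=> e3 e2 e1 e30 e20 e10 ge3 hg3 ge2 hg2 ge1 hg1 E3 E2 E1.
have [le1 le2 le3 le4] : [/\ g1 <= e1, g2 <= e2, g3 <= e3 & D <= 4^-1] by split; lra.
have [le5 le6 le7] : [/\ e1 * 30 <= g2, e2 * 20 <= g3 & e3 * 10 <= D] by rewrite E1 E2 E3.
pose c := g1 * D / 8; have c0 : 0 < c by rewrite divr_gt0 // mulr_gt0.
have natbig (x : R) : exists n : nat, x < n%:R.
  exists (Num.bound `|x|); exact: le_lt_trans (ler_norm _) (archi_boundP (normr_ge0 _)).
have [m hm] := natbig c^-1.
have cm : 1 < c * m%:R by rewrite mulrC -ltr_pdivrMr // div1r.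
have [n1 hn1] := natbig ((m + 6)%:R / c).
(* Two small sets cost [e / 4] of the gain [e], leaving at least [e1 * 3 / 4 = 2 d]; one [d] pays
   for the polynomial factor of degree [j + 1]. *)
pose k := (m + 6)%N; pose j := (2 ^ k * 2)%N; pose d := e1 * 3 / 8.
have d0 : 0 < d by rewrite /d; lra.
have [n2 hn2] := @exp2_dominates R (8 * 4 ^+ j) d j.+1 d0.
have [n3 hn3] := @exp2_unbounded R 2 d d0.
exists d, (maxn 1 (maxn n1 (maxn n2 n3))); split=> // T V C.
rewrite !geq_max => /and4P[V0 hV1 hV2 hV3] C0 hC.
set n := #|V| in hV1 hV2 hV3 V0 hC *.
have {}hn1 : (m + 6)%:R / n%:R <= c.
  rewrite ler_pdivrMr ?ltr0n // mulrC -ler_pdivrMr //; apply: ltW.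
  by apply: lt_le_trans hn1 _; rewrite ler_nat.
have n0 : 0 < n%:R :> R by rewrite ltr0n.
set u := (layered_bound n)%:R; have u0 : 0 <= u :> R by rewrite ler0n.
pose x y := exp2 (y * n%:R : R).
have xD y z : x (y + z) = x y * x z by rewrite /x mulrDl exp2D.
have x0 y : 0 <= x y by apply: exp2_ge0.
have xle y z : y <= z -> x y <= x z by move=> h; rewrite exp2_le // ler_pM2r.
rewrite -/(x (- d)).
split.
  have : 2 <= x d by apply: hn3.
  have : x (- d) * x d = 1 by rewrite -xD addNr /x mul0r /exp2 mul0r expR0.
  by have := x0 (- d); nra.
pose P := (((4 * n.+1) ^ (2 ^ k)) ^ 2)%N%:R : R.
have P0 : 0 <= P by rewrite ler0n.
pose M := C * (layered_bound n.-1)%:R * P * x (2^-1 - d * 2).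
have M0 : 0 <= M by rewrite !mulr_ge0.
have bad g e s a : a \in V -> #|small_sets V g|%:R <= x s ->
    2^-1 - e + s * 2 <= 2^-1 - d * 2 -> #|bad_at V k g e a|%:R <= M.
  move=> aV hs hle; apply: le_trans (bad_count k e aV (x0 s) hs) _.
  have y0 : 0 <= x (2^-1 - e) * x s ^+ 2 by rewrite mulr_ge0 ?exprn_ge0.
  apply: (@le_trans _ _ (C * (layered_bound n.-1)%:R * P * (x (2^-1 - e) * x s ^+ 2))).
    by rewrite ler_wpM2r // ler_wpM2r // hC.
  rewrite /M ler_wpM2l ?mulr_ge0 //.
  by rewrite -/(x (2^-1 - e)) /x exp2X mulrAC -/(x (s * 2)) -/(x _) -xD xle.
pose Bad a := (bad_at V k g1 e1 a :|: bad_at V k g2 e2 a) :|: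
  (bad_at V k g3 e3 a :|: bad_at V k D 4^-1 a).
have hBad a : a \in V -> #|Bad a|%:R <= M * 4.
  move=> aV.
  have h1 := bad g1 e1 (e1 / 8) a aV (hg1 T V V0).
  have h2 := bad g2 e2 (e2 / 8) a aV (hg2 T V V0).
  have h3 := bad g3 e3 (e3 / 8) a aV (hg3 T V V0).
  have h4 := bad D 4^-1 32^-1 a aV (hD T V V0).
  have U (A B : {set {set T * T}}) : #|A :|: B|%:R <= #|A|%:R + #|B|%:R :> R.
    by rewrite -natrD ler_nat leq_card_setU.
  have u1 := U (bad_at V k g1 e1 a :|: bad_at V k g2 e2 a)
    (bad_at V k g3 e3 a :|: bad_at V k D 4^-1 a).
  have u2 := U (bad_at V k g1 e1 a) (bad_at V k g2 e2 a).
  have u3 := U (bad_at V k g3 e3 a) (bad_at V k D 4^-1 a).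
  have {}h1 : #|bad_at V k g1 e1 a|%:R <= M by apply: h1; rewrite /d; lra.
  have {}h2 : #|bad_at V k g2 e2 a|%:R <= M by apply: h2; rewrite /d; lra.
  have {}h3 : #|bad_at V k g3 e3 a|%:R <= M by apply: h3; rewrite /d; lra.
  have {}h4 : #|bad_at V k D 4^-1 a|%:R <= M by apply: h4; rewrite /d; lra.
  by rewrite /Bad; lra.
pose NB := [set H in cover_graphs V | `[< nearly_bilevel V e1 H >]].
have sub : nonlayered V \subset NB :|: \bigcup_(a in V) Bad a.
  apply/subsetP => H; rewrite in_set => /andP[HG /negP nl].
  rewrite in_setU; apply/orP.
  case: (boolP (H \in \bigcup_(a in V) Bad a)) => hB; [by right|left].
  have nB a : a \in V -> H \notin Bad a.
    by move=> aV; apply: contra hB => hB; apply/bigcupP; exists a.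
  rewrite in_set HG; apply/asboolP.
  have [ | | | |h|] // := typical_structure V0 HG g10 le1 le5 le2 le6 le3 le7 le4 (leqnn k) cm hn1;
    last by case: nl; apply/asboolP.
  - apply: typical_of_not_bad => // a /nB; rewrite !in_setU !negb_or.
    by case/andP=> /andP[].
  - apply: typical_of_not_bad => // a /nB; rewrite !in_setU !negb_or.
    by case/andP=> /andP[].
  - apply: typical_of_not_bad => // a /nB; rewrite !in_setU !negb_or.
    by case/andP=> _ /andP[].
  - apply: typical_of_not_bad => // a /nB; rewrite !in_setU !negb_or.
    by case/andP=> _ /andP[].
(* As [e1 * 12 <= g2], the exceptional sets are among the small sets counted for [g2]. *)
have hNB : #|NB|%:R <= (bipartite_bound n)%:R * x (e2 / 8) ^+ 2.
  apply: bilevel_count => //; apply: le_trans (hg2 T V V0); rewrite ler_nat.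
  by apply: small_sets_le; lra.
have hNB' : #|NB|%:R <= x (- d) * u.
  apply: le_trans hNB _.
  have h := bipartite_layered_bound R n.
  have e : exp2 (n%:R / 2 : R) = x 2^-1 by rewrite /x mulrC.
  rewrite e in h; apply: le_trans (ler_wpM2l (x0 (- d)) h).
  rewrite [leRHS]mulrA -xD [leRHS]mulrC ler_wpM2l // /x exp2X mulrAC exp2_le //.
  by rewrite ler_wpM2r // /d; lra.
have n1' : n.-1.+1 = n by rewrite prednK.
have hu : (layered_bound n.-1)%:R * x 2^-1 <= 2 * u.
  have := layered_bound_step R n.-1; rewrite n1' -/u => h.
  apply: le_trans (ler_wpM2l (ler0n _ 2) h); rewrite mulrA [leRHS]mulrC ler_wpM2l //.
  have -> : x 2^-1 = exp2 2^-1 * exp2 (n.-1%:R / 2 : R).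
    by rewrite -exp2D; congr exp2; rewrite -[in LHS]n1' -natr1; lra.
  rewrite ler_wpM2r ?exp2_ge0 //.
  apply: (@le_trans _ _ (exp2 1)); first by apply: exp2_le; lra.
  by rewrite -[1]/(1%:R) exp2_nat expn1.
have hP : 8 * n%:R * P <= x d.
  apply: le_trans (hn2 n hV2); rewrite /P -expnM -/j expnMn natrM !natrX -!mulrA ler_wpM2l //.
  rewrite mulrCA ler_wpM2l ?exprn_ge0 // exprS ler_wpM2r ?exprn_ge0 //.
  by rewrite ler_nat.
have hM : n%:R * (M * 4) <= C * (x (- d) * u).
  have -> : n%:R * (M * 4) = C * (x (- d * 2) * ((4 * n%:R * P) * ((layered_bound n.-1)%:R * x 2^-1))).
    by rewrite /M xD mulNr; ring.
  rewrite ler_wpM2l //.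
  have -> : x (- d) = x (- d * 2) * x d by rewrite -xD; congr x; lra.
  rewrite -[leRHS]mulrA ler_wpM2l //.
  have h4 : 0 <= 4 * n%:R * P by rewrite !mulr_ge0.
  apply: le_trans (ler_wpM2l h4 hu) _.
  have -> : 4 * n%:R * P * (2 * u) = 8 * n%:R * P * u by ring.
  by rewrite ler_wpM2r.
rewrite mulrDl mul1r.
apply: (@le_trans _ _ #|NB :|: \bigcup_(a in V) Bad a|%:R).
  by rewrite ler_nat subset_leq_card.
apply: (@le_trans _ _ (#|NB|%:R + #|\bigcup_(a in V) Bad a|%:R)).
  by rewrite -natrD ler_nat leq_card_setU.
apply: lerD => //; apply: le_trans hM; exact: card_bigcup_le.
Qed.

Lemma nonlayered_rare : exists (d K : R) (N0 : nat), [/\ 0 < d, 0 <= K &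
  forall (T : finType) (V : {set T}), (N0 <= #|V|)%N ->
    #|nonlayered V|%:R <= K * (exp2 (- d * #|V|%:R) * (layered_bound #|V|)%:R)].
Proof.
have [d [N0 [d0 step]]] := nonlayered_step.
(* [C >= 3] closes the induction, since [1 + (1 + C) / 2 <= C]; the other summand bounds the number
   of all graphs on fewer than [N0] vertices. *)
pose C := 3 + (2 ^ (N0 * N0))%N%:R : R.
have C3 : 3 <= C by rewrite lerDl.
have split_layered (T : finType) (V : {set T}) : #|cover_graphs V|%:R <=
    (layered_bound #|V|)%:R + #|nonlayered V|%:R :> R.
  rewrite -natrD ler_nat.
  apply: leq_trans (leq_add (layered_count V) (leqnn _)).
  rewrite -(cardsID [set H | `[< layered V H >]] (cover_graphs V)).
  by rewrite leq_add // subset_leq_card //; apply/subsetP => H; rewrite !in_set // andbC.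
have main n : forall (T : finType) (V : {set T}), #|V| = n ->
    #|cover_graphs V|%:R <= C * (layered_bound #|V|)%:R.
  elim: n => [|n IH] T V nV.
    apply: le_trans (_ : (2 ^ (#|V| * #|V|))%N%:R <= _); first by rewrite ler_nat card_cover_graphs.
    apply: (@le_trans _ _ C); first by rewrite nV; move: C3; lra.
    by rewrite ler_peMr ?ler1n ?layered_bound_gt0 //; move: C3; lra.
  have [small|big] := ltnP n.+1 N0.
    apply: le_trans (_ : (2 ^ (#|V| * #|V|))%N%:R <= _); first by rewrite ler_nat card_cover_graphs.
    apply: (@le_trans _ _ C); last by rewrite ler_peMr ?ler1n ?layered_bound_gt0 //; move: C3; lra.
    apply: (@le_trans _ _ (2 ^ (N0 * N0))%N%:R); last by rewrite /C lerDr.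
    by rewrite ler_nat leq_exp2l // nV leq_mul // ltnW.
  have [|||h1 h2] := step T V C _ _ _; first by rewrite nV.
  - by move: C3; lra.
  - move=> a aV; have e : #|V :\ a| = n.
      by move: nV; rewrite (cardsD1 a) aV => -[].
    by have := IH T (V :\ a) e; rewrite e nV.
  apply: le_trans (split_layered T V) _.
  set u := (layered_bound _)%:R in h2 *; have u0 : 0 <= u by rewrite ler0n.
  set y := exp2 _ in h1 h2.
  have : (1 + C) * (y * u) <= (1 + C) * (2^-1 * u).
    by rewrite ler_wpM2l ?ler_wpM2r //; move: C3; lra.
  have : 3 * u <= C * u by rewrite ler_wpM2r.
  by move: h2; lra.
exists d, (1 + C), (maxn N0 1); split=> //; first by move: C3; lra.
move=> T V; rewrite geq_max => /andP[hN V0].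
have [||//] := step T V C hN _ _; first by move: C3; lra.
move=> a aV; have e : #|V :\ a| = #|V|.-1 by rewrite (cardsD1 a V) aV.
by rewrite -e; apply: (main #|V :\ a|).
Qed.

End Rare.

(** * The Kleitman-Rothschild theorem *)

Section CoverGraph.
Variable N : nat.
Implicit Types (P Q : labelled_poset N) (x y z w : 'I_N).

Definition ple P x y : bool := val P (x, y).

Lemma ple_refl P x : ple P x x. Proof. exact: (@poset_of_le_refl N P x). Qed.

Lemma ple_trans P y x z : ple P x y -> ple P y z -> ple P x z.
Proof. exact: (@poset_of_le_trans _ P y x z). Qed.

Lemma ple_anti P x y : ple P x y -> ple P y x -> x = y.
Proof. by move=> xy yx; apply: (@poset_of_le_anti _ P); apply/andP. Qed.

Definition plt P x y := (x != y) && ple P x y.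

Definition cover_graph P : {set 'I_N * 'I_N} :=
  [set p | plt P p.1 p.2 && [forall z, ~~ (plt P p.1 z && plt P z p.2)]].

Lemma plt_trans P y x z : plt P x y -> plt P y z -> plt P x z.
Proof.
move=> /andP[xy xy'] /andP[yz yz']; rewrite /plt (ple_trans xy' yz') andbT.
by apply: contraNneq yz => e; apply/eqP/(ple_anti yz'); rewrite -e.
Qed.

Lemma plt_asym P x y : plt P x y -> ~~ plt P y x.
Proof.
move=> /andP[xy h]; apply/negP => /andP[_ h'].
by case/negP: xy; apply/eqP/(ple_anti h).
Qed.

Lemma cover_plt P x y : (x, y) \in cover_graph P -> plt P x y.
Proof. by rewrite inE => /andP[]. Qed.

Lemma cover_between P x y z : (x, y) \in cover_graph P -> plt P x z -> ~~ plt P z y.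
Proof. by rewrite inE => /andP[_ /forallP/(_ z)] /=; rewrite negb_and => /orP[/negbTE ->|]. Qed.

Lemma cover_graph_in P : cover_graph P \in cover_graphs [set: 'I_N].
Proof.
rewrite in_set; apply/andP; split; first by apply/subsetP => -[x y]; rewrite !inE.
apply/asboolP; split=> [x y xy|x y z xy yz|x y z w xy yz zw].
- by apply: contra (plt_asym (cover_plt xy)) => /cover_plt.
- rewrite in_nb negb_or; apply/andP; split; apply/negP => h.
    by have := cover_between h (cover_plt xy); rewrite (cover_plt yz).
  have := plt_trans (cover_plt xy) (cover_plt yz) => h'.
  by have := plt_asym h'; rewrite (cover_plt h).
- have yw := plt_trans (cover_plt yz) (cover_plt zw).
  rewrite in_nb negb_or; apply/andP; split; apply/negP => h.
    by have := cover_between h (cover_plt xy); rewrite yw.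
  have := plt_trans (cover_plt xy) yw => h'.
  by have := plt_asym h'; rewrite (cover_plt h).
Qed.

(** Induction on the number of elements strictly between [x] and [y]. *)
Lemma plt_ind P (r : 'I_N -> 'I_N -> Prop) :
  (forall x y z, r x y -> r y z -> r x z) ->
  (forall x y, (x, y) \in cover_graph P -> r x y) ->
  forall x y, plt P x y -> r x y.
Proof.
move=> rt rc x y; pose I x y := [set z | plt P x z && plt P z y].
have [n] := ubnP #|I x y|; elim: n x y => // n IH x y /[!ltnS] hn xy.
have [I0|[z]] := set_0Vmem (I x y).
  apply: rc; rewrite inE /= xy; apply/forallP => z; apply/negP => h.
  by move/setP/(_ z): I0; rewrite !inE h.
rewrite inE => /andP[xz zy]; apply: (rt _ z); apply: IH => //.
  apply: leq_trans hn; apply: proper_card; apply/properP; split.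
    by apply/subsetP => w; rewrite !inE => /andP[-> /plt_trans ->].
  by exists z; rewrite !inE ?xz ?zy //= /plt eqxx ?andbF.
apply: leq_trans hn; apply: proper_card; apply/properP; split.
  by apply/subsetP => w; rewrite !inE => /andP[h ->]; rewrite (plt_trans xz h).
by exists z; rewrite !inE ?xz ?zy //= /plt eqxx ?andbF.
Qed.

Lemma cover_graph_inj : injective cover_graph.
Proof.
have sub P Q : cover_graph P = cover_graph Q -> forall x y, plt P x y -> plt Q x y.
  move=> e; apply: plt_ind => [x y z|x y]; first exact: plt_trans.
  by rewrite e; apply: cover_plt.
move=> P Q e; apply/val_inj/ffunP => -[x y].
rewrite -/(ple P x y) -/(ple Q x y).
have [->|xy] := eqVneq x y; first by rewrite !ple_refl.
have pE O : ple O x y = plt O x y by rewrite /plt xy.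
by rewrite !pE; apply/idP/idP; apply: sub.
Qed.

Lemma card_posets_le (K : {set labelled_poset N}) (F : {set {set 'I_N * 'I_N}}) :
  (forall P, P \in K -> cover_graph P \in F) -> (#|K| <= #|F|)%N.
Proof.
move=> h; rewrite -(card_imset K cover_graph_inj); apply/subset_leq_card/subsetP.
by move=> _ /imsetP[P /h hP ->].
Qed.

End CoverGraph.

(** * Layered graphs with small layers or missing edges *)

Section Triples.
Variables (R : realType) (T : finType).
Implicit Types (A B C S : {set T}) (E : {set T * T}).
Notation V := [set: T].
Notation n := #|[set: T]|.

Definition third A B := V :\: B :\: A.
Definition triple_pairs A B := setX A B :|: setX B (third A B).

Definition dense_between t E A B : bool :=
  [forall S : {set T}, forall S' : {set T},
    [&& S \subset A, S' \subset B, #|S| == t & #|S'| == t] ==>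
    ~~ [disjoint E & setX S S']].

(** The last two clauses ensure that no middle vertex is minimal or maximal, so that the layers can
    be read off the order. *)
Definition good_triple (g : R) t A B E : bool :=
  [&& g < dens R V A, g < dens R V B, g < dens R V (third A B),
      dense_between t E A B, dense_between t E B (third A B),
      [forall b in B, ~~ [disjoint E & setX A [set b]]]
    & [forall b in B, ~~ [disjoint E & setX [set b] (third A B)]]].

(* Triples [(B, A, E)]: the middle layer [B] comes first because the bottom
   layer [A] ranges over the subsets of its complement. *)
Definition triples : {set {set T} * {set T} * {set T * T}} :=
  [set p | ((p.1.1 \in powerset V) && (p.1.2 \in powerset (V :\: p.1.1)))
           && (p.2 \in powerset (triple_pairs p.1.2 p.1.1))].

Definition good_triples (g : R) t :=
  [set p in triples | good_triple g t p.1.2 p.1.1 p.2].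

Lemma card_triple_pairs A B : A \subset V :\: B ->
  #|triple_pairs A B| = ((n - #|B|) * #|B|)%N.
Proof.
move=> sA; have sB := subsetT B.
have d0 : setX A B :&: setX B (third A B) = set0.
  apply/setP => -[x y]; rewrite in_setI !in_setX in_set0 /=.
  apply/negbTE/negP => /andP[/andP[xA _] /andP[xB _]].
  by move/subsetP/(_ x xA): sA; rewrite in_setD xB.
rewrite /triple_pairs cardsU d0 cards0 subn0 !cardsX [(#|B| * _)%N]mulnC -mulnDl.
by rewrite /third -(card_setD_sub sB) (card_setD_sub sA) subnKC // subset_leq_card.
Qed.

Lemma layered_bound_sum :
  layered_bound n = (\sum_(B in powerset V) \sum_(A in powerset (V :\: B))
    2 ^ #|triple_pairs A B|)%N.
Proof.
rewrite /layered_bound -(sum_powerset V (fun b => 2 ^ ((n - b) * b.+1))%N).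
apply: eq_bigr => B _; rewrite (eq_bigr (fun=> 2 ^ ((n - #|B|) * #|B|)))%N.
  by rewrite sum_nat_const card_powerset card_setD_sub ?subsetT // -expnD mulnS.
by move=> A; rewrite powersetE => /card_triple_pairs ->.
Qed.

Lemma card_triples : #|triples| = layered_bound n.
Proof.
rewrite layered_bound_sum -sum1_card pair_big_dep.
rewrite (eq_bigr (fun q => \sum_(E in powerset (triple_pairs q.2 q.1)) 1)%N); last first.
  by move=> q _; rewrite sum_nat_const muln1 card_powerset.
by rewrite pair_big_dep; apply: eq_bigl => p; rewrite in_set.
Qed.

Lemma avoid_count A B (F : {set T * T}) : F \subset triple_pairs A B ->
  #|[set E in powerset (triple_pairs A B) | [disjoint E & F]]|%:R =
  exp2 (- #|F|%:R : R) * (2 ^ #|triple_pairs A B|)%N%:R.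
Proof.
move=> sF; have -> : [set E in powerset (triple_pairs A B) | [disjoint E & F]] =
    powerset (triple_pairs A B :\: F).
  by apply/setP => E; rewrite in_set !powersetE subsetD.
rewrite card_powerset card_setD_sub // -!(exp2_nat R) -exp2D; congr exp2.
by rewrite natrB ?subset_leq_card // addrC.
Qed.

(** Union bound over at most [4 ^ n] pairs of [t]-sets, each of which excludes [t * t] possible
    edges. *)
Lemma sparse_count t A B X Y : setX X Y \subset triple_pairs A B ->
  #|[set E in powerset (triple_pairs A B) | ~~ dense_between t E X Y]|%:R <=
  exp2 (2 * n%:R - (t * t)%N%:R : R) * (2 ^ #|triple_pairs A B|)%N%:R.
Proof.
move=> sXY.
pose F (p : {set T} * {set T}) :=
  [set E in powerset (triple_pairs A B) | [disjoint E & setX p.1 p.2]].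
pose I := [set p : {set T} * {set T} | [&& p.1 \subset X, p.2 \subset Y, #|p.1| == t & #|p.2| == t]].
have sub : [set E in powerset (triple_pairs A B) | ~~ dense_between t E X Y] \subset
    \bigcup_(p in I) F p.
  apply/subsetP => E; rewrite in_set => /andP[hE /forallPn[S /forallPn[S']]].
  rewrite negb_imply negbK => /andP[h hd]; apply/bigcupP; exists (S, S'); rewrite in_set //.
  by rewrite hE.
apply: (@le_trans _ _ #|\bigcup_(p in I) F p|%:R); first by rewrite ler_nat subset_leq_card.
apply: (@le_trans _ _ (#|I|%:R * (exp2 (- (t * t)%N%:R : R) * (2 ^ #|triple_pairs A B|)%N%:R))).
  apply: card_bigcup_le => -[S S']; rewrite in_set => /and4P[/= sS sS' /eqP tS /eqP tS'].
  rewrite /F avoid_count /= ?cardsX ?tS ?tS' //.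
  by apply: subset_trans sXY; apply: setXS.
rewrite mulrA ler_wpM2r // exp2D ler_wpM2r ?exp2_ge0 //.
rewrite mulrC mulr_natr mulr2n exp2D exp2_nat -natrM ler_nat.
apply: leq_trans (max_card _) _.
by rewrite card_prod -[#|{set T}|]cardsT -powersetT card_powerset.
Qed.

Lemma isolated_count A B (X : {set T}) (F : T -> {set T * T}) (g : R) :
  (forall b, b \in X -> F b \subset triple_pairs A B) ->
  (forall b, b \in X -> g * n%:R <= #|F b|%:R) ->
  #|[set E in powerset (triple_pairs A B) | ~~ [forall b in X, ~~ [disjoint E & F b]]]|%:R <=
  n%:R * exp2 (- g * n%:R) * (2 ^ #|triple_pairs A B|)%N%:R.
Proof.
move=> sF hF.
pose G b := [set E in powerset (triple_pairs A B) | [disjoint E & F b]].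
have sub : [set E in powerset (triple_pairs A B) | ~~ [forall b in X, ~~ [disjoint E & F b]]]
    \subset \bigcup_(b in X) G b.
  apply/subsetP => E; rewrite in_set => /andP[hE /forallPn[b]].
  rewrite negb_imply negbK => /andP[bX hd]; apply/bigcupP; exists b; rewrite // in_set.
  by rewrite hE.
apply: (@le_trans _ _ #|\bigcup_(b in X) G b|%:R); first by rewrite ler_nat subset_leq_card.
apply: (@le_trans _ _ (#|X|%:R * (exp2 (- g * n%:R) * (2 ^ #|triple_pairs A B|)%N%:R))).
  apply: card_bigcup_le => b bX; rewrite avoid_count ?sF // ler_wpM2r //.
  by apply: exp2_le; rewrite mulNr lerN2 hF.
by rewrite mulrA ler_wpM2r // ler_wpM2r ?exp2_ge0 // ler_nat subset_leq_card ?subsetT.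
Qed.

Lemma bad_triple_count g t A B : A \subset V :\: B -> (0 < n)%N ->
  g < dens R V A -> g < dens R V B -> g < dens R V (third A B) ->
  #|[set E in powerset (triple_pairs A B) | ~~ good_triple g t A B E]|%:R <=
  (2 * exp2 (2 * n%:R - (t * t)%N%:R) + 2 * (n%:R * exp2 (- g * n%:R)))
    * (2 ^ #|triple_pairs A B|)%N%:R.
Proof.
move=> sA n0 gA gB gC; set P := triple_pairs A B; set C := third A B in gC *.
have nR : 0 < n%:R :> R by rewrite ltr0n.
have dg X : g < dens R V X -> g * n%:R <= #|X|%:R.
  by rewrite /dens ltr_pdivlMr // => /ltW.
pose E1 := [set E in powerset P | ~~ dense_between t E A B].
pose E2 := [set E in powerset P | ~~ dense_between t E B C].
pose E3 := [set E in powerset P | ~~ [forall b in B, ~~ [disjoint E & setX A [set b]]]].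
pose E4 := [set E in powerset P | ~~ [forall b in B, ~~ [disjoint E & setX [set b] C]]].
have sub : [set E in powerset P | ~~ good_triple g t A B E] \subset (E1 :|: E2) :|: (E3 :|: E4).
  apply/subsetP => E; rewrite in_set => /andP[hE]; rewrite /good_triple gA gB gC /=.
  rewrite !negb_and => /or4P[] h; apply/setUP.
  - by left; apply/setUP; left; rewrite in_set hE h.
  - by left; apply/setUP; right; rewrite in_set hE h.
  - by right; apply/setUP; left; rewrite in_set hE h.
  - by right; apply/setUP; right; rewrite in_set hE h.
have h1 : #|E1|%:R <= _ := @sparse_count t A B A B (subsetUl _ _).
have h2 : #|E2|%:R <= _ := @sparse_count t A B B C (subsetUr _ _).
have h3 : #|E3|%:R <= n%:R * exp2 (- g * n%:R) * (2 ^ #|P|)%N%:R.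
  apply: isolated_count => b bB.
    by apply: subset_trans (subsetUl _ _); rewrite setXS // sub1set.
  by rewrite cardsX cards1 muln1 dg.
have h4 : #|E4|%:R <= n%:R * exp2 (- g * n%:R) * (2 ^ #|P|)%N%:R.
  apply: isolated_count => b bB.
    by apply: subset_trans (subsetUr _ _); rewrite setXS // sub1set.
  by rewrite cardsX cards1 mul1n dg.
have U (X Y : {set {set T * T}}) : #|X :|: Y|%:R <= #|X|%:R + #|Y|%:R :> R.
  by rewrite -natrD ler_nat leq_card_setU.
have u1 := U (E1 :|: E2) (E3 :|: E4); have u2 := U E1 E2; have u3 := U E3 E4.
have u4 : #|[set E in powerset P | ~~ good_triple g t A B E]|%:R <= #|(E1 :|: E2) :|: (E3 :|: E4)|%:R :> R.
  by rewrite ler_nat subset_leq_card.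
rewrite -/P in h1 h2.
by move: h1 h2 h3 h4 u1 u2 u3 u4; set w := (2 ^ _)%N%:R; set y := exp2 (_ - _); set z := n%:R * _; lra.
Qed.

Definition bad_triples g t := triples :\: good_triples g t.

(** The summands in order: all layers are large but [E] is defective; the bottom or the top is
    small, with [s] choices instead of [2 ^ (n - b)]; the middle is small and few edges are
    possible. *)
Lemma bad_triples_le g t (s : R) : (0 < n)%N -> #|small_sets V g|%:R <= s ->
  #|bad_triples g t|%:R <=
  (2 * exp2 (2 * n%:R - (t * t)%N%:R) + 2 * (n%:R * exp2 (- g * n%:R)))
    * (layered_bound n)%:R
  + 2 * s * (bipartite_bound n)%:R + s * exp2 (n%:R + g * n%:R * n%:R).
Proof.
move=> n0 hs.
pose beta := 2 * exp2 (2 * n%:R - (t * t)%N%:R) + 2 * (n%:R * exp2 (- g * n%:R)) : R.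
rewrite -/beta.
have nR : 0 < n%:R :> R by rewrite ltr0n.
have s0 : 0 <= s by apply: le_trans hs.
have beta0 : 0 <= beta.
  by rewrite addr_ge0 ?mulr_ge0 ?exp2_ge0 //.
pose w B := ((2 ^ ((n - #|B|) * #|B|))%N%:R : R).
pose S := small_sets V g.
have inS X : (X \in S) = ~~ (g < dens R V X) by rewrite in_set subsetT -leNgt.
pose E A B := [set (B, A, E) | E in [set E in powerset (triple_pairs A B) | ~~ good_triple g t A B E]].
have sub : bad_triples g t \subset
    \bigcup_(B in powerset V) \bigcup_(A in powerset (V :\: B)) E A B.
  apply/subsetP => -[[B A] e]; rewrite in_setD in_set => /andP[+ h]; rewrite h /= => ng.
  move: h; rewrite in_set /= => /andP[/andP[hB hA] he].
  apply/bigcupP; exists B => //; apply/bigcupP; exists A => //.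
  by apply/imsetP; exists e; rewrite // in_set he ng.
have hE A B : A \subset V :\: B ->
    #|E A B|%:R <= (beta + (A \in S)%:R + (third A B \in S)%:R + (B \in S)%:R) * w B.
  move=> sA; have wE : (2 ^ #|triple_pairs A B|)%N%:R = w B by rewrite card_triple_pairs.
  have w0 : 0 <= w B by rewrite ler0n.
  case: (boolP [|| A \in S, third A B \in S | B \in S]) => [h|].
    apply: (@le_trans _ _ (w B)).
      rewrite -wE -card_powerset ler_nat; apply: leq_trans (leq_imset_card _ _) _.
      by rewrite subset_leq_card //; apply/subsetP => e; rewrite in_set => /andP[].
    rewrite ler_peMl //; move: beta0 h.
    by case: (A \in S); case: (third A B \in S); case: (B \in S) => //= *; lra.
  rewrite !negb_or => /and3P[hA hC hB]; rewrite (negbTE hA) (negbTE hC) (negbTE hB) !addr0.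
  rewrite !inS !negbK in hA hC hB.
  rewrite -wE; apply: le_trans (bad_triple_count t sA n0 hA hB hC).
  by rewrite ler_nat leq_imset_card.
apply: (@le_trans _ _ (\sum_(B in powerset V) \sum_(A in powerset (V :\: B)) #|E A B|%:R)).
  under eq_bigr do rewrite -natr_sum; rewrite -natr_sum ler_nat.
  apply: leq_trans (subset_leq_card sub) _; apply: leq_trans (card_bigcup_sum _ _) _.
  by apply: leq_sum => B _; apply: card_bigcup_sum.
apply: (@le_trans _ _ (\sum_(B in powerset V)
   (beta * (2 ^ #|V :\: B|)%N%:R * w B + (2 * s) * w B + (B \in S)%:R * (2 ^ #|V :\: B|)%N%:R * w B))).
  apply: ler_sum => B _.
  apply: (@le_trans _ _ (\sum_(A in powerset (V :\: B))
      (beta + (A \in S)%:R + (third A B \in S)%:R + (B \in S)%:R) * w B)).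
    by apply: ler_sum => A; rewrite powersetE; apply: hE.
  clear hE; clearbody beta.
  rewrite -mulr_suml -!mulrDl ler_wpM2r ?ler0n // !big_split /= !sumr_const card_powerset.
  have sm (f : {set T} -> {set T}) : {in powerset (V :\: B) &, injective f} ->
      \sum_(A in powerset (V :\: B)) (f A \in S)%:R <= s :> R.
    move=> inj; apply: le_trans hs; rewrite -natr_sum ler_nat.
    rewrite -(big_imset (fun X => (X \in S : nat)) inj) /= -sum1_card.
    rewrite big_mkcond [leqRHS]big_mkcond; apply: leq_sum => X _.
    by case: ifP => //; case: (X \in S).
  have h1 := sm id (fun _ _ _ _ => id).
  have h2 : \sum_(A in powerset (V :\: B)) (third A B \in S)%:R <= s.
    apply: (sm (fun A => third A B)) => A A'; rewrite !powersetE => sA sA' e.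
    have K (W X : {set T}) : X \subset W -> W :\: (W :\: X) = X.
      by move=> sX; rewrite setDDr setDv set0U (setIidPr sX).
    by rewrite -(K _ _ sA) -(K _ _ sA') -/(third A B) e.
  by rewrite -[beta *+ _]mulr_natr -[(_ \in S)%:R *+ _]mulr_natr; lra.
rewrite !big_split /=; apply: lerD; first apply: lerD.
- rewrite /layered_bound -(sum_powerset V (fun b => 2 ^ ((n - b) * b.+1))%N).
  rewrite natr_sum mulr_sumr; apply: ler_sum => B _.
  by rewrite -mulrA -natrM -expnD card_setD_sub ?subsetT // mulnS.
- rewrite -mulr_sumr ler_wpM2l ?mulr_ge0 // /bipartite_bound.
  by rewrite -(sum_powerset V (fun b => 2 ^ ((n - b) * b))%N) natr_sum.
apply: (@le_trans _ _ (\sum_(B in powerset V) (B \in S)%:R * exp2 (n%:R + g * n%:R * n%:R))).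
  apply: ler_sum => B _; rewrite -mulrA; case: (boolP (B \in S)) => hB; last by rewrite !mul0r.
  rewrite !mul1r -natrM -expnD -exp2_nat exp2_le // natrD lerD //.
    by rewrite ler_nat subset_leq_card // subsetT.
  rewrite natrM mulrC; apply: ler_pM => //; last by rewrite ler_nat leq_subr.
  by move: hB; rewrite in_set /dens ler_pdivrMr // => /andP[].
rewrite -mulr_suml ler_wpM2r ?exp2_ge0 //; apply: le_trans hs.
rewrite -natr_sum ler_nat -sum1_card big_mkcond [leqRHS]big_mkcond; apply: leq_sum => X _.
by case: ifP => //; case: (X \in S).
Qed.

End Triples.

(** * Almost all triples are good *)

Section Asymptotics.
Variable R : realType.

(** Keep only the term where [b] is [n / 2] rounded down. *)
Lemma layered_bound_ge n : exp2 ((n%:R ^+ 2 - 1) / 4 : R) <= (layered_bound n)%:R.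
Proof.
pose b := n./2; have bn : (b <= n)%N by rewrite /b -{2}(odd_double_half n) -addnn addnA leq_addl.
apply: (@le_trans _ _ (2 ^ ((n - b) * b))%N%:R).
  rewrite -exp2_nat exp2_le //.
  have -> : n%:R = (odd n)%:R + b%:R * 2 :> R.
    by rewrite -{1}(odd_double_half n) natrD -muln2 natrM.
  rewrite natrM natrB //.
  have -> : n%:R = (odd n)%:R + b%:R * 2 :> R.
    by rewrite -{1}(odd_double_half n) natrD -muln2 natrM.
  by case: (odd n) => /=; rewrite expr2; lra.
rewrite ler_nat /layered_bound.
have bo : (b < n.+1)%N by rewrite ltnS.
rewrite (bigD1 (Ordinal bo)) //= (leq_trans _ (leq_addr _ _)) //.
rewrite -[leqLHS]mul1n leq_mul ?bin_gt0 // leq_exp2l // leq_mul2l leqnSn orbT //.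
Qed.

Lemma exp2_small (eta e : R) : 0 < eta -> 0 < e ->
  exists N, forall n, (N <= n)%N -> n.+1%:R * exp2 (- eta * n%:R) <= e.
Proof.
move=> eta0 e0; have [N hN] := @exp2_dominates R e^-1 eta 1 eta0.
exists N => n /hN; rewrite expr1 mulrC ler_pdivrMr // => h.
rewrite mulNr /exp2 mulNr expRN -/(exp2 _) ler_pdivrMr ?exp2_gt0 // mulrC.
by rewrite mulrC [leRHS]mulrC.
Qed.

(** Every summand of [bad_triples_le] is exponentially smaller: [t * t >= 5 n] beats the [4 ^ n]
    pairs, [bipartite_bound] is short of a factor [2 ^ (n / 2)], and [g <= 1/8] keeps [g n^2] well
    below the exponent [n^2 / 4] of [layered_bound_ge]. *)
Lemma bad_triples_rare (g e : R) : 0 < g -> g <= 8^-1 ->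
  (forall (T : finType) (V : {set T}), (0 < #|V|)%N ->
     #|small_sets V g|%:R <= exp2 (8^-1 * #|V|%:R : R)) -> 0 < e ->
  exists N, forall (T : finType) t, (N <= #|[set: T]|)%N ->
    (5 * #|[set: T]| <= t * t)%N ->
    #|bad_triples T g t|%:R <=
      e * (layered_bound #|[set: T]|)%:R.
Proof.
move=> g0 g8 hg e0.
have [||N1 h1] := @exp2_small 8^-1 (e / 8); rewrite ?invr_gt0 ?ltr0n ?divr_gt0 //.
have [||N2 h2] := @exp2_small g (e / 8); rewrite ?divr_gt0 //.
exists (maxn 30 (maxn N1 N2)) => T t; set n := #|_|; rewrite !geq_max => /and3P[n30 n1 n2] ht.
have n0 : (0 < n)%N by apply: leq_trans n30.
apply: le_trans (bad_triples_le t n0 (hg T [set: T] n0)) _; rewrite -/n.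
have hu := layered_bound_ge n; have hb := bipartite_layered_bound R n.
set u := (layered_bound n)%:R in hu hb *.
set b := (bipartite_bound n)%:R in hb *.
have u0 : 0 <= u by rewrite ler0n.
have {h1} := h1 n n1; have {h2} := h2 n n2; set N := n%:R in hu hb *.
have N30 : 30 <= N by rewrite ler_nat.
set y := exp2 (- 8^-1 * N); set z := exp2 (- g * N) => h2 h1.
have y0 : 0 <= y by apply: exp2_ge0.
have z0 : 0 <= z by apply: exp2_ge0.
have {}h1 : y <= e / 8.
  apply: le_trans h1; rewrite ler_peMl // ler1n //.
have {}h2 : N * z <= e / 8 by apply: le_trans h2; rewrite ler_wpM2r // ler_nat.
have t1 : exp2 (2 * N - (t * t)%N%:R) <= y.
  apply: exp2_le; have : 5 * N <= (t * t)%N%:R by rewrite -natrM ler_nat.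
  by move: N30; lra.
have t2 : exp2 (8^-1 * N) * b <= y * u.
  apply: le_trans (ler_wpM2l y0 hb); rewrite mulrA ler_wpM2r ?ler0n // -exp2D.
  by apply: exp2_le; move: N30; lra.
have t3 : exp2 (8^-1 * N) * exp2 (N + g * N * N) <= y * u.
  apply: le_trans (ler_wpM2l y0 hu); rewrite -!exp2D; apply: exp2_le.
  have : g * (N * N) <= 8^-1 * (N * N) by rewrite ler_wpM2r // mulr_ge0 // ler0n.
  have : 30 * N <= N * N by rewrite ler_wpM2r // ler0n.
  by rewrite expr2; move: N30; lra.
have t1u : exp2 (2 * N - (t * t)%N%:R) * u <= (e / 8) * u by rewrite ler_wpM2r // (le_trans t1).
have t2u : N * z * u <= (e / 8) * u by rewrite ler_wpM2r.
have yu : y * u <= (e / 8) * u by rewrite ler_wpM2r.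
set p := exp2 (2 * N - _) in t1u *; set q := exp2 (8^-1 * N) in t2 t3 *.
have eu : 0 <= e * u by rewrite mulr_ge0 // ltW.
by move: t1u t2u yu t2 t3; lra.
Qed.

End Asymptotics.

(** * From good triples to posets and back *)

Section TriplePosets.
Variables (R : realType) (N : nat).
Notation T := 'I_N.
Implicit Types (A B : {set T}) (E : {set T * T}).

(* The bottom layer is put entirely below the top layer, so that a good triple
   can be recovered from its minimal and maximal elements. *)
Definition triple_order (p : {set T} * {set T} * {set T * T}) : {ffun T * T -> bool} :=
  [ffun q => [|| q.1 == q.2, q \in p.2
               | (q.1 \in p.1.2) && (q.2 \in third p.1.2 p.1.1)]].

Definition layer A B x : nat := if x \in A then 0 else if x \in B then 1 else 2.

Lemma layer_edge A B E x y : A \subset [set: T] :\: B -> E \subset triple_pairs A B ->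
  (x, y) \in E -> (layer A B x < layer A B y)%N.
Proof.
move=> /subsetP sA /subsetP sE /sE; rewrite in_setU !in_setX /layer.
have nAB z : z \in A -> z \notin B by move=> /sA; rewrite in_setD => /andP[].
case/orP=> /andP[hx hy].
  by rewrite hx hy; case: ifP => // /nAB; rewrite hy.
case: ifP => [/nAB|_]; first by rewrite hx.
by rewrite hx; move: hy; rewrite !in_setD => /and3P[/negbTE -> /negbTE -> _].
Qed.

Lemma layer_third A B x : (x \in third A B) = (layer A B x == 2).
Proof. by rewrite /third !in_setD /layer in_setT; case: (x \in A); case: (x \in B). Qed.

Section OneTriple.
Variables (A B : {set T}) (E : {set T * T}).
Hypotheses (sA : A \subset [set: T] :\: B) (sE : E \subset triple_pairs A B).
Let r := triple_order (B, A, E).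

Lemma triple_orderE x y : r (x, y) =
  [|| x == y, (x, y) \in E | (x \in A) && (y \in third A B)].
Proof. by rewrite /r ffunE. Qed.

Lemma triple_order_layer x y : r (x, y) -> x != y -> (layer A B x < layer A B y)%N.
Proof.
rewrite triple_orderE => /or3P[/eqP -> /eqP //|xy _|/andP[xA yC] _].
  exact: layer_edge xy.
by move: yC; rewrite layer_third => /eqP ->; rewrite /layer xA.
Qed.

(** Two strict steps raise the layer twice, so they lead from the bottom to the top, where all pairs
    are related. *)
Lemma triple_order_po : is_partial_order r.
Proof.
split=> [x|x y|y x z].
- by rewrite triple_orderE eqxx.
- case/andP=> xy yx; apply/eqP; apply: contraT => ne.
  have h := triple_order_layer xy ne; rewrite eq_sym in ne.
  by have := ltn_trans h (triple_order_layer yx ne); rewrite ltnn.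
- have [->//|xy] := eqVneq x y; have [->//|yz] := eqVneq y z.
  move=> /triple_order_layer/(_ xy) h1 /triple_order_layer/(_ yz) h2.
  rewrite triple_orderE layer_third; apply/or3P/Or33.
  have l2 u : (layer A B u <= 2)%N by rewrite /layer; case: ifP => // _; case: ifP.
  have z2 : layer A B z == 2.
    by rewrite eqn_leq l2; apply: leq_ltn_trans h2; apply: leq_ltn_trans h1.
  have : (layer A B x < 1)%N.
    by apply: leq_trans h1 _; rewrite -ltnS; apply: leq_trans h2 (l2 z).
  by rewrite z2 andbT /layer; case: ifP => // _; case: ifP.
Qed.

(** A middle vertex has an edge from [A], and a top vertex is above all of [A], which is nonempty
    because its density exceeds [g]. *)
Lemma good_minimal (g : R) t x : 0 <= g -> good_triple g t A B E ->
  (x \in A) = [forall y, r (y, x) ==> (y == x)].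
Proof.
move=> g0 /and4P[gA gB gC /and4P[_ _ /forallP iA _]].
have [a aA] : exists a, a \in A.
  by apply/set0Pn; apply: contraTneq gA => ->; rewrite dens0 -leNgt.
apply/idP/forallP => [xA y|mx].
  apply/implyP => yx; apply: contraT => ne; have := triple_order_layer yx ne.
  by rewrite [layer A B x]/layer xA.
have no y : (y, x) \in E -> y = x.
  by move=> yx; apply/eqP; apply: (implyP (mx y)); rewrite triple_orderE yx orbT.
case: (boolP (x \in A)) => // xA; case: (boolP (x \in B)) => xB.
  have /implyP/(_ xB)/pred0Pn[[u v]] := iA x.
  rewrite /= in_setX in_set1 => /andP[uv /andP[uA /eqP ev]].
  by move: (no u); rewrite -ev uv => /(_ isT) e; rewrite -ev -e uA in xA.
have xC : x \in third A B by rewrite !in_setD xA xB in_setT.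
have /implyP/(_ _)/eqP e := mx a; rewrite -e ?aA // in xA.
by rewrite triple_orderE aA xC !orbT.
Qed.

Lemma good_maximal (g : R) t x : 0 <= g -> good_triple g t A B E ->
  (x \in third A B) = [forall y, r (x, y) ==> (y == x)].
Proof.
move=> g0 /and4P[gA gB gC /and4P[_ _ _ /forallP iC]].
have [c cC] : exists c, c \in third A B.
  by apply/set0Pn; apply: contraTneq gC => ->; rewrite dens0 -leNgt.
apply/idP/forallP => [xC y|mx].
  apply/implyP => xy; apply: contraT => ne.
  rewrite eq_sym in ne; have := triple_order_layer xy ne.
  move: xC; rewrite layer_third => /eqP ->.
  by rewrite /layer; case: ifP => // _; case: ifP.
have no y : (x, y) \in E -> y = x.
  by move=> xy; apply/eqP; apply: (implyP (mx y)); rewrite triple_orderE xy orbT.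
case: (boolP (x \in B)) => xB.
  have /implyP/(_ xB)/pred0Pn[[u v]] := iC x.
  rewrite /= in_setX in_set1 => /andP[uv /andP[/eqP eu vC]].
  by move: (no v); rewrite -eu uv => /(_ isT) <-.
case: (boolP (x \in A)) => xA; last by rewrite !in_setD xA xB in_setT.
have /implyP/(_ _)/eqP e := mx c; rewrite -e ?cC //.
by rewrite triple_orderE xA cC !orbT.
Qed.

Lemma triple_edges x y :
  ((x, y) \in E) = [&& r (x, y), x != y & ~~ ((x \in A) && (y \in third A B))].
Proof.
rewrite triple_orderE; apply/idP/idP => [xy|]; last first.
  by case/and3P=> /or3P[->|//|->] //.
have h := layer_edge sA sE xy; rewrite xy orbT /=.
apply/andP; split; first by apply: contraTneq h => ->; rewrite ltnn.
apply/negP => /andP[xA]; move/subsetP/(_ _ xy): sE; rewrite in_setU !in_setX /=.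
move/subsetP/(_ _ xA): sA; rewrite !in_setD => /andP[/negbTE -> _].
by case/orP=> [/andP[_ ->]|]; rewrite ?andbF.
Qed.

End OneTriple.

(** [triple_order] is injective on good triples: the outer layers are the minimal and the maximal
    elements, and the edges are the strict relations not going from bottom to top. *)
Lemma good_triples_le (g : R) t : 0 <= g ->
  (#|good_triples T g t| <= #|{: labelled_poset N}|)%N.
Proof.
move=> g0.
have inj : {in good_triples T g t &, injective triple_order}.
  move=> [[B A] E] [[B' A'] E']; rewrite in_set => /andP[h gd].
  rewrite in_set => /andP[h' gd'] er.
  move: h; rewrite in_set /= !powersetE => /andP[/andP[_ sA] sE].
  move: h'; rewrite in_set /= !powersetE => /andP[/andP[_ sA'] sE'].
  have eA : A = A'.
    by apply/setP => x; rewrite (good_minimal sA sE _ g0 gd) (good_minimal sA' sE' _ g0 gd') er.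
  have eC : third A B = third A' B'.
    by apply/setP => x; rewrite (good_maximal sA sE _ g0 gd) (good_maximal sA' sE' _ g0 gd') er.
  have bE (X Y : {set T}) : X \subset [set: T] :\: Y -> Y = [set: T] :\: (X :|: third X Y).
    move=> /subsetP sX; apply/setP => x; rewrite /third !(in_setD, in_setU) in_setT andbT.
    case: (boolP (x \in X)) => [/sX|_ /=]; last by rewrite andbT negbK.
    by rewrite in_setD => /andP[/negbTE ->].
  have eB : B = B' by rewrite (bE _ _ sA) (bE _ _ sA') eC eA.
  have eE : E = E'.
    apply/setP => -[x y]; rewrite (triple_edges sA sE) (triple_edges sA' sE') er.
    by rewrite eC eA.
  by rewrite eA eB eE.
rewrite -(card_in_imset inj).
rewrite -[leqRHS]cardsT -(card_imset [set: labelled_poset N] val_inj).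
apply/subset_leq_card/subsetP => _ /imsetP[[[B A] E] hp ->].
move: hp; rewrite in_set => /andP[h _].
move: h; rewrite in_set /= !powersetE => /andP[/andP[_ sA] sE].
have po := triple_order_po sA sE.
pose P : labelled_poset N := exist _ (triple_order (B, A, E)) (asboolT po).
by apply/imsetP; exists P; rewrite ?in_setT.
Qed.

Definition three_layered (g : R) t (P : labelled_poset N) : Prop := exists A B,
  [/\ A \subset [set: T] :\: B, cover_graph P \subset triple_pairs A B
    & good_triple g t A B (cover_graph P)].

Lemma not_three_layered (g : R) t :
  (#|[set P : labelled_poset N | ~~ `[< three_layered g t P >]]| <=
   #|nonlayered [set: T]| + #|bad_triples T g t|)%N.
Proof.
apply: (@leq_trans #|nonlayered [set: T] :|: [set p.2 | p in bad_triples T g t]|); last first.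
  by apply: leq_trans (leq_card_setU _ _) _; rewrite leq_add2l leq_imset_card.
apply: card_posets_le => P; rewrite in_set => nP.
rewrite in_setU; case: (boolP (cover_graph P \in nonlayered _)) => //=.
rewrite in_set cover_graph_in /= negbK => /asboolP[A [B [sB sA sE]]].
apply/imsetP; exists (B, A, cover_graph P) => //.
have hT : (B, A, cover_graph P) \in triples T by rewrite in_set /= !powersetE sB sA.
rewrite in_setD hT andbT in_set hT /=; apply: contra nP => gd.
by apply/asboolP; exists A, B.
Qed.

End TriplePosets.

(** With [u] for [layered_bound N], good triples give at least [(1 - e / 4) u] posets. A poset that
    is not three-layered yields a nonlayered graph or a bad triple, and these number at most
    [e / 2 * u]. *)
Lemma kleitman_rothschild (R : realType) : exists g : R, 0 < g /\
  forall e : R, 0 < e -> exists N0, forall N t, (N0 <= N)%N -> (5 * N <= t * t)%N ->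
    #|[set P : labelled_poset N | ~~ `[< three_layered g t P >]]|%:R <=
    e * #|{: labelled_poset N}|%:R.
Proof.
have [g [g0 g8 hg]] := @small_sets_entropy R 8^-1 ltac:(by rewrite invr_gt0 ltr0n).
(* Truncation at 1 keeps [1 - e / 4] above 1/2. *)
exists g; split=> // e0 e0_gt0; pose e := Num.min e0 1.
have e_gt0 : 0 < e by rewrite lt_min e0_gt0 ltr01.
have e1 : e <= 1 by rewrite ge_min lexx orbT.
have [d [K [N1 [d0 K0 h1]]]] := nonlayered_rare R.
have e4 : 0 < e / 4 by rewrite divr_gt0.
have [N2 h2] := bad_triples_rare g0 g8 hg e4.
have [|N3 h3] := @exp2_small R d (e / 4 / (K + 1)) d0; first by rewrite divr_gt0 // ltr_wpDl.
exists (maxn N1 (maxn N2 N3)) => N t; rewrite !geq_max => /and3P[n1 n2 n3] ht.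
have cN : #|[set: 'I_N]| = N by rewrite cardsT card_ord.
have := h1 _ [set: 'I_N]; rewrite cN => /(_ n1) {}h1.
have := h2 'I_N t; rewrite cN => /(_ n2 ht) {}h2.
have {}h3 := h3 N n3.
have hno := @not_three_layered R N g t.
have hgood : (#|good_triples 'I_N g t| <= #|{: labelled_poset N}|)%N.
  by apply: good_triples_le; apply: ltW.
have := card_triples 'I_N; rewrite cN => hu.
have : (#|triples 'I_N| <= #|good_triples 'I_N g t| + #|bad_triples 'I_N g t|)%N.
  rewrite -(cardsID (good_triples 'I_N g t) (triples 'I_N)) leq_add2r.
  by rewrite subset_leq_card // subsetIr.
rewrite hu; set u := layered_bound N in h1 h2 *; set b := #|bad_triples _ _ _| in h2 hno *.
set gd := #|good_triples _ _ _| in hgood *; set L := #|nonlayered _| in h1 hno *.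
set Q := #|{: labelled_poset N}| in hgood *; set X := #|[set P | _]| in hno *.
rewrite -!(ler_nat R) !natrD in hno hgood *.
have u0 : 0 <= u%:R :> R by rewrite ler0n.
have hy : K * (exp2 (- d * N%:R) * u%:R) <= e / 4 * u%:R.
  rewrite mulrA ler_wpM2r //.
  have : (K + 1) * exp2 (- d * N%:R) <= e / 4.
    rewrite mulrC -ler_pdivlMr ?ltr_wpDl //; apply: le_trans h3.
    by rewrite ler_peMl ?exp2_ge0 // ler1n.
  by have := exp2_ge0 (- d * N%:R); lra.
move=> hsum.
have hQ : (1 - e / 4) * u%:R <= Q%:R by lra.
have : e * Q%:R <= e0 * Q%:R by rewrite ler_wpM2r // ge_min lexx.
apply: le_trans; apply: (@le_trans _ _ (e / 2 * u%:R)); first by lra.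
have : 2^-1 * u%:R <= Q%:R :> R.
  by apply: le_trans hQ; rewrite ler_wpM2r //; lra.
by move=> h; rewrite -mulrA ler_wpM2l // ltW.
Qed.

(** * Ramsey properties of random posets *)

Section Weights.
Variables (R : realType) (X : finType).
Implicit Types (A F : {set X}) (p : R).

Definition weight p A : R := \prod_(x : X) (if x \in A then p else 1 - p).

Lemma sum_prod (f g : X -> R) :
  \sum_(A : {set X}) \prod_(x : X) (if x \in A then f x else g x) = \prod_(x : X) (f x + g x).
Proof. by rewrite bigA_distr; apply: eq_bigl => A; rewrite inE. Qed.

Lemma weight_ge0 p A : 0 <= p <= 1 -> 0 <= weight p A.
Proof. by case/andP=> p0 p1; apply: prodr_ge0 => x _; case: ifP; rewrite ?subr_ge0. Qed.

Lemma sum_weight p : \sum_(A : {set X}) weight p A = 1.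
Proof.
rewrite /weight (sum_prod (fun=> p) (fun=> 1 - p)) big1 // => x _.
by rewrite subrKC.
Qed.

Lemma weight_superset p F : \sum_(A : {set X} | F \subset A) weight p A = p ^+ #|F|.
Proof.
rewrite -prodr_const big_mkcond [RHS]big_mkcond /=.
rewrite (eq_bigr (fun A : {set X} => \prod_x (if x \in A then p else
    if x \in F then 0 else 1 - p))) => [|A _].
  rewrite (sum_prod (fun=> p) (fun x => if x \in F then 0 else 1 - p)).
  by apply: eq_bigr => x _; case: ifP; rewrite ?addr0 // subrKC.
case: ifP => [/subsetP sF|/negbT/subsetPn[x xF xA]].
  by apply: eq_bigr => x _; case: ifP => // xA; case: ifP => // /sF; rewrite xA.
by rewrite (bigD1 x) //= (negbTE xA) xF mul0r.
Qed.

Lemma weight_disjoint p F : \sum_(A : {set X} | [disjoint A & F]) weight p A = (1 - p) ^+ #|F|.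
Proof.
rewrite -prodr_const big_mkcond [RHS]big_mkcond /=.
rewrite (eq_bigr (fun A : {set X} => \prod_x (if x \in A then
    if x \in F then 0 else p else 1 - p))) => [|A _].
  rewrite (sum_prod (fun x => if x \in F then 0 else p) (fun=> 1 - p)).
  by apply: eq_bigr => x _; case: ifP; rewrite ?add0r // subrKC.
case: (boolP [disjoint A & F]) => [dAF|/pred0Pn[x /andP[/= xA xF]]].
  apply: eq_bigr => x _; case: ifP => // xA.
  by rewrite (disjointFr dAF xA).
by rewrite (bigD1 x) //= xA xF mul0r.
Qed.

(* [K A B] below is the probability that a [q]-random set is [B] and that its
   thinning to a [p]-random set is [A]. *)
Lemma sum_weight_mono p q (D : {pred {set X}}) : 0 <= p -> p <= q -> q <= 1 ->
  (forall A B : {set X}, A \subset B -> A \in D -> B \in D) ->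
  \sum_(A in D) weight p A <= \sum_(A in D) weight q A.
Proof.
move=> p0 pq q1 up.
pose K (A B : {set X}) := \prod_(x : X) (if x \in B then (if x \in A then p else q - p)
                             else (if x \in A then 0 else 1 - q)).
have K0 A B : 0 <= K A B.
  by apply: prodr_ge0 => x _; case: ifP => _; case: ifP; rewrite // subr_ge0.
have e1 A : weight p A = \sum_(B : {set X}) K A B.
  rewrite (sum_prod (fun x => if x \in A then p else q - p) (fun x => if x \in A then 0 else 1 - q)).
  apply: eq_bigr => x _; case: ifP => _; first by rewrite addr0.
  by lra.
have e2 B : weight q B = \sum_(A : {set X}) K A B.
  rewrite (eq_bigr (fun A : {set X} => \prod_x (if x \in A then (if x \in B then p else 0)
    else (if x \in B then q - p else 1 - q)))); last first.
    by move=> A _; apply: eq_bigr => x _; case: ifP => _; case: ifP.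
  rewrite (sum_prod (fun x => if x \in B then p else 0) (fun x => if x \in B then q - p else 1 - q)).
  by apply: eq_bigr => x _; case: ifP => _; rewrite ?add0r // subrKC.
rewrite (eq_bigr (fun A => \sum_(B in D) K A B)) => [|A AD].
  rewrite exchange_big /=; apply: ler_sum => B BD; rewrite e2.
  rewrite [leRHS](bigID (mem D)) /= lerDl sumr_ge0 // => A _; exact: K0.
rewrite e1 (bigID (mem D)) /= [X in _ + X]big1 ?addr0 // => B BD.
have /subsetPn[x xA xB] : ~~ (A \subset B) by apply: contra BD => AB; apply: up AD.
by rewrite /K (bigD1 x) //= (negbTE xB) xA mul0r.
Qed.

End Weights.

(** * Arrow events and the order of the two thresholds *)

Section RandomPoset.
Variable R : realType.

Lemma random_subset_prE n (p : R) (E : classical_sets.set {set {set 'I_n}}) :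
  random_subset_pr p E = \sum_(A in [pred A | A \in E]) weight p A.
Proof. by []. Qed.

Lemma random_subset_prC n (p : R) (E : classical_sets.set {set {set 'I_n}}) :
  random_subset_pr p E + random_subset_pr p (classical_sets.setC E) = 1.
Proof.
rewrite -(sum_weight {set 'I_n} p) (bigID (fun A => A \in E)) /=; congr (_ + _).
by apply: eq_bigl => A; rewrite classical_sets.in_setC.
Qed.

Lemma random_subset_pr_ge0 n (p : R) (E : classical_sets.set {set {set 'I_n}}) :
  0 <= p <= 1 -> 0 <= random_subset_pr p E.
Proof. by move=> hp; apply: sumr_ge0 => A _; apply: weight_ge0. Qed.

Lemma random_subset_pr_le n (p : R) (E : classical_sets.set {set {set 'I_n}})
    (D : {pred {set {set 'I_n}}}) : 0 <= p <= 1 ->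
  (forall A, E A -> A \in D) -> random_subset_pr p E <= \sum_(A in D) weight p A.
Proof.
move=> hp sub; rewrite random_subset_prE [leRHS]big_mkcond [leLHS]big_mkcond /=.
apply: ler_sum => A _; have w0 := @weight_ge0 R _ p A hp.
by case: ifP => [/classical_sets.set_mem/sub ->|_] //; case: ifP.
Qed.

Lemma prob_exp (c : R) n : 0 < c -> 0 <= expR (- (c * n%:R)) <= 1.
Proof. by move=> c0; rewrite expR_ge0 expR_le1 oppr_le0 mulr_ge0 // ltW. Qed.

Lemma cvg_to_one (f : nat -> R) :
  (forall e, 0 < e -> exists N, forall n, (N <= n)%N -> 1 - e <= f n <= 1) ->
  (f n @[n --> \oo] --> (1 : R))%classic.
Proof.
move=> h; apply/cvgrPdist_le => e e0; have [N hN] := h e e0.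
exists N => // n /= /hN /andP[h1 h2].
by rewrite ger0_norm ?subr_ge0 // lerBlDr -lerBlDl.
Qed.

Lemma cvg_to_one_ge (f : nat -> R) e : (f n @[n --> \oo] --> (1 : R))%classic -> 0 < e ->
  exists N, forall n, (N <= n)%N -> 1 - e <= f n.
Proof.
move=> /cvgrPdist_le h e0; have [N _ hN] := h e e0.
exists N => n Nn; have := hN n Nn.
by rewrite /= ler_norml => /andP[_]; rewrite lerBlDl -lerBlDr.
Qed.

Section Arrows.
Variables (dP dQ : Order.disp_t) (P : porderType dP) (Q : porderType dQ) (n : nat).
Implicit Types A B : {set {set 'I_n}}.

(* Copies in [subposet A], seen as maps to the whole power set. *)
Definition copy_in (dF : Order.disp_t) (F : porderType dF) (D : {set 'I_n} -> Prop) :=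
  exists phi : F -> {set 'I_n}, [/\ injective phi,
    forall x y, (x <= y)%O -> phi x \subset phi y & forall x, D (phi x)].

Lemma copy_in_subposet (dF : Order.disp_t) (F : porderType dF) A (D : {set 'I_n} -> Prop) :
  copy_in F (fun S => S \in A /\ D S) ->
  contains_copy_in F (fun x : subposet A => D (val x)).
Proof.
move=> [phi [inj mon hD]].
pose psi x : subposet A := exist _ (phi x) (hD x).1.
exists psi; split; first by move=> x y /(congr1 val) /inj.
- by move=> x y /mon.
- by move=> x; exact: (hD x).2.
Qed.

Lemma subposet_copy_in (dF : Order.disp_t) (F : porderType dF) A (D : subposet A -> Prop) :
  contains_copy_in F D -> copy_in F (fun S => exists2 x : subposet A, val x = S & D x).
Proof.
move=> [phi [inj mon hD]]; exists (fun x => val (phi x)); split.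
- by move=> x y /val_inj /inj.
- by move=> x y /mon.
- by move=> x; exists (phi x).
Qed.

(** Colourings of the power set restrict to the subposet; conversely one extends by [true], the
    colours outside [A] being irrelevant to copies in [A]. *)
Lemma arrowsP A : arrows (subposet A) P Q <->
  forall col : {set 'I_n} -> bool,
    copy_in P (fun S => S \in A /\ col S = true) \/
    copy_in Q (fun S => S \in A /\ col S = false).
Proof.
split=> h col.
  have [/subposet_copy_in|/subposet_copy_in] := h (fun x => col (val x)) => -[phi [inj mon hD]].
    left; exists phi; split=> // x; have [y <- hy] := hD x.
    by split=> //; exact: (valP y).
  right; exists phi; split=> // x; have [y <- hy] := hD x.
  by split=> //; exact: (valP y).
have [] := h (fun S => if insub S is Some x then col x else true).
  move=> /copy_in_subposet [phi [inj mon hD]]; left; exists phi; split=> // x.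
  by have := hD x; rewrite /= valK.
move=> /copy_in_subposet [phi [inj mon hD]]; right; exists phi; split=> // x.
by have := hD x; rewrite /= valK.
Qed.

Lemma arrows_up A B : A \subset B -> arrows (subposet A) P Q -> arrows (subposet B) P Q.
Proof.
move=> /subsetP sAB /arrowsP h; apply/arrowsP => col.
have [] := h col => -[phi [inj mon hD]]; [left|right]; exists phi; split=> // x;
by have [/sAB] := hD x.
Qed.

End Arrows.

(** If [c' < c] then [p <= q], but the arrow event has probability at least 3/4 for [p] and at most
    1/4 for [q], against [sum_weight_mono]. *)
Lemma c_Ram_minus_le_plus (dP dQ : Order.disp_t) (P : porderType dP) (Q : porderType dQ) :
  (c_Ram_minus R P Q <= c_Ram_plus R P Q)%E.
Proof.
apply: ge_ereal_sup => _ [c [c0 hc] <-]; apply: le_ereal_inf_tmp => _ [c' [c'0 hc'] <-].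
rewrite lee_fin leNgt; apply/negP => cc.
have e4 : 0 < 4^-1 :> R by rewrite invr_gt0 ltr0n.
have [N1 h1] := cvg_to_one_ge hc e4; have [N2 h2] := cvg_to_one_ge hc' e4.
pose n := maxn N1 N2.
have {}h1 := h1 n (leq_maxl _ _); have {}h2 := h2 n (leq_maxr _ _).
pose p := expR (- (c * n%:R)); pose q := expR (- (c' * n%:R)).
have /andP[p0 _] := prob_exp n c0; have /andP[_ q1] := prob_exp n c'0.
have pq : p <= q by rewrite ler_expR lerN2 ler_wpM2r // ltW.
have := random_subset_prC q (arrows_event P Q n).
suff : random_subset_pr p (arrows_event P Q n) <= random_subset_pr q (arrows_event P Q n).
  by rewrite -/p -/q in h1 h2 *; lra.
rewrite !random_subset_prE; apply: sum_weight_mono => //.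
move=> A B sAB; rewrite !inE => /classical_sets.set_mem h.
by apply: classical_sets.mem_set; apply: arrows_up h.
Qed.

End RandomPoset.

Section UnionBound.
Variables (R : realType) (X I : finType).

Lemma weight_union (p : R) (J : {pred I}) (Q : I -> {set X} -> bool) : 0 <= p <= 1 ->
  \sum_(A : {set X} | [exists u in J, Q u A]) weight p A <=
  \sum_(u in J) \sum_(A : {set X} | Q u A) weight p A.
Proof.
move=> hp; under [leRHS]eq_bigr do rewrite big_mkcond.
rewrite exchange_big big_mkcond /=; apply: ler_sum => A _.
have w0 := weight_ge0 A hp.
case: ifP => [/existsP[u /andP[uJ uA]]|_]; last by apply: sumr_ge0 => u _; case: ifP.
rewrite (bigD1 u) //= uA lerDl; apply: sumr_ge0 => v _; by case: ifP.
Qed.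

End UnionBound.

(** * Upper bound on the threshold by counting upsets *)

Section UpperBound.
Variables (R : realType) (N : nat) (P : labelled_poset N).

Definition upsets (F : {set 'I_N}) : {set {set 'I_N}} :=
  [set U : {set 'I_N} | (U \subset F) &&
     [forall x in U, forall y in F, ple P x y ==> (y \in U)]].

Lemma upsets_gt1 (F : {set 'I_N}) : (0 < #|F|)%N -> (1 < #|upsets F|)%N.
Proof.
move=> F0; have ne : set0 != F by rewrite eq_sym -card_gt0.
rewrite -[2%N]/(1.+1) -[1%N]/(true : nat) -ne -cards2; apply/subset_leq_card/subsetP => U.
rewrite in_set2 => /orP[] /eqP ->; rewrite in_set; apply/andP; split; rewrite ?sub0set //.
  by apply/forallP => x; rewrite in_set0.
by apply/forallP => x; apply/implyP => _; apply/forallP => y; apply/implyP => ->; rewrite implybT.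
Qed.

(** In a copy, every coordinate selects an upset of [F], namely the elements whose image contains
    it. For each of the resulting [n]-tuples of upsets with [#|F|] distinct images, all images are
    kept with probability [p ^+ #|F|]. *)
Lemma arrows_pr_le n (p : R) (F : {set 'I_N}) : 0 <= p <= 1 -> (0 < #|F|)%N ->
  random_subset_pr p (arrows_event (poset_of P) (poset_of P) n) <=
  #|upsets F|%:R ^+ n * p ^+ #|F|.
Proof.
move=> hp /card_gt0P[x0 x0F].
pose im (U : {ffun 'I_n -> {set 'I_N}}) := [set [set j | x \in U j] | x in F].
pose J : {pred {ffun 'I_n -> {set 'I_N}}} :=
  [pred U | (U \in ffun_on (mem (upsets F))) && (#|im U| == #|F|)].
have sub (A : {set {set 'I_n}}) : arrows_event (poset_of P) (poset_of P) n A ->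
    A \in [pred A : {set {set 'I_n}} | [exists U in J, im U \subset A]].
  (* Under a constant colouring the arrow gives a copy in the first colour; the second colour class
     is empty. *)
  move=> /arrowsP/(_ (fun=> true))[|]; case=> phi [inj mon hphi]; last by have [] := hphi x0.
  rewrite inE; apply/existsP.
  pose U : {ffun 'I_n -> {set 'I_N}} := [ffun j => [set x in F | j \in phi x]].
  have ePhi x : x \in F -> [set j | x \in U j] = phi x.
    by move=> xF; apply/setP => j; rewrite in_set ffunE in_set xF.
  have eim : im U = [set phi x | x in F].
    by apply: eq_in_imset => x xF; rewrite ePhi.
  exists U; rewrite inE eim card_imset // eqxx andbT; apply/andP; split; last first.
    by apply/subsetP => _ /imsetP[x _ ->]; have [] := hphi x.
  apply/ffun_onP => j; rewrite in_set; apply/andP; split.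
    by apply/subsetP => x; rewrite ffunE in_set => /andP[].
  apply/forallP => x; apply/implyP; rewrite ffunE in_set => /andP[xF xj].
  apply/forallP => y; apply/implyP => yF; apply/implyP => xy.
  by rewrite in_set yF /=; apply: (subsetP (mon x y xy)).
apply: le_trans (random_subset_pr_le hp sub) _.
apply: le_trans (weight_union _ _ hp) _.
apply: (@le_trans _ _ (\sum_(U in J) p ^+ #|F|)).
  apply: ler_sum => U; rewrite inE => /andP[_ /eqP eU].
  by rewrite weight_superset eU.
rewrite sumr_const -[leLHS]mulr_natl ler_wpM2r ?exprn_ge0 //; first by case/andP: hp.
rewrite -natrX ler_nat -[n in (_ ^ n)%N]card_ord -card_ffun_on.
by apply/subset_leq_card/subsetP => U; rewrite inE => /andP[].
Qed.

Lemma c_Ram_plus_le (F : {set 'I_N}) : (0 < #|F|)%N ->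
  (c_Ram_plus R (poset_of P) (poset_of P) <= (ln #|upsets F|%:R / #|F|%:R)%:E)%E.
Proof.
move=> F0; set L := _ / _; have U1 := upsets_gt1 F0.
have fR : 0 < #|F|%:R :> R by rewrite ltr0n.
have lU : 0 < ln #|upsets F|%:R :> R by rewrite ln_gt0 // ltr1n.
have L0 : 0 < L by rewrite divr_gt0.
apply/lee_addgt0Pr => e e0; rewrite -EFinD; apply: ge_ereal_inf; exists (L + e)%:E => //.
exists (L + e) => //; have c0 : 0 < L + e by rewrite addr_gt0.
split=> //; apply: cvg_to_one => d d0.
(* The part [L] of the exponent cancels the number of upsets, so the bound is exactly
   [exp2 (- eta * n)]. *)
pose eta := e * #|F|%:R / ln 2.
have eta0 : 0 < eta by rewrite divr_gt0 ?mulr_gt0 ?ln2_gt0.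
have [M hM] := exp2_small eta0 d0.
exists M => n /hM h; have hp := prob_exp n c0.
have := random_subset_prC (expR (- ((L + e) * n%:R))) (arrows_event (poset_of P) (poset_of P) n).
have := random_subset_pr_ge0 (arrows_event (poset_of P) (poset_of P) n) hp.
have := arrows_pr_le n hp F0.
have -> : #|upsets F|%:R ^+ n * expR (- ((L + e) * n%:R)) ^+ #|F| = exp2 (- eta * n%:R).
  rewrite -[X in X ^+ n]lnK ?posrE ?ltr0n 1?ltnW // -!expRM_natr -expRD /exp2; congr expR.
  rewrite /eta /L; field; rewrite ?gt_eqF ?ln2_gt0 //.
have : exp2 (- eta * n%:R) <= d.
  by apply: le_trans h; rewrite ler_peMl ?exp2_ge0 // ler1n.
set y := exp2 _; set a := random_subset_pr _ _; set b := random_subset_pr _ _.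
move: y a b; clear=> y a b ? ? ? ?; apply/andP; split; lra.
Qed.

End UpperBound.

(** * Lower bound on the threshold from five levels *)

Section LowerBound.
Variable N : nat.
Hypothesis N0 : (0 < N)%N.
(** With [2 N] families in a level, one of the two colours occurs on at least [N] of them. *)
Let K := (N + N)%N.

Section Blocks.
Variables n q : nat.
Hypotheses (Kq : (K <= q)%N) (qn : (5 * q <= n)%N).
Implicit Types (i : 'I_5) (k : 'I_K) (j : 'I_n) (S Z : {set 'I_n}).

(* [n] coordinates contain five consecutive blocks of length [q], and each
   block starts with [K] tag coordinates. The members of [level_family i k]
   contain all blocks before the [i]-th, the [k]-th tag and any free
   coordinates of the [i]-th, and nothing after it. *)
Definition level_base i k : {set 'I_n} :=
  [set j : 'I_n | (j < i * q)%N || (j == i * q + k :> nat)%N].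

Definition level_free i : {set 'I_n} :=
  [set j : 'I_n | (i * q + K <= j)%N && (j < i * q + q)%N].

Definition level_family i k : {set {set 'I_n}} :=
  [set level_base i k :|: S | S in powerset (level_free i)].

Lemma level_bound i : (i * q + q <= n)%N.
Proof. by apply: leq_trans qn; rewrite -mulSnr leq_mul2r ltn_ord orbT. Qed.

Lemma card_level_family i k : (2 ^ (q - K) <= #|level_family i k|)%N.
Proof.
have lt_free (x : 'I_(q - K)) : (i * q + K + x < n)%N.
  apply: leq_trans (level_bound i); rewrite -addnA ltn_add2l.
  by rewrite -ltn_subRL.
rewrite card_in_imset => [|S S']; last first.
  rewrite !powersetE => sS sS' e; apply/setP => j.
  have dj : j \in level_free i -> j \notin level_base i k.
    rewrite !in_set => /andP[h _]; rewrite negb_or -leqNgt (leq_trans (leq_addr _ _) h) /=.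
    by apply/negP => /eqP e'; move: h; rewrite e' leq_add2l leqNgt ltn_ord.
  move/setP/(_ j): e; rewrite !in_setU.
  case: (boolP (j \in level_free i)) => [/dj /negbTE -> //|jF _].
  have := contra (subsetP sS j) jF; have := contra (subsetP sS' j) jF.
  by move=> /negbTE -> /negbTE ->.
rewrite card_powerset leq_exp2l //.
rewrite -[leqLHS]card_ord -(card_imset (f := fun x => Ordinal (lt_free x)) 'I_(q - K)).
  apply/subset_leq_card/subsetP => _ /imsetP[x _ ->].
  by rewrite in_set /= leq_addr /= -addnA ltn_add2l -ltn_subRL.
by move=> x y /(congr1 val) /= /addnI /val_inj.
Qed.

Lemma level_family_before i k Z j : Z \in level_family i k -> (j < i * q)%N -> j \in Z.
Proof. by move=> /imsetP[S _ ->] h; rewrite in_setU in_set h. Qed.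

Lemma level_family_lt i k Z j : Z \in level_family i k -> j \in Z -> (j < i * q + q)%N.
Proof.
move=> /imsetP[S + ->]; rewrite powersetE => /subsetP sS.
rewrite in_setU in_set => /orP[/orP[h|/eqP ->]|/sS].
- by apply: leq_trans h (leq_addr _ _).
- by rewrite ltn_add2l; apply: leq_trans (ltn_ord k) Kq.
- by rewrite in_set => /andP[].
Qed.

Lemma level_family_tag i k Z j k' : Z \in level_family i k ->
  j = (i * q + k')%N :> nat -> (k' < K)%N -> (j \in Z) = (k' == k :> nat).
Proof.
move=> /imsetP[S + ->] ej kK; rewrite powersetE => /subsetP sS.
rewrite in_setU in_set ej ltnNge leq_addr /= eqn_add2l.
case: eqVneq => //= _; apply/negbTE/negP => /sS.
by rewrite in_set ej leq_add2l leqNgt kK.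
Qed.

Lemma level_family_sub i i' k k' Z Z' : Z \in level_family i k ->
  Z' \in level_family i' k' -> (i < i')%N -> Z \subset Z'.
Proof.
move=> hZ hZ' ii; apply/subsetP => j jZ; apply: (level_family_before hZ').
apply: leq_trans (level_family_lt hZ jZ) _.
by rewrite -mulSnr leq_mul2r ii orbT.
Qed.

Lemma tag_lt i k : (i * q + k < n)%N.
Proof.
apply: leq_trans (level_bound i); rewrite ltn_add2l.
exact: leq_trans (ltn_ord k) Kq.
Qed.

(** [Z'] contains the whole [i]-th block and so all its [K >= 2] tags, while [Z] contains just
    one. *)
Lemma level_family_neq i i' k k' Z Z' : Z \in level_family i k ->
  Z' \in level_family i' k' -> (i < i')%N -> Z != Z'.
Proof.
move=> hZ hZ' ii; have K1 : (1 < K)%N by rewrite /K -(prednK N0) addSn addnS.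
pose k0 : 'I_K := Ordinal (ltnW K1); pose k1 : 'I_K := Ordinal K1.
have inZ' (k2 : 'I_K) : Ordinal (tag_lt i k2) \in Z'.
  apply: (level_family_before hZ') => /=.
  apply: (@leq_trans (i * q + q)); first by rewrite ltn_add2l (leq_trans (ltn_ord k2)).
  by rewrite -mulSnr leq_mul2r ii orbT.
apply: contraTneq (inZ' k0) => e.
have := inZ' k1; rewrite -e (level_family_tag hZ (k' := k1)) // => /eqP e1.
by rewrite (level_family_tag hZ (k' := k0)) // -e1.
Qed.

Lemma level_family_inj i i' k k' Z : Z \in level_family i k ->
  Z \in level_family i' k' -> i = i' /\ k = k'.
Proof.
move=> hZ hZ'.
have ei : i = i'.
  apply: val_inj => /=; case: (ltngtP i i') => // h.
    by have := level_family_neq hZ hZ' h; rewrite eqxx.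
  by have := level_family_neq hZ' hZ h; rewrite eqxx.
split=> //; subst i'; apply: val_inj; apply/eqP.
rewrite -(level_family_tag hZ' (erefl : Ordinal (tag_lt i k) = _ :> nat) (ltn_ord k)).
by rewrite (level_family_tag hZ (k' := k)).
Qed.

(* Among five levels, each coloured by its majority colour, three share a
   colour. *)
Lemma arrows_of_levels (P : labelled_poset N) (rank : 'I_N -> nat) (A : {set {set 'I_n}}) :
  (forall x, (rank x < 3)%N) -> (forall x y, plt P x y -> (rank x < rank y)%N) ->
  (forall i k, exists2 Z, Z \in A & Z \in level_family i k) ->
  arrows (subposet A) (poset_of P) (poset_of P).
Proof.
move=> r3 rlt hA; apply/arrowsP => col.
have /fin_all_exists[Z hZ] : forall p : 'I_5 * 'I_K, exists Z, Z \in A /\ Z \in level_family p.1 p.2.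
  by move=> [i k]; have [Z h1 h2] := hA i k; exists Z.
pose T i := [set k | col (Z (i, k))].
pose c i := (N <= #|T i|)%N.
pose S i := [set k | col (Z (i, k)) == c i].
have cS i : (N <= #|S i|)%N.
  rewrite /S /c; case: (leqP N #|T i|) => h.
    by apply: leq_trans h _; apply/subset_leq_card/subsetP => k; rewrite !in_set => ->.
  have -> : [set k | col (Z (i, k)) == false] = ~: T i.
    by apply/setP => k; rewrite !in_set eqbF_neg.
  have := cardsC (T i); rewrite card_ord /K => e.
  by rewrite -(leq_add2l #|T i|) e leq_add2r ltnW.
pose s (b : bool) := [seq i : nat <- iota 0 5 | c (inord i) == b].
have [b b3] : exists b, (3 <= size (s b))%N.
  have e : (size (s true) + size (s false) = 5)%N.
    rewrite /s !size_filter.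
    have := count_predC (fun i : nat => c (inord i) == true) (iota 0 5); rewrite size_iota => e; rewrite -[RHS]e.
    by congr (_ + _)%N; apply: eq_count => i /=; case: (c _).
  case: (leqP 3 (size (s true))) => h; first by exists true.
  exists false; rewrite -(leq_add2l (size (s true))) e.
  by apply: (@leq_trans (2 + 3)); rewrite ?leq_add2r.
have sl r : (r < 3)%N -> (nth 0 (s b) r < 5)%N /\ c (inord (nth 0 (s b) r)) = b.
  move=> hr; have : nth 0 (s b) r \in s b by rewrite mem_nth // (leq_trans hr).
  by rewrite mem_filter mem_iota /= => /andP[/eqP -> ->].
pose l r : 'I_5 := inord (nth 0 (s b) r).
have ll r r' : (r < r')%N -> (r' < 3)%N -> (l r < l r')%N.
  move=> rr hr'; have hr := ltn_trans rr hr'.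
  rewrite !inordK ?(sl _ hr).1 ?(sl _ hr').1 //.
  apply: (sorted_ltn_nth ltn_trans) => //; rewrite ?inE ?(leq_trans _ b3) //.
  by apply: sorted_filter; [exact: ltn_trans|exact: iota_ltn_sorted].
have K0 : (0 < K)%N by rewrite addn_gt0 N0.
(* Elements of equal rank go to different families of one level, chosen by their labels. *)
pose h i (x : 'I_N) : 'I_K := nth (Ordinal K0) (enum (S i)) x.
have hS i x : h i x \in S i.
  by rewrite -mem_enum mem_nth // -cardE (leq_trans (ltn_ord x)).
pose phi (x : 'I_N) := Z (l (rank x), h (l (rank x)) x).
have phiF x : phi x \in level_family (l (rank x)) (h (l (rank x)) x) by have [] := hZ (l (rank x), h (l (rank x)) x).
have phi_inj : injective phi.
  move=> x y e; have [ei ek] := level_family_inj (phiF x) (eq_rect_r (fun Z => Z \in _) (phiF y) e).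
  move: ek; rewrite ei => /eqP; rewrite nth_uniq ?enum_uniq -?cardE ?(leq_trans (ltn_ord _)) //.
  by move=> /eqP /val_inj.
have phi_mon x y : ple P x y -> phi x \subset phi y.
  move=> xy; have [->//|ne] := eqVneq x y.
  apply: level_family_sub (phiF x) (phiF y) _; apply: ll => //.
  by apply: rlt; rewrite /plt ne.
have phi_col x : col (phi x) = b.
  have := hS (l (rank x)) x; rewrite in_set => /eqP ->.
  exact: (sl _ (r3 x)).2.
have : copy_in (poset_of P) (fun S : {set 'I_n} => S \in A /\ col S = b).
  exists phi; split=> // x; split; last exact: phi_col.
  by have [] := hZ (l (rank x), h (l (rank x)) x).
by case: (b) => E; [left|right].
Qed.

End Blocks.

(** Union bound over the [5 * K] families for the event that one is missed; otherwise
    [arrows_of_levels] applies. *)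
Lemma levels_pr_ge (R : realType) n q (p : R) (P : labelled_poset N) (rank : 'I_N -> nat) :
  0 <= p <= 1 -> (K <= q)%N -> (5 * q <= n)%N ->
  (forall x, (rank x < 3)%N) -> (forall x y, plt P x y -> (rank x < rank y)%N) ->
  1 - (5 * K)%N%:R * (1 - p) ^+ (2 ^ (q - K)) <=
    random_subset_pr p (arrows_event (poset_of P) (poset_of P) n).
Proof.
move=> hp Kq qn r3 rlt; have /andP[p0 p1] := hp.
have := random_subset_prC p (arrows_event (poset_of P) (poset_of P) n).
suff : random_subset_pr p (classical_sets.setC (arrows_event (poset_of P) (poset_of P) n)) <=
    (5 * K)%N%:R * (1 - p) ^+ (2 ^ (q - K)) by lra.
pose fam (u : 'I_5 * 'I_K) := level_family n q u.1 u.2.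
have sub (A : {set {set 'I_n}}) :
    classical_sets.setC (arrows_event (poset_of P) (poset_of P) n) A ->
    A \in [pred A : {set {set 'I_n}} | [exists u in xpredT, [disjoint A & fam u]]].
  move=> nA; rewrite inE; apply: contra_notT nA => /existsPn h.
  apply: (arrows_of_levels Kq qn r3 rlt) => i k.
  by have /pred0Pn[Z /andP[/= ZA Zf]] := h (i, k); exists Z.
apply: le_trans (random_subset_pr_le hp sub) _.
apply: le_trans (weight_union _ _ hp) _.
apply: (@le_trans _ _ (\sum_(u : 'I_5 * 'I_K) (1 - p) ^+ (2 ^ (q - K)))).
  apply: ler_sum => u _; rewrite weight_disjoint.
  by apply: ler_wiXn2l; rewrite ?subr_ge0 ?lerBlDr ?lerDl // card_level_family.
by rewrite sumr_const card_prod !card_ord -[leLHS]mulr_natl.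
Qed.

Lemma c_Ram_minus_ge (R : realType) (P : labelled_poset N) (rank : 'I_N -> nat) :
  (forall x, (rank x < 3)%N) -> (forall x y, plt P x y -> (rank x < rank y)%N) ->
  ((ln 2 / 5)%:E <= c_Ram_minus R (poset_of P) (poset_of P))%E.
Proof.
move=> r3 rlt; have l2 := ln2_gt0 R.
apply/lee_addgt0Pr => e e0.
(* The first argument only keeps [c] positive when [e] is large. *)
pose c := Num.max (ln 2 / 10) (ln 2 / 5 - e / 2).
have c0 : 0 < c by rewrite lt_max divr_gt0.
have cl : c < ln 2 / 5 by rewrite gt_max; apply/andP; split; lra.
apply: (@le_trans _ _ (c%:E + e%:E)%E).
  rewrite -EFinD lee_fin; have : ln 2 / 5 - e / 2 <= c by rewrite le_max lexx orbT.
  by lra.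
apply: leeD => //; apply: ereal_sup_ubound; exists c => //; split=> //.
apply: cvg_to_one => d d0.
pose eta := 5^-1 - c / ln 2.
have eta0 : 0 < eta by rewrite subr_gt0 ltr_pdivrMr // mulrC.
pose D := (5 * K)%N%:R * exp2 (1 + K%:R) : R.
have D0 : 0 < D by rewrite mulr_gt0 ?exp2_gt0 // ltr0n muln_gt0 addn_gt0 N0.
have [M hM] := exp2_small eta0 (divr_gt0 d0 D0).
exists (maxn M (5 * K)) => n; rewrite geq_max => /andP[/hM h nK].
have hp := prob_exp n c0; set p := expR _ in hp *; have /andP[p0 p1] := hp.
pose q := (n %/ 5)%N.
have Kq : (K <= q)%N by rewrite leq_divRL // mulnC.
have qn : (5 * q <= n)%N by rewrite mulnC leq_trunc_div.
have := levels_pr_ge hp Kq qn r3 rlt.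
have := random_subset_prC p (arrows_event (poset_of P) (poset_of P) n).
have := random_subset_pr_ge0 (classical_sets.setC (arrows_event (poset_of P) (poset_of P) n)) hp.
have : (5 * K)%N%:R * (1 - p) ^+ (2 ^ (q - K)) <= d.
  set y := p * (2 ^ (q - K))%N%:R.
  have y0 : 0 < y by rewrite mulr_gt0 ?expR_gt0 // ltr0n expn_gt0.
  have h1 : (1 - p) ^+ (2 ^ (q - K)) <= y^-1.
    apply: (@le_trans _ _ (expR (- p) ^+ (2 ^ (q - K)))).
      by apply: lerXn2r; rewrite ?nnegrE ?subr_ge0 ?expR_ge0 // expR_ge1Dx.
    rewrite -expRM_natr mulNr -/y expRN lef_pV2 ?posrE ?expR_gt0 //.
    by apply: le_trans (expR_ge1Dx y); rewrite lerDr ler01.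
  (* Rounding gives [q >= n / 5 - 1], so [y] is at least [2 ^ (eta * n - 1 - K)]. *)
  have h2 : y^-1 <= exp2 (1 + K%:R) * exp2 (- eta * n%:R).
    rewrite -exp2D -[leRHS]invrK lef_pV2 ?posrE ?invr_gt0 ?exp2_gt0 //.
    rewrite /exp2 -expRN /y -exp2_nat /p /exp2 -expRD ler_expR natrB //.
    have : n%:R / 5 - 1 <= q%:R :> R.
      have : (n%:R <= (q * 5 + 5)%N%:R :> R)%R.
        by rewrite ler_nat {1}(divn_eq n 5) leq_add2l ltnW // ltn_mod.
      by rewrite natrD natrM; lra.
    rewrite -(ler_pM2r l2); rewrite /eta.
    have -> : - ((1 + K%:R + - (5^-1 - c / ln 2) * n%:R) * ln 2) =
      (n%:R / 5 - 1 - K%:R) * ln 2 - c * n%:R by field; rewrite gt_eqF.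
    by lra.
  have k0 : 0 <= (5 * K)%N%:R :> R by [].
  apply: le_trans (ler_wpM2l k0 (le_trans h1 h2)) _; rewrite mulrA -/D.
  rewrite mulrC -ler_pdivlMr //; apply: le_trans h.
  by rewrite ler_peMl ?exp2_ge0 // ler1n.
set a := random_subset_pr _ _; set b := random_subset_pr _ _.
set z := _ * _ ^+ _; move: a b z; clear => a b z ? ? ? ?.
by apply/andP; split; lra.
Qed.

End LowerBound.

(** * Almost all posets *)

Section LayeredUpsets.
Variables (N : nat) (P : labelled_poset N).
Implicit Types A B C U S : {set 'I_N}.

Lemma three_layered_rank (R : realType) (g : R) t : three_layered g t P ->
  exists rank : 'I_N -> nat, (forall x, (rank x < 3)%N) /\
    (forall x y, plt P x y -> (rank x < rank y)%N).
Proof.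
move=> [A [B [sA sE _]]]; exists (layer A B); split=> [x|].
  by rewrite /layer; case: ifP => // _; case: ifP.
apply: plt_ind => [x y z|x y]; first exact: ltn_trans.
exact: layer_edge.
Qed.

Definition sets_lt t : {set {set 'I_N}} := [set S : {set 'I_N} | (#|S| < t)%N].

(** Pad an enumeration with [None] to a tuple of length [t]. *)
Lemma card_sets_lt t : (#|sets_lt t| <= N.+1 ^ t)%N.
Proof.
pose f (u : t.-tuple (option 'I_N)) := [set x : 'I_N | Some x \in u].
have -> : (N.+1 ^ t = #|{: t.-tuple (option 'I_N)}|)%N.
  by rewrite card_tuple card_option card_ord.
apply: leq_trans (leq_imset_card f _); apply/subset_leq_card/subsetP => S.
rewrite in_set => hS; pose s := map Some (enum S) ++ nseq (t - #|S|) None.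
have ss : size s == t by rewrite size_cat size_map size_nseq -cardE subnKC // ltnW.
apply/imsetP; exists (Tuple ss) => //; apply/setP => x.
rewrite in_set (_ : (Some x \in Tuple ss) = (Some x \in s)) //.
rewrite mem_cat (mem_map (@Some_inj _)) mem_enum.
by case: (x \in S) => //=; apply/esym/negbTE; rewrite mem_nseq andbF.
Qed.

(** If [U] contained [t] vertices of [A] and missed [t] of [B], some edge between them would lead
    out of [U]. *)
Lemma dense_between_cases t A B U : dense_between t (cover_graph P) A B ->
  (forall x y, x \in U -> x \in A -> y \in B -> ple P x y -> y \in U) ->
  (#|U :&: A| < t)%N \/ (#|B :\: U| < t)%N.
Proof.
move=> /forallP hd hU; case: (ltnP #|U :&: A| t) => h1; [by left|right].
rewrite ltnNge; apply/negP => h2.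
have ex (X : {set 'I_N}) : (t <= #|X|)%N -> exists2 S : {set 'I_N}, S \subset X & #|S| = t.
  case/card_geqP => s [us ss sX]; exists [set x in s].
    by apply/subsetP => x; rewrite in_set => /sX.
  by rewrite cardsE (card_uniqP us).
have [S sS cS] := ex _ h1; have [S' sS' cS'] := ex _ h2.
have /forallP/(_ S') := hd S; rewrite cS cS' !eqxx !andbT.
rewrite (subset_trans sS (subsetIr _ _)) (subset_trans sS' (subsetDl _ _)) /=.
move=> /pred0Pn[[x y] /andP[/= xy]]; rewrite in_setX => /andP[xS yS].
have := subsetP sS x xS; rewrite in_setI => /andP[xU xA].
have := subsetP sS' y yS; rewrite in_setD => /andP[yU yB].
by case/negP: yU; apply: (hU x) => //; have /andP[] := cover_plt xy.
Qed.

Lemma dense_between_sub t A B A' B' : A' \subset A -> B' \subset B ->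
  dense_between t (cover_graph P) A B -> dense_between t (cover_graph P) A' B'.
Proof.
move=> sA sB /forallP h; apply/forallP => S; apply/forallP => S'; apply/implyP.
case/and4P=> h1 h2 h3 h4; have /forallP/(_ S')/implyP := h S; apply.
by rewrite (subset_trans h1 sA) (subset_trans h2 sB) h3.
Qed.

(* An upset and the complement of an upset cannot both be large in two
   consecutive layers, so at most one layer is cut nontrivially. *)
Lemma card_upsets_le t m A B C : (t + t <= m)%N ->
  dense_between t (cover_graph P) A B -> dense_between t (cover_graph P) B C ->
  #|A| = m -> #|B| = m -> #|C| = m ->
  (#|upsets P (A :|: B :|: C)| <= 3 * (N.+1 ^ t * N.+1 ^ t * 2 ^ m))%N.
Proof.
move=> tm dAB dBC cA cB cC.
pose D (X : {set 'I_N}) := setX (setX (sets_lt t) (sets_lt t)) (powerset X).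
pose f1 (u : {set 'I_N} * {set 'I_N} * {set 'I_N}) := u.1.1 :|: u.1.2 :|: u.2.
pose f2 (u : {set 'I_N} * {set 'I_N} * {set 'I_N}) := u.1.1 :|: u.2 :|: (C :\: u.1.2).
pose f3 (u : {set 'I_N} * {set 'I_N} * {set 'I_N}) := u.2 :|: (B :\: u.1.1) :|: (C :\: u.1.2).
have cD (X : {set 'I_N}) (f : {set 'I_N} * {set 'I_N} * {set 'I_N} -> {set 'I_N}) :
    #|X| = m -> (#|[set f u | u in D X]| <= N.+1 ^ t * N.+1 ^ t * 2 ^ m)%N.
  move=> cX; apply: leq_trans (leq_imset_card _ _) _.
  by rewrite !cardsX card_powerset cX leq_mul ?leq_mul ?card_sets_lt.
apply: (@leq_trans #|[set f1 u | u in D C] :|: [set f2 u | u in D B] :|: [set f3 u | u in D A]|); last first.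
  rewrite !mulSn mul0n addn0 addnA; apply: leq_trans (leq_card_setU _ _) _.
  apply: leq_add; last exact: cD.
  by apply: leq_trans (leq_card_setU _ _) _; apply: leq_add; apply: cD.
apply/subset_leq_card/subsetP => U; rewrite in_set => /andP[sU /forallP hU].
have up x y : x \in U -> y \in A :|: B :|: C -> ple P x y -> y \in U.
  by move=> xU yF xy; move: (implyP (hU x) xU) => /forallP/(_ y)/implyP/(_ yF)/implyP/(_ xy).
have UE : U = (U :&: A) :|: (U :&: B) :|: (U :&: C).
  by rewrite -!setIUr; apply/esym/setIidPl.
have UD X : U :&: X = X :\: (X :\: U).
  by rewrite setDDr setDv set0U setIC.
have c1 : (#|U :&: A| < t)%N \/ (#|B :\: U| < t)%N.
  apply: dense_between_cases dAB _ => x y xU _ yB xy.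
  by apply: (up x) => //; rewrite !in_setU yB orbT.
have c2 : (#|U :&: B| < t)%N \/ (#|C :\: U| < t)%N.
  apply: dense_between_cases dBC _ => x y xU _ yC xy.
  by apply: (up x) => //; rewrite !in_setU yC orbT.
have inD (X : {set 'I_N}) (u : {set 'I_N} * {set 'I_N} * {set 'I_N}) :
     (#|u.1.1| < t)%N -> (#|u.1.2| < t)%N -> u.2 \subset X -> u \in D X.
  by case: u => [[u1 u2] u3] /= h1 h2 h3; rewrite !in_setX powersetE !in_set h1 h2.
rewrite !in_setU; case: c1 => h1; case: c2 => h2.
- apply/orP; left; apply/orP; left; apply/imsetP.
  by exists (U :&: A, U :&: B, U :&: C); [apply: inD; rewrite ?subsetIr|].
- apply/orP; left; apply/orP; right; apply/imsetP.
  exists (U :&: A, C :\: U, U :&: B); first by apply: inD; rewrite ?subsetIr.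
  by rewrite /f2 /= -UD.
- have := cardsID U B; rewrite cB setIC => e.
  have : (m < t + t)%N by rewrite -e -addSn leq_add // ltnW.
  by rewrite ltnNge tm.
- apply/orP; right; apply/imsetP.
  exists (B :\: U, C :\: U, U :&: A); first by apply: inD; rewrite ?subsetIr.
  by rewrite /f3 /= -!UD.
Qed.

End LayeredUpsets.

(** * The error term and the final assembly *)

Section AlmostAll.
Variable R : realType.

(** Apply [ln q <= q] to the fourth root [q] of [n]. *)
Lemma ln_sqr_le (n : nat) : (0 < n)%N -> ln n%:R ^+ 2 <= 16 * Num.sqrt n%:R :> R.
Proof.
move=> n0; pose r := Num.sqrt (n%:R : R); pose q := Num.sqrt r.
have nR : 0 < n%:R :> R by rewrite ltr0n.
have r0 : 0 < r by rewrite sqrtr_gt0.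
have q0 : 0 < q by rewrite sqrtr_gt0.
have qr : q ^+ 2 = r by rewrite sqr_sqrtr // ltW.
have rn : r ^+ 2 = n%:R by rewrite sqr_sqrtr // ltW.
have e : ln n%:R = ln q *+ 4 by rewrite -rn -qr -exprM lnXn.
have l0 : 0 <= ln n%:R :> R by rewrite ln_ge0 // ler1n.
have : ln n%:R <= q *+ 4 by rewrite e ler_pMn2r // ltW // ln_sublinear.
move=> h; apply: (@le_trans _ _ ((q *+ 4) ^+ 2)).
  by apply: lerXn2r; rewrite ?nnegrE // mulrn_wge0 // ltW.
by rewrite exprMn_n qr -mulr_natl.
Qed.

(** The side length [t] used in [kleitman_rothschild]; the successor ensures [5 n <= t * t]. *)
Definition rect n : nat := (Num.truncn (Num.sqrt (5 * n%:R : R))).+1.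

Lemma rect_ge n : (5 * n <= rect n * rect n)%N.
Proof.
rewrite -(ler_nat R) !natrM; set s : R := 5%:R * n%:R.
have s0 : 0 <= s by rewrite mulr_ge0.
have h : Num.sqrt s <= (rect n)%:R by apply: ltW; rewrite /rect truncnS_gt.
rewrite -[s]sqr_sqrtr // -expr2; apply: lerXn2r; rewrite ?nnegrE ?sqrtr_ge0 //.
Qed.

Lemma rect_le n : (0 < n)%N -> (rect n)%:R <= 4 * Num.sqrt n%:R :> R.
Proof.
move=> n0; have s0 : 0 <= Num.sqrt (5 * n%:R : R) by apply: sqrtr_ge0.
have h : (Num.truncn (Num.sqrt (5 * n%:R : R)))%:R <= Num.sqrt (5 * n%:R : R) by rewrite truncn_le.
have r1 : 1 <= Num.sqrt n%:R :> R.
  by rewrite -[leLHS]sqrtr1 ler_sqrt ?ler1n ?ltr0n.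
have h3 : Num.sqrt (5 * n%:R : R) <= 3 * Num.sqrt n%:R.
  rewrite -[3]ger0_norm // -sqrtr_sqr -sqrtrM ?sqr_ge0 // ler_sqrt ?mulr_ge0 ?sqr_ge0 //.
  by rewrite ler_wpM2r // expr2; lra.
by rewrite /rect -natr1; lra.
Qed.

Lemma labelled_poset_gt0 N : (0 < #|{: labelled_poset N}|)%N.
Proof.
pose r : {ffun 'I_N * 'I_N -> bool} := [ffun p => p.1 == p.2].
have po : is_partial_order r.
  split=> [x|x y|y x z]; rewrite !ffunE //=.
    by case/andP=> /eqP.
  by move=> /eqP ->.
by apply/card_gt0P; exists (exist _ r (asboolT po)).
Qed.

Lemma almost_all_of_rare (X : forall N, labelled_poset N -> Prop) :
  (forall e : R, 0 < e -> exists N0, forall N, (N0 <= N)%N ->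
     #|[set P : labelled_poset N | ~~ `[< X N P >]]|%:R <= e * #|{: labelled_poset N}|%:R) ->
  almost_all_posets R X.
Proof.
move=> h; apply: cvg_to_one => e e0; have [N0 hN] := h e e0.
exists N0 => N /hN {}h.
have q0 : 0 < #|{: labelled_poset N}|%:R :> R by rewrite ltr0n labelled_poset_gt0.
rewrite ler_pdivlMr // ler_pdivrMr // mul1r ler_nat max_card andbT.
have : (#|[set P : labelled_poset N | `[< X N P >]]| +
        #|[set P : labelled_poset N | ~~ `[< X N P >]]| = #|{: labelled_poset N}|)%N.
  rewrite -[RHS](cardsC [set P : labelled_poset N | `[< X N P >]]); congr (_ + _)%N.
  by apply: eq_card => P; rewrite !inE.
move=> /(congr1 (fun k => k%:R : R)); rewrite natrD => hs.
by move: h hs; set a := #|_|%:R; set b := #|_|%:R; lra.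
Qed.

Lemma c_Ram_plus_three_layered (g : R) : 0 < g -> exists N0, forall N (P : labelled_poset N),
  (N0 <= N)%N -> three_layered g (rect N) P ->
  (c_Ram_plus R (poset_of P) (poset_of P) <= (ln 2 / 3 + 160 / g / ln N%:R)%:E)%E.
Proof.
move=> g0.
(* [N] above [64 / g ^ 2] makes [g] times the root of [N] at least 8, which yields [t + t <= m]. *)
have [M hM] : exists M : nat, 64 / g ^+ 2 < M%:R.
  exists (Num.bound `|64 / g ^+ 2|); exact: le_lt_trans (ler_norm _) (archi_boundP (normr_ge0 _)).
have [M' hM'] : exists M : nat, expR 1 < M%:R :> R.
  by exists (Num.bound (expR 1 : R)); apply: archi_boundP (expR_ge0 1).
exists (maxn 2 (maxn M M')) => N P; rewrite !geq_max => /and3P[N3 MN MN'] [A [B [sA sE gd]]].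
have N0 : (0 < N)%N by apply: leq_trans N3.
have nR : 0 < N%:R :> R by rewrite ltr0n.
set t := rect N in gd *; set C := third A B in gd *.
case/and4P: gd => gA gB gC /and4P[dAB dBC _ _].
pose m := (Num.truncn (g * N%:R)).+1.
pose r := Num.sqrt (N%:R : R); have r0 : 0 < r by rewrite sqrtr_gt0.
have rr : r ^+ 2 = N%:R by rewrite sqr_sqrtr // ltW.
have hm : g * N%:R < m%:R by rewrite truncnS_gt.
have cT : #|[set: 'I_N]| = N by rewrite cardsT card_ord.
have ex (X : {set 'I_N}) : g < dens R [set: 'I_N] X -> exists2 S : {set 'I_N}, S \subset X & #|S| = m.
  rewrite /dens cT ltr_pdivlMr // => hX.
  have : (m <= #|X|)%N.
    rewrite -(ltr_nat R); apply: le_lt_trans hX.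
    by rewrite truncn_le mulr_ge0 // ltW.
  case/card_geqP => s [us ss sX]; exists [set x in s].
    by apply/subsetP => x; rewrite in_set => /sX.
  by rewrite cardsE (card_uniqP us).
have [A' sA' cA] := ex _ gA; have [B' sB' cB] := ex _ gB; have [C' sC' cC] := ex _ gC.
have ht : t%:R <= 4 * r by apply: rect_le.
have gr : 8 <= g * r.
  have : 64 <= (g * r) ^+ 2.
    rewrite exprMn rr mulrC -ler_pdivrMr ?exprn_gt0 // ltW // (lt_le_trans hM) //.
    by rewrite ler_nat.
  have : 0 < g * r by rewrite mulr_gt0.
  by rewrite expr2; nra.
have tm : (t + t <= m)%N.
  rewrite -(ler_nat R) natrD; apply: ltW; apply: le_lt_trans hm.
  have : 8 * r <= g * r * r by rewrite ler_pM2r.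
  by rewrite -rr expr2; lra.
pose F := A' :|: B' :|: C'.
have hU := card_upsets_le tm (dense_between_sub sA' sB' dAB) (dense_between_sub sB' sC' dBC) cA cB cC.
have cF : #|F| = (3 * m)%N.
  have dj (X Y : {set 'I_N}) : X :&: Y = set0 -> #|X :|: Y| = (#|X| + #|Y|)%N.
    by move=> e; rewrite cardsU e cards0 subn0.
  have d1 : A' :&: B' = set0.
    apply/eqP; rewrite setI_eq0; apply: disjointWl sA' _; apply: disjointWr sB' _.
    by move: sA; rewrite subsetD => /andP[].
  have d2 : (A' :|: B') :&: C' = set0.
    apply/setP => x; rewrite in_setI in_setU in_set0; apply/negbTE/negP => /andP[h /(subsetP sC')].
    rewrite /C /third !in_setD => /and3P[xA xB _].
    by case/orP: h => [/(subsetP sA')|/(subsetP sB')]; rewrite ?(negbTE xA) ?(negbTE xB).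
  by rewrite /F !dj // cA cB cC !mulSn mul0n addn0 addnA.
have m0 : 0 < m%:R :> R by rewrite ltr0n.
have F0 : (0 < #|F|)%N by rewrite cF muln_gt0.
apply: le_trans (c_Ram_plus_le R P F0) _; rewrite lee_fin cF.
pose l := ln (N%:R : R).
have l1 : 1 <= l.
  rewrite -[1](expRK (R := R)) ler_ln ?posrE ?expR_gt0 // ltW // (lt_le_trans hM') //.
  by rewrite ler_nat.
have t1 : 1 <= t%:R :> R by rewrite ler1n.
have U0 : (0 < #|upsets P F|)%N by apply: ltnW; apply: upsets_gt1.
have hln : ln #|upsets P F|%:R <= ln 3 + t%:R * (2 * l) * 2 + m%:R * ln 2 :> R.
  apply: (@le_trans _ _ (ln (3 * ((N.+1%:R ^+ t * N.+1%:R ^+ t) * 2 ^+ m)))).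
    by rewrite ler_ln ?posrE ?ltr0n ?mulr_gt0 ?exprn_gt0 // -!natrX -!natrM ler_nat.
  rewrite !lnM ?posrE ?mulr_gt0 ?exprn_gt0 ?ltr0n //.
  rewrite !lnXn ?ltr0n // -[_ *+ t]mulr_natl -[_ *+ m]mulr_natl.
  have : ln N.+1%:R <= 2 * l.
    have -> : 2 * l = ln (N%:R ^+ 2) by rewrite lnXn // mulr_natl.
    rewrite ler_ln ?posrE ?exprn_gt0 ?ltr0n // -natrX ler_nat -mulnn.
    apply: (@leq_trans (2 * N)); last by rewrite leq_mul2r N3 orbT.
    by rewrite mul2n -addnn -addn1 leq_add2l.
  move=> hl; have : t%:R * ln N.+1%:R <= t%:R * (2 * l) by rewrite ler_wpM2l.
  by rewrite /l; lra.
have l3 : ln 3 <= 3 * (t%:R * l).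
  have : ln 3 < 3 :> R by apply: ln_sublinear.
  have : 1 <= t%:R * l by apply: mulr_ege1.
  by lra.
rewrite natrM ler_pdivrMr ?mulr_gt0 //.
(* From [t <= 4 r] and [l ^ 2 <= 16 r] one gets [7 t l^2 <= 448 r^2], which is below [480 r^2];
   dividing 480 by 3 gives the constant 160. *)
have key : 7 * (t%:R * l) <= 160 / g / l * (3 * m%:R).
  have tl : t%:R * l <= 4 * r * l by rewrite ler_wpM2r // (le_trans _ l1).
  have l0 : 0 < l by apply: lt_le_trans l1.
  have ll : l ^+ 2 <= 16 * r by apply: ln_sqr_le.
  apply: (@le_trans _ _ (160 / g / l * (3 * (g * r ^+ 2)))); last first.
    rewrite ler_wpM2l ?divr_ge0 ?ltW // ltr_pM2l // rr //.
  have -> : 160 / g / l * (3 * (g * r ^+ 2)) = 480 * r ^+ 2 / l.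
    by field; rewrite !gt_eqF.
  rewrite ler_pdivlMr //; apply: (@le_trans _ _ (28 * r * l ^+ 2)).
    have gen (x y z : R) : 0 <= z -> x * z <= 4 * y * z -> 7 * (x * z) * z <= 28 * y * z ^+ 2.
      by move=> z0 h; have := ler_wpM2r z0 h; rewrite expr2; lra.
    exact: gen (ltW l0) tl.
  have : r * l ^+ 2 <= r * (16 * r) by rewrite ler_wpM2l // ltW.
  by have := sqr_ge0 r; rewrite !expr2; lra.
have e3 : ln 2 / 3 * (3 * m%:R) = m%:R * ln 2 :> R by field.
by apply: le_trans hln _; rewrite [leRHS]mulrDl e3; move: key l3; lra.
Qed.

End AlmostAll.

Theorem theorem16 (R : realType) :
  exists c_ru_minus c_ru_plus : R,
    [/\ ln 2 / 5 <= c_ru_minus, c_ru_minus <= c_ru_plus & c_ru_plus <= ln 2 / 3]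
    /\ exists K : R,
      almost_all_posets R (fun (N : nat) (P : labelled_poset N) =>
        [/\ (c_ru_minus%:E <= c_Ram_minus R (poset_of P) (poset_of P))%E,
            (c_Ram_minus R (poset_of P) (poset_of P)
               <= c_Ram_plus R (poset_of P) (poset_of P))%E
          & (c_Ram_plus R (poset_of P) (poset_of P)
               <= (c_ru_plus + K / ln N%:R)%:E)%E]).
Proof.
have l2 := ln2_gt0 R.
exists (ln 2 / 5), (ln 2 / 3); split; first by split; lra.
have [g [g0 hg]] := kleitman_rothschild R; exists (160 / g).
have [N1 hN1] := c_Ram_plus_three_layered g0.
apply: almost_all_of_rare => e e0; have [N2 hN2] := hg e e0.
exists (maxn 1 (maxn N1 N2)) => N; rewrite !geq_max => /and3P[N0 n1 n2].
apply: le_trans (hN2 N (rect R N) n2 (rect_ge R N)).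
rewrite ler_nat; apply/subset_leq_card/subsetP => P; rewrite !inE; apply: contra.
move=> /asboolP hP; apply/asboolP.
have [rank [r3 rlt]] := three_layered_rank hP.
split; [exact: c_Ram_minus_ge rlt|exact: c_Ram_minus_le_plus|exact: hN1].
Qed.
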